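(* Let $F\colon\mathbb{R}^d\to\mathbb{R}^m$ be a $C^2$-smooth map, $h\colon\mathbb{R}^m\to\mathbb{R}$ a convex function, and $r\colon\mathbb{R}^d\to\mathbb{R}\cup\{\infty\}$ a closed $\rho$-weakly convex function, and suppose there is a constant $\beta>0$ with $|h(F(y))-h(F(x)+\nabla F(x)(y-x))|\le\frac{\beta}{2}\|y-x\|^2$ for all $x,y\in\mathbb{R}^d$. Let $f(x)=h(F(x))+r(x)$ and let $\bar x$ be any critical point of $f$. Suppose the problem $\min_x f(x)$ admits a composite $C^2$ active manifold $\mathcal{M}$ at $\bar x$. Then for any $\mu\in(0,\rho^{-1})$, the proximal linear map $$S(x):=\mathrm{argmin}_{y}\ h(F(x)+\nabla F(x)(y-x))+r(y)+\frac{1}{2\mu}\|y-x\|^2$$ is $C^1$-smooth on a neighborhood of $\bar x$. Moreover, if $\bar x$ is a composite strict saddle point, then the Jacobian $\nabla S(\bar x)$ has a real eigenvalue strictly greater than one.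
   Context: A function $\varphi\colon\mathbb{R}^n\to\mathbb{R}\cup\{\infty\}$ is closed if its epigraph is closed; it is $\rho$-weakly convex ($\rho>0$) if $x\mapsto \varphi(x)+\frac{\rho}{2}\|x\|^2$ is convex. Subdifferential: if $\varphi(\bar x)$ is finite, $\partial\varphi(\bar x)$ is the set of $v$ with $\varphi(x)\ge\varphi(\bar x)+\langle v,x-\bar x\rangle+o(\|x-\bar x\|)$ as $x\to\bar x$; otherwise $\partial\varphi(\bar x)=\emptyset$. A point $\bar x$ is critical for $\varphi$ if $0\in\partial\varphi(\bar x)$. Manifolds: $\mathcal{M}\subset\mathbb{R}^n$ is a $C^p$ manifold of dimension $k$ around $\bar x\in\mathcal{M}$ if there are an open neighborhood $U$ of $\bar x$ and a $C^p$ map $G\colon\mathbb{R}^n\to\mathbb{R}^{n-k}$ with $\nabla G(\bar x)$ of full rank and $\mathcal{M}\cap U=\{x\in U:G(x)=0\}$. The tangent space is $T_{\mathcal{M}}(\bar x)=\ker\nabla G(\bar x)$. Active manifold: for a closed weakly convex $\varphi$ with critical point $\bar x$, a set $\mathcal{M}\ni\bar x$ is an active $C^p$ manifold at $\bar x$ if there is a neighborhood $U$ of $\bar x$ such that $\mathcal{M}\cap U$ is a $C^p$-smooth manifold, the restriction of $\varphi$ to $\mathcal{M}\cap U$ is $C^p$-smooth, and $\inf\{\|v\|:v\in\partial\varphi(x),\ x\in U\setminus\mathcal{M}\}>0$ (with $\inf\emptyset=+\infty$). For $x$ and $v\in\partial\varphi(x)$, a set $\mathcal{R}\ni x$ is a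 $C^2$ active manifold of $\varphi$ at $x$ for $v$ if it is a $C^2$ active manifold of $\varphi-\langle v,\cdot\rangle$ at $x$. Composite active manifold: let $\bar x$ be critical for $f=h\circ F+r$. Fix $\bar w\in\partial h(F(\bar x))$ and $\bar v\in\partial r(\bar x)$ with $0=\nabla F(\bar x)^*\bar w+\bar v$. Suppose (1) there exist $C^2$-smooth manifolds $\mathcal{R}\subset\mathbb{R}^d$ and $\mathcal{H}\subset\mathbb{R}^m$ containing $\bar x$ and $F(\bar x)$, respectively, with $\nabla F(\bar x)[T_{\mathcal{R}}(\bar x)]+T_{\mathcal{H}}(F(\bar x))=\mathbb{R}^m$; and (2) $\mathcal{R}$ is an active manifold of $r$ at $\bar x$ for $\bar v$ and $\mathcal{H}$ is an active manifold of $h$ at $F(\bar x)$ for $\bar w$ (both $C^2$). Then $\mathcal{M}:=\mathcal{R}\cap F^{-1}(\mathcal{H})$ is called a composite $C^2$ active manifold at $\bar x$. If in addition $d^2f_{\mathcal{M}}(\bar x)(u)<0$ for some $u\in T_{\mathcal{M}}(\bar x)$, then $\bar x$ is called a composite strict saddle point. Here $f_{\mathcal{M}}:=f+\delta_{\mathcal{M}}$ ($\delta_{\mathcal M}$ is $0$ on $\mathcal M$, $+\infty$ off it), and for $u\in T_{\mathcal{M}}(\bar x)$, $d^2f_{\mathcal{M}}(\bar x)(u)$ is the parabolic subderivative $\liminf_{t\searrow0,\,w'\to w}\frac{f_{\mathcal{M}}(\bar x+tu+\frac12t^2w')-f_{\mathcal{M}}(\bar x)}{\frac12t^2}$, whose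 value is the same for all $w$ for which it is finite. Equivalently, if $\hat f$ is a $C^2$ function agreeing with $f$ on $\mathcal{M}$ near $\bar x$, $G=0$ are local defining equations of $\mathcal{M}$, and $\bar\lambda$ is the multiplier with $\nabla\hat f(\bar x)+\sum_i\bar\lambda_i\nabla G_i(\bar x)=0$, then $d^2f_{\mathcal{M}}(\bar x)(u)=\langle(\nabla^2\hat f(\bar x)+\sum_i\bar\lambda_i\nabla^2G_i(\bar x))u,u\rangle$. *)

(* Defs.v *)
From HB Require Import structures.
From mathcomp Require Import all_boot all_order all_algebra.
From mathcomp Require Import all_classical all_reals all_analysis.

Set Implicit Arguments.
Unset Strict Implicit.
Unset Printing Implicit Defensive.

Import Order.TTheory GRing.Theory Num.Theory.
Import numFieldNormedType.Exports.

Local Open Scope classical_set_scope.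
Local Open Scope ring_scope.

(** Points of R^n are row vectors, so ['d F x u = u *m 'J F x] and the adjoint
    of ['d F x] is [w |-> w *m ('J F x)^T]. *)

Section Euclidean.
Context {R : realType} {n : nat}.
Implicit Types u v : 'rV[R]_n.

Definition dot u v : R := \sum_(i < n) u 0 i * v 0 i.

(** The library norm [`|u|] on matrices is the sup norm. *)
Definition norm2 u : R := Num.sqrt (dot u u).

End Euclidean.

(** C^p-smoothness on an open set [U]. *)
Fixpoint smooth_on {R : realType} {n : nat} {W : normedModType R} (p : nat)
    (U : set 'rV[R]_n) (f : 'rV[R]_n -> W) : Prop :=
  if p is p'.+1 then
    (forall x, U x -> differentiable f x) /\
    (forall v, smooth_on p' U (fun x => 'd f x v))
  else forall x, U x -> {for x, continuous f}.

(** A function to R ∪ {∞} is a map to [\bar R] that never takes the value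
    [-oo]; the definitions below are meant for such maps. *)
Section ExtendedValued.
Context {R : realType} {n : nat}.
Implicit Types (phi : 'rV[R]_n -> \bar R) (x u v w : 'rV[R]_n).
Local Open Scope ereal_scope.

Definition closed_function phi : Prop :=
  closed [set p : 'rV[R]_n * R | phi p.1 <= p.2%:E].

Definition econvex_function phi : Prop :=
  forall (t : R) x y, (0 <= t <= 1)%R ->
    phi (t *: x + (1 - t) *: y)%R <= t%:E * phi x + (1 - t)%:E * phi y.

Definition weakly_convex (rho : R) phi : Prop :=
  econvex_function (fun x => phi x + (rho / 2 * norm2 x ^+ 2)%:E).

(** The one-sided inequality "up to o(|x - xbar|)" is spelled out with epsilons
    because [phi x] may be infinite. *)
Definition subdifferential phi xbar : set 'rV[R]_n :=
  [set v | phi xbar \is a fin_num /\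
    forall eps : R, (0 < eps)%R -> \forall x \near xbar,
      phi xbar + (dot v (x - xbar) - eps * norm2 (x - xbar))%:E <= phi x].

Definition critical phi xbar : Prop := subdifferential phi xbar 0%R.

Definition infty_indicator (M : set 'rV[R]_n) x : \bar R :=
  if x \in M then 0 else +oo.

Definition tilt phi v x : \bar R := phi x - (dot v x)%:E.

(** Parabolic subderivative of [phi] at [x] for [u] with respect to [w]. *)
Definition parabolic_subderivative phi x u w : \bar R :=
  limf_einf
    (fun q : R * 'rV[R]_n =>
       (phi (x + q.1 *: u + (q.1 ^+ 2 / 2) *: q.2)%R - phi x)
       * ((q.1 ^+ 2 / 2)^-1)%:E)
    (filter_prod (0%R : R)^'+ (nbhs w)).

(** "d^2 phi (x)(u) is defined and equal to [a]": the parabolic subderivative is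
    finite and equal to [a] for some [w]; for the functions f_M considered below
    [a] does not depend on [w]. *)
Definition is_d2 phi x u (a : R) : Prop :=
  exists w, parabolic_subderivative phi x u w = a%:E.

End ExtendedValued.

Section Manifolds.
Context {R : realType} {n : nat}.
Implicit Types (p k : nat) (M U : set 'rV[R]_n) (x : 'rV[R]_n).

Definition local_equations p k M x (G : 'rV[R]_n -> 'rV[R]_(n - k)) : Prop :=
  smooth_on p setT G /\ \rank ('J G x) = (n - k)%N /\
  exists U, open_nbhs x U /\ M `&` U = [set y | U y /\ G y = 0].

Definition manifold_around p k M x : Prop :=
  (k <= n)%N /\ M x /\ exists G : 'rV[R]_n -> 'rV[R]_(n - k),
    local_equations p M x G.

Definition manifold p M : Prop :=
  exists k, forall x, M x -> manifold_around p k M x.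

(** The kernel does not depend on the choice of the local equations [G]. *)
Definition tangent p M x : set 'rV[R]_n :=
  [set u | exists k (G : 'rV[R]_n -> 'rV[R]_(n - k)),
    [/\ (k <= n)%N, local_equations p M x G & 'd G x u = 0]].

Definition smooth_restriction p (phi : 'rV[R]_n -> \bar R) M : Prop :=
  forall x, M x -> exists V (g : 'rV[R]_n -> R),
    [/\ open_nbhs x V, smooth_on p V g &
        forall y, M y -> V y -> phi y = (g y)%:E].

(** To be used for closed weakly convex [phi]. *)
Definition active_manifold p (phi : 'rV[R]_n -> \bar R) M xbar : Prop :=
  [/\ critical phi xbar, M xbar &
   exists U, [/\ nbhs xbar U, manifold p (M `&` U),
     smooth_restriction p phi (M `&` U) &
     (0 < ereal_inf [set (norm2 v)%:E | v in
            [set v | exists2 x, (U `\` M) x & subdifferential phi x v]])%E]].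

Definition active_manifold_for p (phi : 'rV[R]_n -> \bar R) M xbar v : Prop :=
  subdifferential phi xbar v /\ active_manifold p (tilt phi v) M xbar.

End Manifolds.

Section Composite.
Context {R : realType} {d m : nat}.
Variables (F : 'rV[R]_d -> 'rV[R]_m) (h : 'rV[R]_m -> R)
  (r : 'rV[R]_d -> \bar R).

Definition composite_objective (x : 'rV[R]_d) : \bar R :=
  ((h (F x))%:E + r x)%E.

Definition composite_active_manifold (M : set 'rV[R]_d) (xbar : 'rV[R]_d) :
    Prop :=
  exists (wbar : 'rV[R]_m) (vbar : 'rV[R]_d)
    (MR : set 'rV[R]_d) (MH : set 'rV[R]_m),
    [/\ [/\ subdifferential (EFin \o h) (F xbar) wbar,
            subdifferential r xbar vbar &
            0 = wbar *m ('J F xbar)^T + vbar],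
        [/\ exists k, manifold_around 2 k MR xbar,
            exists k, manifold_around 2 k MH (F xbar) &
            forall z : 'rV[R]_m, exists u w,
              [/\ tangent 2 MR xbar u, tangent 2 MH (F xbar) w &
                  z = 'd F xbar u + w]],
        active_manifold_for 2 r MR xbar vbar,
        active_manifold_for 2 (EFin \o h) MH (F xbar) wbar &
        M = MR `&` (F @^-1` MH)].

Definition composite_strict_saddle (xbar : 'rV[R]_d) : Prop :=
  critical composite_objective xbar /\
  exists M, composite_active_manifold M xbar /\
    exists u a, [/\ tangent 2 M xbar u,
      is_d2 (fun x => composite_objective x + infty_indicator M x)%E xbar u a &
      a < 0].

Definition proxlinear_objective (mu : R) (x y : 'rV[R]_d) : \bar R :=
  ((h (F x + 'd F x (y - x)))%:E + r y
   + ((2 * mu)^-1 * norm2 (y - x) ^+ 2)%:E)%E.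

Definition proxlinear_argmin (mu : R) (x : 'rV[R]_d) : set 'rV[R]_d :=
  [set y | forall z,
    (proxlinear_objective mu x y <= proxlinear_objective mu x z)%E].

End Composite.

(* Main.v *)
From HB Require Import structures.
Require Import Defs.
From mathcomp Require Import all_boot all_order all_algebra.
From mathcomp Require Import all_classical all_reals all_analysis.
From mathcomp Require Import ring lra.

Import Order.TTheory GRing.Theory Num.Theory.
Import numFieldNormedType.Exports.

Local Open Scope classical_set_scope.
Local Open Scope ring_scope.

Set Implicit Arguments.
Unset Strict Implicit.
Unset Printing Implicit Defensive.

(** Near [xbar] write the subproblem as the minimization over [y] of a smooth
    function [phi x y] under smooth constraints [G x y = 0]: convexity makes
    the subproblem strongly convex, so its solution [S x] exists, is unique and
    tends to [xbar]; the multiplier pair of [S x] tends to [(wbar, vbar)]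
    because transversality determines that pair; and since subgradients off the
    active manifolds stay away from [wbar] and [vbar], [S x] lies on the first
    manifold and the linearized value on the second one. The implicit function
    theorem applied to the KKT system then gives smoothness of [S].

    Let [H] be the Hessian in [y] of the Lagrangian of the subproblem at [xbar]
    and [Q] that of the Lagrangian of [f] on the manifold. Differentiating the
    KKT system gives [H (S' u - u) = - Q u] modulo normal vectors. [H] is
    positive definite on the tangent space, and at a strict saddle the Rayleigh
    quotient of [Q] with respect to [H] has a negative minimum [k], attained at
    an eigenvector [v], so [S' v = (1 - k) v]. *)

(** Convergence of the multipliers is the delicate point, because a subgradient of [r] near [x0] is
    controlled only in some directions. Along the first manifold [r] is smooth, so the subgradient
    inequality tested at points of that manifold controls [v - v0] on tangent vectors; [h] is
    treated alike. The multipliers of the subproblem satisfy [v - v0 = - (w - w0) (JF x0)^T] up to a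
    small error, and by transversality every direction is the image of a tangent vector of the first
    manifold plus a tangent vector of the second. Hence [w - w0], and with it [v - v0], tends to
    zero.

    [H] and [Q] come from one map, the derivative [A] of the [y]-gradient of the Lagrangian in the
    pair [(x, y)]: [H v = A (0, v)] and [Q v = A (v, v)]. The second belongs to [f] because the
    linearization error vanishes on the diagonal. For the same reason the constraints have zero
    [x]-derivative at the base point, so [S'] takes values in the tangent space; this is what lets a
    relation modulo normal vectors determine [S' v]. *)

Ltac move_front b :=
  try rewrite (addrC _ b);
  repeat (lazymatch goal with
          | |- b + _ = 0 => fail
          | |- _ => rewrite (addrCA _ b)
          end).

Ltac cancel_loop :=
  rewrite ?addr0 ?add0r;
  lazymatch goal with
  | |- 0 = 0 => reflexivity
  | |- - ?a + ?a = 0 => exact: addNr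
  | |- ?a + - ?a = 0 => exact: subrr
  | |- - ?a + ?r = 0 => move_front a; rewrite ?[a + (- a + _)]addNKr; cancel_loop
  | |- ?a + ?r = 0 => move_front (- a); rewrite ?[- a + (a + _)]addKr; cancel_loop
  end.

(** Identities in abelian groups, for vectors to which [ring] does not apply. *)
Ltac zmod := apply: subr0_eq; rewrite ?(opprD, opprK) -?addrA; cancel_loop.

Lemma ler_pM3 (R : numDomainType) (C a a' b b' : R) :
  0 <= C -> 0 <= a -> 0 <= b -> a <= a' -> b <= b' -> C * a * b <= C * a' * b'.
Proof. by move=> *; rewrite ler_pM ?mulr_ge0// ler_wpM2l. Qed.

(** * Strict derivatives *)

Section StrictDerivative.
Context {R : realType}.
Implicit Types U V W : normedModType R.

(** A predicate on plain functions, so that derivatives given by explicit formulas need not be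
    bundled; the bound stands for continuity. *)
Definition blin V W (L : V -> W) :=
  linear L /\ exists2 C, 0 <= C & forall v, `|L v| <= C * `|v|.

(** Strict differentiability compares two points near [x]. It obeys the same
    calculus as differentiability, and a map that is strictly differentiable at
    every point of an open set is C^1 there, so that C^1-smoothness can be
    handled pointwise. *)
Definition sdiff V W (f : V -> W) (x : V) (L : V -> W) :=
  blin L /\ forall e, 0 < e ->
    \forall p \near (x, x), `|f p.1 - f p.2 - L (p.1 - p.2)| <= e * `|p.1 - p.2|.

Definition has_diff V W (f : V -> W) x (L : V -> W) :=
  differentiable f x /\ 'd f x = L :> (V -> W).

Section BlinTheory.
Variables (V W : normedModType R) (L : V -> W) (hL : blin L).

Lemma blinD u v : L (u + v) = L u + L v.
Proof. by have := hL.1 1 u v; rewrite !scale1r. Qed.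

Lemma blin0 : L 0 = 0.
Proof. by apply: (addrI (L 0)); rewrite -blinD !addr0. Qed.

Lemma blinZ a u : L (a *: u) = a *: L u.
Proof. by have := hL.1 a u 0; rewrite !addr0 blin0 addr0. Qed.

Lemma blinN u : L (- u) = - L u.
Proof. by rewrite -scaleN1r blinZ scaleN1r. Qed.

Lemma blinB u v : L (u - v) = L u - L v.
Proof. by rewrite blinD blinN. Qed.

Lemma blin_cont : continuous L.
Proof.
have [_ [C C0 hC]] := hL.
move=> x; apply/cvgrPdist_le => e e0.
near=> y.
rewrite -blinB (le_trans (hC _))//.
have : `|x - y| <= e / (C + 1).
  near: y; apply: (@cvgr_dist_le _ _ _ (nbhs x) _ id x cvg_id).
  by rewrite divr_gt0//; lra.
rewrite ler_pdivlMr; last by lra.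
by have := normr_ge0 (x - y); nra.
Unshelve. all: by end_near. Qed.

End BlinTheory.

Lemma blin_id V : blin (id : V -> V).
Proof. by split; [move=> ? ? ?|exists 1 => // v; rewrite mul1r]. Qed.

Lemma blin_cst0 V W : blin (fun _ : V => 0 : W).
Proof.
split=> [a u v|]; first by rewrite scaler0 addr0.
by exists 0 => // v; rewrite normr0 mul0r.
Qed.

Lemma blin_add V W (L M : V -> W) : blin L -> blin M -> blin (fun v => L v + M v).
Proof.
move=> hL hM; split=> [a u v|].
  by rewrite !(blinD hL, blinD hM, blinZ hL, blinZ hM) scalerDr addrACA.
have [[_ [C C0 hC]] [_ [D D0 hD]]] := (hL, hM).
exists (C + D) => [|v]; first exact: addr_ge0.
by rewrite mulrDl (le_trans (ler_normD _ _))// lerD.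
Qed.

Lemma blin_scale V W a (L : V -> W) : blin L -> blin (fun v => a *: L v).
Proof.
move=> hL; split=> [b u v|].
  by rewrite !(blinD hL, blinZ hL) scalerDr !scalerA mulrC.
have [_ [C C0 hC]] := hL.
exists (`|a| * C) => [|v]; first exact: mulr_ge0.
by rewrite normrZ -mulrA ler_wpM2l.
Qed.

Lemma blin_comp U V W (L : V -> W) (M : U -> V) :
  blin L -> blin M -> blin (L \o M).
Proof.
move=> hL hM; split=> [a u v|] /=.
  by rewrite !(blinD hL, blinD hM, blinZ hL, blinZ hM).
have [[_ [C C0 hC]] [_ [D D0 hD]]] := (hL, hM).
exists (C * D) => [|v]; first exact: mulr_ge0.
by rewrite (le_trans (hC _))// -mulrA ler_wpM2l.
Qed.

Lemma blin_pair U V W (L : U -> V) (M : U -> W) :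
  blin L -> blin M -> blin (fun v => (L v, M v)).
Proof.
move=> hL hM; split=> [a u v|].
  by rewrite !(blinD hL, blinD hM, blinZ hL, blinZ hM).
have [[_ [C C0 hC]] [_ [D D0 hD]]] := (hL, hM).
exists (C + D) => [|v]; first exact: addr_ge0.
rewrite prod_normE ge_max /= mulrDl.
have := hC v; have := hD v.
by have := mulr_ge0 C0 (normr_ge0 v); have := mulr_ge0 D0 (normr_ge0 v); lra.
Qed.

Lemma blin_fst V W : blin (fst : V * W -> V).
Proof.
split=> [a u v|]//.
by exists 1 => // v; rewrite mul1r [leRHS]prod_normE le_max lexx.
Qed.

Lemma blin_snd V W : blin (snd : V * W -> W).
Proof.
split=> [a u v|]//.
by exists 1 => // v; rewrite mul1r [leRHS]prod_normE le_max lexx orbT.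
Qed.

Lemma coord_le_norm m n (A : 'M[R]_(m, n)) i j : `|A i j| <= `|A|.
Proof.
rewrite [leRHS]/Num.norm /= mx_normrE.
by apply: (@le_bigmax_cond _ _ _ _ (i, j) xpredT (fun ij => `|A ij.1 ij.2|)).
Qed.

Lemma mxnorm_le m n (A : 'M[R]_(m, n)) c :
  0 <= c -> (forall i j, `|A i j| <= c) -> `|A| <= c.
Proof.
move=> c0 hA; rewrite [leLHS]/Num.norm /= mx_normrE.
by apply: bigmax_le => // -[i j] _; apply: hA.
Qed.

Lemma lin_rV_blin n W (L : 'rV[R]_n -> W) : linear L -> blin L.
Proof.
move=> hL; split=> //.
have L0 : L 0 = 0 by have := hL (-1) 0 0; rewrite scaler0 addr0 scaleN1r addNr.
have LD u v : L (u + v) = L u + L v by have := hL 1 u v; rewrite !scale1r.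
have LZ a u : L (a *: u) = a *: L u by have := hL a u 0; rewrite L0 !addr0.
exists (\sum_i `|L (delta_mx 0 i)|) => [|v]; first exact: sumr_ge0.
rewrite {1}(row_sum_delta v) (big_morph L LD L0) mulr_suml.
rewrite (le_trans (ler_norm_sum _ _ _))//; apply: ler_sum => i _.
by rewrite LZ normrZ mulrC ler_wpM2l// coord_le_norm.
Qed.

Lemma mulmx_norm m n p (A : 'M[R]_(m, n)) (B : 'M[R]_(n, p)) :
  `|A *m B| <= n%:R * `|A| * `|B|.
Proof.
apply: mxnorm_le => [|i j]; first by rewrite !mulr_ge0.
rewrite mxE (le_trans (ler_norm_sum _ _ _))//.
rewrite (@le_trans _ _ (\sum_(k < n) `|A| * `|B|))//.
  by apply: ler_sum => k _; rewrite normrM ler_pM// coord_le_norm.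
by rewrite big_const_ord iter_addr_0 -mulrA mulr_natl.
Qed.

Lemma blin_mulmxl m n p (A : 'M[R]_(m, n)) :
  blin (fun B : 'M[R]_(n, p) => A *m B).
Proof.
split=> [a u v|]; first by rewrite mulmxDr -scalemxAr.
by exists (n%:R * `|A|) => [|v]; rewrite ?mulr_ge0// mulmx_norm.
Qed.

Lemma blin_mulmxr m n p (B : 'M[R]_(n, p)) :
  blin (fun A : 'M[R]_(m, n) => A *m B).
Proof.
split=> [a u v|]; first by rewrite mulmxDl -scalemxAl.
by exists (n%:R * `|B|) => [|v]; rewrite ?mulr_ge0// mulrAC mulmx_norm.
Qed.

Lemma norm_trmx m n (A : 'M[R]_(m, n)) : `|A^T| = `|A|.
Proof.
apply/eqP; rewrite eq_le; apply/andP; split; apply: mxnorm_le => // i j.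
  by rewrite mxE coord_le_norm.
by have := coord_le_norm A^T j i; rewrite mxE.
Qed.

Lemma blin_trmx m n : blin (fun A : 'M[R]_(m, n) => A^T).
Proof.
split=> [a u v|]; first by rewrite linearP.
by exists 1 => // v; rewrite mul1r norm_trmx.
Qed.

Lemma sdiff_lin V W (L : V -> W) x : blin L -> sdiff L x L.
Proof.
move=> hL; split=> // e e0; near=> p.
by rewrite -blinB// subrr normr0 mulr_ge0// ltW.
Unshelve. all: by end_near. Qed.

Lemma sdiff_cst V W (c : W) (x : V) : sdiff (fun _ => c) x (fun _ => 0).
Proof.
split=> [|e e0]; first exact: blin_cst0.
by near=> p; rewrite !subrr normr0 mulr_ge0// ltW.
Unshelve. all: by end_near. Qed.

Lemma sdiffD V W (f g : V -> W) x L M :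
  sdiff f x L -> sdiff g x M -> sdiff (fun y => f y + g y) x (fun v => L v + M v).
Proof.
move=> [hL hf] [hM hg]; split=> [|e e0]; first exact: blin_add.
have e20 : 0 < e / 2 by lra.
near=> p.
have : `|f p.1 - f p.2 - L (p.1 - p.2)| <= e / 2 * `|p.1 - p.2|.
  by near: p; apply: hf.
have : `|g p.1 - g p.2 - M (p.1 - p.2)| <= e / 2 * `|p.1 - p.2|.
  by near: p; apply: hg.
rewrite (_ : f p.1 + g p.1 - (f p.2 + g p.2) - (L (p.1 - p.2) + M (p.1 - p.2)) =
 (f p.1 - f p.2 - L (p.1 - p.2)) + (g p.1 - g p.2 - M (p.1 - p.2))).
  set u := f p.1 - _ - _; set v := g p.1 - _ - _.
  by move=> ? ?; have := ler_normD u v; lra.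
zmod.
Unshelve. all: by end_near. Qed.

Lemma sdiff_cvg V W (f : V -> W) x L : sdiff f x L -> f y @[y --> x] --> f x.
Proof.
move=> [[_ [C C0 hC]] /(_ _ ltr01) hf].
have [[A B] /= [nA nB] AB] : nbhs (x, x)
  [set p | `|f p.1 - f p.2 - L (p.1 - p.2)| <= 1 * `|p.1 - p.2|] by exact: hf.
apply/cvgrPdist_le => e e0.
near=> y.
have /AB /= : (A `*` B) (x, y).
  by split=> /=; [exact: nbhs_singleton|near: y].
have : `|x - y| <= e / (C + 1).
  near: y; apply: (@cvgr_dist_le _ _ _ (nbhs x) _ id x cvg_id).
  by rewrite divr_gt0//; lra.
rewrite ler_pdivlMr; last by lra.
rewrite mul1r; have := hC (x - y).
set a := f x - f y; set b := L _ => h1 h2 h3.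
have : `|a| <= `|a - b| + `|b| by rewrite -{1}(subrK b a) ler_normD.
by have := normr_ge0 (x - y); lra.
Unshelve. all: by end_near. Qed.

Lemma sdiff_lip V W (f : V -> W) x L : sdiff f x L ->
  exists2 C, 0 < C & \forall p \near (x, x), `|f p.1 - f p.2| <= C * `|p.1 - p.2|.
Proof.
move=> [[_ [C C0 hC]] /(_ _ ltr01) hf].
exists (C + 1); first by lra.
near=> p.
have : `|f p.1 - f p.2 - L (p.1 - p.2)| <= 1 * `|p.1 - p.2| by near: p.
have := hC (p.1 - p.2).
set a := f _ - f _; set b := L _ => h1 h2.
have : `|a| <= `|a - b| + `|b| by rewrite -{1}(subrK b a) ler_normD.
by lra.
Unshelve. all: by end_near. Qed.

Lemma cvg_pair_diag V W (f : V -> W) x : f y @[y --> x] --> f x ->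
  (f p.1, f p.2) @[p --> (x, x)] --> (f x, f x).
Proof.
by move=> h; apply: cvg_pair; [apply: cvg_comp; [exact: cvg_fst|]|
  apply: cvg_comp; [exact: cvg_snd|]].
Qed.

Lemma sdiff_comp U V W (f : V -> W) (g : U -> V) x L M :
  sdiff f (g x) L -> sdiff g x M -> sdiff (f \o g) x (L \o M).
Proof.
move=> [hL hf] hg; have cg := sdiff_cvg hg; have [C C0 gC] := sdiff_lip hg.
case: hg => hM hg; split=> [|e e0]; first exact: blin_comp.
have [_ [D D0 hD]] := hL.
have eC : 0 < e / (2 * C) by rewrite divr_gt0//; lra.
near=> p => /=.
have : `|g p.1 - g p.2| <= C * `|p.1 - p.2| by near: p.
have : `|f (g p.1) - f (g p.2) - L (g p.1 - g p.2)| <=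
    e / (2 * C) * `|g p.1 - g p.2|.
  by near: p; exact: (cvg_pair_diag cg (hf _ eC)).
have : `|g p.1 - g p.2 - M (p.1 - p.2)| <= e / (2 * (D + 1)) * `|p.1 - p.2|.
  by near: p; apply: hg; rewrite divr_gt0//; lra.
set a := f _ - f _; set b := g _ - g _; set w := p.1 - p.2 => h1 h2 h3.
have := hD (b - M w); rewrite blinB// => h4.
have : `|a - L (M w)| <= `|a - L b| + `|L b - L (M w)| by rewrite -[X in `|X| <= _](subrKA (L b)) ler_normD.
have : e / (2 * C) * `|b| <= e / 2 * `|w|.
  rewrite (le_trans (ler_wpM2l _ h3))//; first by rewrite divr_ge0 //; lra.
  by rewrite le_eqVlt; apply/orP; left; apply/eqP; field; lra.
have : D * `|b - M w| <= e / 2 * `|w|.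
  rewrite (@le_trans _ _ ((D + 1) * `|b - M w|))//.
    by rewrite ler_wpM2r//; lra.
  rewrite (le_trans (ler_wpM2l _ h1))//; first by lra.
  by rewrite le_eqVlt; apply/orP; left; apply/eqP; field; lra.
by lra.
Unshelve. all: by end_near. Qed.

Lemma sdiff_pair U V W (f : U -> V) (g : U -> W) x L M :
  sdiff f x L -> sdiff g x M -> sdiff (fun y => (f y, g y)) x (fun v => (L v, M v)).
Proof.
move=> [hL hf] [hM hg]; split=> [|e e0]; first exact: blin_pair.
near=> p.
by rewrite prod_normE ge_max /=; apply/andP; split; near: p; [apply: hf|apply: hg].
Unshelve. all: by end_near. Qed.

(** One product rule that serves matrix products and dot products. *)
Lemma sdiff_bilin U V1 V2 W (b : V1 -> V2 -> W) (f : U -> V1) (g : U -> V2) x L M C :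
  (forall u, linear (b u)) -> (forall v, linear (b^~ v)) ->
  (forall u v, `|b u v| <= C * `|u| * `|v|) ->
  sdiff f x L -> sdiff g x M ->
  sdiff (fun y => b (f y) (g y)) x (fun v => b (L v) (g x) + b (f x) (M v)).
Proof.
move=> linr linl hC sf sg.
wlog C0 : C hC / 0 < C.
  move=> h; apply: (h (`|C| + 1)) => [u v|]; last by have := normr_ge0 C; lra.
  rewrite (le_trans (hC u v))//.
  rewrite ler_wpM2r// ler_wpM2r//; have := ler_norm C; lra.
have bl1 v : blin (b^~ v).
  split=> //; exists (C * `|v|) => [|u]; first by rewrite mulr_ge0//; lra.
  by rewrite mulrAC.
have bl2 u : blin (b u).
  by split=> //; exists (C * `|u|) => [|v//]; rewrite mulr_ge0//; lra.
have cf := sdiff_cvg sf; have cg := sdiff_cvg sg.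
have := sf; have := sg => -[hM hg] [hL hf].
split.
  apply: blin_add; first exact: (blin_comp (bl1 (g x)) hL).
  exact: (blin_comp (bl2 (f x)) hM).
move=> e e0.
have [_ [D D0 hD]] := hL; have [_ [E E0 hE]] := hM.
(* The error splits below into four terms, each bounded by [e1 * |w|] times [C] and one of the
   factors summed here; so [e1 * K <= e / 4] makes each of them at most a quarter of the allowed
   error. *)
pose K := C * (`|f x| + `|g x| + D + E + 1).
have K0 : 0 < K by rewrite mulr_gt0//; have := normr_ge0 (f x); have := normr_ge0 (g x); lra.
pose e1 := Num.min 1 (e / (4 * K)).
have e10 : 0 < e1.
  by rewrite lt_min ltr01 /= divr_gt0//; lra.
have e1K : e1 * K <= e / 4.
  rewrite -ler_pdivlMr// (le_trans (_ : _ <= e / (4 * K)))//.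
    by rewrite ge_min lexx orbT.
  by rewrite le_eqVlt; apply/orP; left; apply/eqP; field; lra.
have n3 : \forall p \near (x, x), `|f x - f p.2| <= e1.
  have : (f \o snd) p @[p --> (x, x)] --> f x by apply: cvg_comp cf; exact: cvg_snd.
  by move/cvgrPdist_le; apply.
have n4 : \forall p \near (x, x), `|g x - g p.1| <= e1.
  have : (g \o fst) p @[p --> (x, x)] --> g x by apply: cvg_comp cg; exact: cvg_fst.
  by move/cvgrPdist_le; apply.
near=> p.
have h1 : `|f p.1 - f p.2 - L (p.1 - p.2)| <= e1 * `|p.1 - p.2|.
  by near: p; apply: hf.
have h2 : `|g p.1 - g p.2 - M (p.1 - p.2)| <= e1 * `|p.1 - p.2|.
  by near: p; apply: hg.
have h3 : `|f x - f p.2| <= e1 by near: p.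
have h4 : `|g x - g p.1| <= e1 by near: p.
have h5 : `|g p.1| <= `|g x| + 1.
  have : `|g p.1| <= `|g x - g p.1| + `|g x|.
    by rewrite distrC -{1}(subrK (g x) (g p.1)) ler_normD.
  by have : e1 <= 1 by [rewrite ge_min lexx]; lra.
have h6 : `|f p.2| <= `|f x| + 1.
  have : `|f p.2| <= `|f x - f p.2| + `|f x|.
    by rewrite distrC -{1}(subrK (f x) (f p.2)) ler_normD.
  by have : e1 <= 1 by [rewrite ge_min lexx]; lra.
set w := p.1 - p.2 in h1 h2 *.
rewrite (_ : _ - _ - _ = b (f p.1 - f p.2 - L w) (g p.1) + b (L w) (g p.1 - g x)
   + b (f p.2) (g p.1 - g p.2 - M w) + b (f p.2 - f x) (M w)); last first.
  rewrite !(blinB (bl1 _), blinB (bl2 _)).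
  zmod.
have {h1} H1 : `|b (f p.1 - f p.2 - L w) (g p.1)| <= e / 4 * `|w|.
  rewrite (le_trans (hC _ _))//.
  rewrite (@le_trans _ _ (C * (e1 * `|w|) * (`|g x| + 1)))//.
    by apply: ler_pM3; rewrite ?mulr_ge0// ltW.
  rewrite (_ : C * _ * _ = e1 * (C * (`|g x| + 1)) * `|w|); last by ring.
  rewrite ler_wpM2r// (le_trans _ e1K)// ler_pM2l// ler_pM2l//.
  by have := normr_ge0 (f x); lra.
have {h4} H2 : `|b (L w) (g p.1 - g x)| <= e / 4 * `|w|.
  rewrite (le_trans (hC _ _))// distrC.
  rewrite (@le_trans _ _ (C * (D * `|w|) * e1))//.
    by apply: ler_pM3; rewrite ?mulr_ge0// ltW.
  rewrite (_ : C * _ * _ = e1 * (C * D) * `|w|); last by ring.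
  rewrite ler_wpM2r// (le_trans _ e1K)// ler_pM2l// ler_pM2l//.
  by have := normr_ge0 (f x); have := normr_ge0 (g x); lra.
have {h2} H3 : `|b (f p.2) (g p.1 - g p.2 - M w)| <= e / 4 * `|w|.
  rewrite (le_trans (hC _ _))//.
  rewrite (@le_trans _ _ (C * (`|f x| + 1) * (e1 * `|w|)))//.
    by apply: ler_pM3; rewrite ?mulr_ge0// ltW.
  rewrite (_ : C * _ * _ = e1 * (C * (`|f x| + 1)) * `|w|); last by ring.
  rewrite ler_wpM2r// (le_trans _ e1K)// ler_pM2l// ler_pM2l//.
  by have := normr_ge0 (g x); lra.
have {h3} H4 : `|b (f p.2 - f x) (M w)| <= e / 4 * `|w|.
  rewrite (le_trans (hC _ _))// distrC.
  rewrite (@le_trans _ _ (C * e1 * (E * `|w|)))//.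
    by apply: ler_pM3; rewrite ?mulr_ge0// ltW.
  rewrite (_ : C * _ * _ = e1 * (C * E) * `|w|); last by ring.
  rewrite ler_wpM2r// (le_trans _ e1K)// ler_pM2l// ler_pM2l//.
  by have := normr_ge0 (f x); have := normr_ge0 (g x); lra.
have := ler_normD (b (f p.1 - f p.2 - L w) (g p.1) + b (L w) (g p.1 - g x)
   + b (f p.2) (g p.1 - g p.2 - M w)) (b (f p.2 - f x) (M w)).
have := ler_normD (b (f p.1 - f p.2 - L w) (g p.1) + b (L w) (g p.1 - g x))
   (b (f p.2) (g p.1 - g p.2 - M w)).
have := ler_normD (b (f p.1 - f p.2 - L w) (g p.1)) (b (L w) (g p.1 - g x)).
by lra.
Unshelve. all: by end_near. Qed.

Lemma sdiff_mulmx U m n p (f : U -> 'M[R]_(m, n)) (g : U -> 'M[R]_(n, p)) x L M :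
  sdiff f x L -> sdiff g x M ->
  sdiff (fun y => f y *m g y) x (fun v => L v *m g x + f x *m M v).
Proof.
apply: (@sdiff_bilin _ _ _ _ (@mulmx _ m n p) f g x L M n%:R) => //.
- by move=> u a v w; rewrite mulmxDr -scalemxAr.
- by move=> u a v w; rewrite mulmxDl -scalemxAl.
- exact: mulmx_norm.
Qed.

(** Both derivatives are compared with the same increment of [f] from [y] to [y + t v], [t] small:
    strictness at [x] controls it by [L], since both points are near [x], and strictness at [y] by
    [L']. *)
Lemma sdiff_near_deriv V W (f : V -> W) x L e : sdiff f x L -> 0 < e ->
  \forall y \near x, forall L', sdiff f y L' -> forall v, `|L' v - L v| <= e * `|v|.
Proof.
move=> [hL hf] e0; have e20 : 0 < e / 2 by lra.
have [[A B] /= [nA nB] AB] : nbhs (x, x)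
  [set p | `|f p.1 - f p.2 - L (p.1 - p.2)| <= e / 2 * `|p.1 - p.2|] by exact: hf.
have nAB : nbhs x (A `&` B) by apply: filterI.
near=> y => L' [hL' hf'] v.
have [->|v0] := eqVneq v 0; first by rewrite (blin0 hL') (blin0 hL) subrr !normr0 mulr0.
have [[A' B'] /= [nA' nB'] AB'] : nbhs (y, y)
  [set p | `|f p.1 - f p.2 - L' (p.1 - p.2)| <= e / 2 * `|p.1 - p.2|] by exact: hf'.
have nC : nbhs y ((A `&` B) `&` (A' `&` B')).
  apply: filterI; last exact: filterI.
  by near: y; exact: nbhs_interior.
have [t [t0 ht]] : exists t, 0 < t /\ ((A `&` B) `&` (A' `&` B')) (y + t *: v).
  have /nbhs_ballP [d /= d0 dC] := nC.
  exists (d / (2 * `|v|)); have v0' : 0 < `|v| by rewrite normr_gt0.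
  split; first by rewrite divr_gt0//; lra.
  apply: dC; rewrite -ball_normE /= opprD addrA subrr add0r normrN normrZ.
  rewrite gtr0_norm ?divr_gt0//; last by lra.
  by rewrite invfM mulrA divfK ?gt_eqF//; lra.
have [[Ay By] [A'y B'y]] := nbhs_singleton nC.
have /AB /= : (A `*` B) (y + t *: v, y) by split; [exact: ht.1.1|].
have /AB' /= : (A' `*` B') (y + t *: v, y) by split; [exact: ht.2.1|].
rewrite (addrC y) addrK (blinZ hL) (blinZ hL') normrZ gtr0_norm//.
set a := _ - f y => h1 h2.
rewrite -(ler_pM2l t0) -{1}(gtr0_norm t0) -normrZ scalerBr.
have -> : t *: L' v - t *: L v = (a - t *: L v) - (a - t *: L' v).
  zmod.
by have := ler_normB (a - t *: L v) (a - t *: L' v); lra.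
Unshelve. all: by end_near. Qed.

Lemma sdiff_near_eq V W (f g : V -> W) x L :
  (\forall y \near x, f y = g y) -> sdiff f x L -> sdiff g x L.
Proof.
move=> fg [hL hf]; split=> // e e0.
have [[A B] /= [nA nB] AB] : nbhs (x, x)
  [set p | `|f p.1 - f p.2 - L (p.1 - p.2)| <= e * `|p.1 - p.2|] by exact: hf.
exists (A `&` [set y | f y = g y], B `&` [set y | f y = g y]) => /=.
  by split; apply: filterI.
by move=> [y z] /= [[Ay fy] [Bz fz]]; rewrite -fy -fz; apply: (AB (y, z)).
Qed.

Lemma sdiff_uniq V W (f : V -> W) x L L' : sdiff f x L -> sdiff f x L' -> L = L'.
Proof.
move=> h h'; apply/funext => v; apply/eqP; rewrite eq_sym -subr_eq0 -normr_eq0.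
rewrite eq_le normr_ge0 andbT; apply/ler_addgt0Pl => e e0; rewrite addr0.
have e'0 : 0 < e / (`|v| + 1) by rewrite divr_gt0//; have := normr_ge0 v; lra.
have := nbhs_singleton (sdiff_near_deriv h e'0) _ h' v.
move=> /le_trans; apply; rewrite mulrAC ler_pdivrMr; last by have := normr_ge0 v; lra.
by rewrite ler_pM2l//; lra.
Qed.

Lemma sdiff_diff V W (f : V -> W) x L : sdiff f x L ->
  has_diff f x L.
Proof.
move=> [hL hf].
pose LM := GRing.isLinear.Build _ _ _ _ _ hL.1.
pose LL : {linear V -> W} := HB.pack L LM.
have cL : continuous LL by exact: (blin_cont hL).
have fL : f \o shift x = cst (f x) + LL +o_ 0 id.
  apply/eqaddoP => e e0.
  have [[A B] /= [nA nB] AB] : nbhs (x, x)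
    [set p | `|f p.1 - f p.2 - L (p.1 - p.2)| <= e * `|p.1 - p.2|] by exact: hf.
  have nA0 : \forall v \near 0, A (v + x).
    by move: nA; rewrite -[nbhs x A]/(\forall z \near x, A z) (near_shift 0 x) subr0.
  near=> v.
  have /AB /= : (A `*` B) (v + x, x) by split; [near: v|exact: nbhs_singleton].
  by rewrite addrK -addrA -opprD.
have dE : 'd f x = LL :> (V -> W) by apply: diff_unique.
split; last by rewrite dE.
by apply/diff_locallyP; rewrite dE.
Unshelve. all: by end_near. Qed.

Lemma cont_distP V W (f : V -> W) x : {for x, continuous f} <->
  forall e, 0 < e -> \forall y \near x, `|f x - f y| <= e.
Proof. exact: cvgrPdist_le. Qed.

Lemma near_forall (T : topologicalType) (I : finType) (P : I -> T -> Prop) (x : T) :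
  (forall i, \forall y \near x, P i y) -> \forall y \near x, forall i, P i y.
Proof. exact: filter_forall. Qed.

Lemma sdiff_cont V W (U : set V) (f : V -> W) L v x :
  (\forall y \near x, sdiff f y (L y)) -> {for x, continuous (fun y => 'd f y v)}.
Proof.
move=> h; apply/cont_distP => e e0.
have e'0 : 0 < e / (`|v| + 1) by rewrite divr_gt0//; have := normr_ge0 v; lra.
have hx := nbhs_singleton h.
apply: filterS2 h (sdiff_near_deriv hx e'0) => y hy.
rewrite (sdiff_diff hx).2 (sdiff_diff hy).2 distrC => /(_ _ hy v).
move=> /le_trans; apply; rewrite mulrAC ler_pdivrMr; last by have := normr_ge0 v; lra.
by rewrite ler_pM2l//; lra.
Qed.

Lemma sdiff_smooth n W (U : set 'rV[R]_n) (f : 'rV[R]_n -> W) L :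
  open U -> (forall x, U x -> sdiff f x (L x)) -> smooth_on 1 U f.
Proof.
move=> oU h; split=> [x Ux|v x Ux]; first exact: (sdiff_diff (h x Ux)).1.
apply: (@sdiff_cont _ _ U f L v x).
by apply: filterS (open_nbhs_nbhs (conj oU Ux)) => y; exact: h.
Qed.

Lemma affine_sdiff V (x w : V) (t : R) :
  sdiff (fun s : R => x + s *: w) t (fun s => s *: w).
Proof.
have hL : blin (fun s : R => s *: w).
  split=> [a u v|]; first by rewrite scalerDl scalerA.
  by exists `|w| => // s; rewrite normrZ mulrC.
have := sdiffD (sdiff_cst x t) (sdiff_lin t hL).
by under [X in sdiff _ _ X -> _]eq_fun do rewrite add0r.
Qed.

Lemma has_diff_lin V W (f : V -> W) x L : has_diff f x L -> linear L.
Proof. by move=> [_ <-] a u v; rewrite linearP. Qed.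

Lemma mvt_segment V (f : V -> R) (x w : V) (D : R -> V -> R) :
  (forall t, 0 <= t <= 1 -> has_diff f (x + t *: w) (D t)) ->
  exists2 t, 0 < t < 1 & f (x + w) - f x = D t w.
Proof.
move=> hf; pose g := f \o (fun s : R => x + s *: w).
have da t : has_diff (fun s : R => x + s *: w) t (fun s => s *: w).
  exact: sdiff_diff (affine_sdiff x w t).
have dg (t : R) : 0 <= t <= 1 -> differentiable g t.
  by move=> /hf[? _]; apply: differentiable_comp => //; exact: (da t).1.
have dgE (t : R) : 0 <= t <= 1 -> is_derive t 1 g (D t w).
  move=> t01; apply: DeriveDef; first exact/diff_derivable/dg.
  have [hf1 hf2] := hf t t01.
  rewrite deriveE; last exact: dg.
  rewrite diff_comp; [|exact: (da t).1|exact: hf1].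
  by rewrite /= (da t).2 scale1r hf2.
have [t|t|t] := @MVT R g (fun t => D t w) 0 1 ltr01.
- by rewrite in_itv /= => /andP[t0 t1]; apply: dgE; rewrite !ltW.
- apply: derivable_within_continuous => s; rewrite in_itv /= => s01.
  exact/diff_derivable/dg.
rewrite in_itv /= => t01; rewrite /g /= scale0r addr0 scale1r subr0 mulr1 => ->.
by exists t.
Qed.

Lemma ball_segment V (x a b : V) d t : 0 <= t <= 1 -> `|x - a| < d -> `|x - b| < d ->
  `|x - (b + t *: (a - b))| < d.
Proof.
move=> /andP[t0 t1] ha hb.
rewrite (_ : x - _ = t *: (x - a) + (1 - t) *: (x - b)); last first.
  by rewrite scalerBl scale1r !scalerBr; zmod.
rewrite (le_lt_trans (ler_normD _ _))// !normrZ (ger0_norm t0) ger0_norm ?subr_ge0//.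
have := normr_ge0 (x - a); have := normr_ge0 (x - b).
have [->|t00] := eqVneq t 0; first by rewrite mul0r add0r subr0 mul1r.
have : 0 < t by rewrite lt_neqAle eq_sym t00.
by nra.
Qed.

Lemma rV_lin_le n (L M : 'rV[R]_n -> R) c w : linear L -> linear M ->
  (forall i, `|L (delta_mx 0 i) - M (delta_mx 0 i)| <= c) ->
  `|L w - M w| <= n%:R * c * `|w|.
Proof.
move=> /lin_rV_blin hL /lin_rV_blin hM h.
have E (N : 'rV[R]_n -> R) : blin N -> N w = \sum_i w 0 i * N (delta_mx 0 i).
  move=> hN; rewrite {1}(row_sum_delta w) (big_morph N (blinD hN) (blin0 hN)).
  by apply: eq_bigr => i _; rewrite (blinZ hN).
rewrite (E L)// (E M)// -sumrB.
rewrite (le_trans (ler_norm_sum _ _ _))//.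
rewrite (@le_trans _ _ (\sum_(i < n) c * `|w|))//.
  apply: ler_sum => i _; rewrite -mulrBr normrM mulrC.
  by rewrite ler_pM// coord_le_norm.
by rewrite big_const_ord iter_addr_0 -mulrA mulr_natl.
Qed.

Lemma nearS (T : topologicalType) (P Q : T -> Prop) (x : T) :
  (forall y, P y -> Q y) -> (\forall y \near x, P y) -> \forall y \near x, Q y.
Proof. exact: filterS. Qed.

Lemma nearS2 (T : topologicalType) (P Q S : T -> Prop) (x : T) :
  (forall y, P y -> Q y -> S y) -> (\forall y \near x, P y) ->
  (\forall y \near x, Q y) -> \forall y \near x, S y.
Proof. exact: filterS2. Qed.

Lemma nearI (T : topologicalType) (P Q : T -> Prop) (x : T) :
  (\forall y \near x, P y) -> (\forall y \near x, Q y) -> \forall y \near x, P y /\ Q y.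
Proof. exact: filterI. Qed.

Lemma near_open (T : topologicalType) (U : set T) x : open U -> U x -> \forall y \near x, U y.
Proof. by move=> oU Ux; apply: open_nbhs_nbhs. Qed.

Lemma near_distP V (P : V -> Prop) (x : V) : (\forall y \near x, P y) <->
  exists2 d, 0 < d & forall y, `|x - y| < d -> P y.
Proof.
split=> [/nbhs_ballP [d /= d0 dB]|[d d0 dB]].
  by exists d => // y xy; apply: dB; rewrite -ball_normE.
by apply/nbhs_ballP; exists d => //= y; rewrite -ball_normE; exact: dB.
Qed.

Lemma near2_distP V (P : V * V -> Prop) (x : V) : (\forall p \near (x, x), P p) <->
  exists2 d, 0 < d & forall y z, `|x - y| < d -> `|x - z| < d -> P (y, z).
Proof.
split=> [[[A B] /= [/near_distP [a a0 hA] /near_distP [b b0 hB]] AB]|[d d0 dB]].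
  exists (Num.min a b) => [|y z]; first by rewrite lt_min a0 b0.
  rewrite !lt_min => /andP[ya _] /andP[_ zb].
  by apply: (AB (y, z)); split; [exact: hA|exact: hB].
exists (ball x d, ball x d); first by split; apply: nbhsx_ballx.
by move=> [y z] /=; rewrite -ball_normE /= => -[]; exact: dB.
Qed.

Lemma sdiffP V W (f : V -> W) x L : sdiff f x L <-> blin L /\
  forall e, 0 < e -> exists2 d, 0 < d &
    forall a b, `|x - a| < d -> `|x - b| < d -> `|f a - f b - L (a - b)| <= e * `|a - b|.
Proof.
split=> -[hL h]; split=> // e /h; first by move/near2_distP.
by move=> [d d0 hd]; apply/near2_distP; exists d.
Qed.

(** The mean value theorem on the segment from [b] to [a] turns the increment into a derivative at a
    point near [x], which is close to [D x] on each basis vector. *)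
Lemma sdiff_scalar n (f : 'rV[R]_n -> R) (D : 'rV[R]_n -> 'rV[R]_n -> R) x :
  (\forall y \near x, has_diff f y (D y)) ->
  (forall i e, 0 < e ->
    \forall y \near x, `|D x (delta_mx 0 i) - D y (delta_mx 0 i)| <= e) ->
  sdiff f x (D x).
Proof.
move=> df cdf; have lDx := has_diff_lin (nbhs_singleton df).
apply/sdiffP; split=> [|e e0]; first exact: lin_rV_blin.
have c0 : 0 < e / (n%:R + 1) by rewrite divr_gt0// ltr_wpDl.
have nD : \forall y \near x, forall i : 'I_n,
    `|D x (delta_mx 0 i) - D y (delta_mx 0 i)| <= e / (n%:R + 1).
  by apply: near_forall => i; exact: cdf.
have /near_distP [d d0 dB] := nearI df nD.
exists d => // a b xa xb.
have seg t : 0 <= t <= 1 -> `|x - (b + t *: (a - b))| < d.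
  by move=> t01; apply: ball_segment.
have [t t01|t /andP[t0 t1]] := @mvt_segment _ f b (a - b) (fun t => D (b + t *: (a - b))).
  by have [] := dB _ (seg t t01).
have -> : b + (a - b) = a by rewrite addrC subrK.
move=> ->.
have t01 : 0 <= t <= 1 by rewrite !ltW.
have [fD hD] := dB _ (seg t t01).
have {}fD := has_diff_lin fD.
rewrite distrC (le_trans (rV_lin_le _ lDx fD hD))// ler_wpM2r//.
by rewrite mulrA ler_pdivrMr ?ltr_wpDl// mulrC ler_pM2l//; lra.
Qed.

Lemma smooth_sdiff1 n (U : set 'rV[R]_n) (f : 'rV[R]_n -> R) x :
  open U -> smooth_on 1 U f -> U x -> sdiff f x ('d f x).
Proof.
move=> oU [df cdf] Ux; apply: (@sdiff_scalar _ f (fun y => 'd f y)).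
  by apply: nearS (near_open oU Ux) => y Uy; split=> //; exact: df.
by move=> i; exact/cont_distP/cdf.
Qed.

Lemma sdiff_mx n p q (f : 'rV[R]_n -> 'M[R]_(p, q)) x (L : 'rV[R]_n -> 'M[R]_(p, q)) :
  (forall i j, sdiff (fun y => f y i j) x (fun v => L v i j)) -> sdiff f x L.
Proof.
move=> h; split=> [|e e0].
  apply: lin_rV_blin => a u v; apply/matrixP => i j.
  by have [[hl _] _] := h i j; rewrite !mxE -hl.
have H : \forall z \near (x, x), forall i j,
    `|f z.1 i j - f z.2 i j - L (z.1 - z.2) i j| <= e * `|z.1 - z.2|.
  by apply: near_forall => i; apply: near_forall => j; apply: (h i j).2.
apply: nearS H => z H; apply: mxnorm_le => [|i j]; first by rewrite mulr_ge0// ltW.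
by rewrite !mxE; exact: H.
Qed.

Lemma blin_coord m n (i : 'I_m) (j : 'I_n) : blin (fun A : 'M[R]_(m, n) => A i j).
Proof.
split=> [a u v|]; first by rewrite !mxE.
by exists 1 => // v; rewrite mul1r coord_le_norm.
Qed.

Lemma diff_coord n m (f : 'rV[R]_n -> 'rV[R]_m) j y :
  differentiable f y -> has_diff (fun x => f x 0 j) y (fun v => 'd f y v 0 j).
Proof.
move=> df; have [dc dcE] := sdiff_diff (sdiff_lin (f y) (blin_coord 0 j)).
split; first exact: (differentiable_comp df dc).
by rewrite (diff_comp df dc) dcE.
Qed.

Lemma smooth_sdiff n m (U : set 'rV[R]_n) (f : 'rV[R]_n -> 'rV[R]_m) x :
  open U -> smooth_on 1 U f -> U x -> sdiff f x ('d f x).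
Proof.
move=> oU [df cdf] Ux; apply: sdiff_mx => i j; rewrite ord1.
apply: (@sdiff_scalar _ (fun y => f y 0 j) (fun y v => 'd f y v 0 j)).
  by apply: nearS (near_open oU Ux) => y Uy; apply/diff_coord/df.
move=> k e e0; have /cont_distP/(_ e e0) := cdf (delta_mx 0 k) x Ux.
apply: nearS => y; apply: le_trans.
by have := coord_le_norm ('d f x (delta_mx 0 k) - 'd f y (delta_mx 0 k)) 0 j; rewrite !mxE.
Qed.

Lemma jacobian_sdiff n m (U : set 'rV[R]_n) (f : 'rV[R]_n -> 'rV[R]_m) x :
  open U -> smooth_on 2 U f -> U x -> exists L, sdiff (fun y => 'J f y) x L.
Proof.
move=> oU [df sdf] Ux.
exists (fun v => \matrix_(i, j) ('d (fun y => 'd f y (delta_mx 0 i)) x v) 0 j).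
apply: sdiff_mx => i j.
have := smooth_sdiff oU (sdf (delta_mx 0 i)) Ux.
move=> /(sdiff_comp (sdiff_lin _ (blin_coord 0 j))).
congr sdiff; apply/funext => y /=; rewrite !mxE//.
Qed.

Definition grad n (f : 'rV[R]_n -> R) x : 'rV[R]_n := \row_i 'd f x (delta_mx 0 i).

Lemma dot_grad n (f : 'rV[R]_n -> R) x v : dot (grad f x) v = 'd f x v.
Proof.
rewrite {2}(row_sum_delta v) linear_sum; apply: eq_bigr => i _.
by rewrite linearZ mxE mulrC.
Qed.

Lemma grad_sdiff n (U : set 'rV[R]_n) (f : 'rV[R]_n -> R) x :
  open U -> smooth_on 2 U f -> U x -> exists L, sdiff (grad f) x L.
Proof.
move=> oU [df sdf] Ux.
exists (fun v => \row_i ('d (fun y => 'd f y (delta_mx 0 i)) x v)).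
apply: sdiff_mx => i j.
have := smooth_sdiff1 oU (sdf (delta_mx 0 j)) Ux.
congr sdiff; apply/funext => y /=; rewrite !mxE//.
Qed.

Lemma smooth_weaken n W p (U : set 'rV[R]_n) (f : 'rV[R]_n -> W) :
  smooth_on p.+1 U f -> smooth_on p U f.
Proof.
elim: p f => [|p IH] f [df sdf].
  by move=> x Ux; apply: differentiable_continuous; exact: df.
by split=> // v; apply: IH.
Qed.

End StrictDerivative.

Section DotProduct.
Context {R : realType}.
Implicit Types n m : nat.

Lemma dotE n (u v : 'rV[R]_n) : dot u v = (u *m v^T) 0 0.
Proof. by rewrite mxE; apply: eq_bigr => i _; rewrite mxE. Qed.

Lemma dotC n (u v : 'rV[R]_n) : dot u v = dot v u.
Proof. by apply: eq_bigr => i _; rewrite mulrC. Qed.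

Lemma dotDl n (u v w : 'rV[R]_n) : dot (u + v) w = dot u w + dot v w.
Proof. by rewrite !dotE mulmxDl mxE. Qed.

Lemma dotDr n (u v w : 'rV[R]_n) : dot u (v + w) = dot u v + dot u w.
Proof. by rewrite dotC dotDl !(dotC u). Qed.

Lemma dotZl n a (u v : 'rV[R]_n) : dot (a *: u) v = a * dot u v.
Proof. by rewrite !dotE -scalemxAl mxE. Qed.

Lemma dotZr n a (u v : 'rV[R]_n) : dot u (a *: v) = a * dot u v.
Proof. by rewrite dotC dotZl dotC. Qed.

Lemma dotNl n (u v : 'rV[R]_n) : dot (- u) v = - dot u v.
Proof. by rewrite -scaleN1r dotZl mulN1r. Qed.

Lemma dotNr n (u v : 'rV[R]_n) : dot u (- v) = - dot u v.
Proof. by rewrite dotC dotNl dotC. Qed.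

Lemma dotBl n (u v w : 'rV[R]_n) : dot (u - v) w = dot u w - dot v w.
Proof. by rewrite dotDl dotNl. Qed.

Lemma dotBr n (u v w : 'rV[R]_n) : dot u (v - w) = dot u v - dot u w.
Proof. by rewrite dotDr dotNr. Qed.

Lemma dot0l n (u : 'rV[R]_n) : dot 0 u = 0.
Proof. by rewrite -(scale0r u) dotZl mul0r. Qed.

Lemma dot0r n (u : 'rV[R]_n) : dot u 0 = 0.
Proof. by rewrite dotC dot0l. Qed.

Lemma dot_mulmx n m (w : 'rV[R]_n) (A : 'M[R]_(n, m)) (u : 'rV[R]_m) :
  dot (w *m A) u = dot w (u *m A^T).
Proof. by rewrite !dotE trmx_mul trmxK mulmxA. Qed.

Lemma norm_dot n (u v : 'rV[R]_n) : `|dot u v| <= n%:R * `|u| * `|v|.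
Proof.
rewrite dotE (le_trans (coord_le_norm _ _ _))//.
by rewrite (le_trans (mulmx_norm _ _))// norm_trmx.
Qed.

Lemma dot_ge0 n (u : 'rV[R]_n) : 0 <= dot u u.
Proof. by apply: sumr_ge0 => i _; rewrite -expr2 sqr_ge0. Qed.

Lemma norm_le_dot n (u : 'rV[R]_n) : `|u| ^+ 2 <= dot u u.
Proof.
have h i j : `|u i j| <= Num.sqrt (dot u u).
  rewrite -(@ler_pXn2r _ 2)// ?nnegrE ?sqrtr_ge0// sqr_sqrtr ?dot_ge0//.
  rewrite real_normK ?num_real// ord1 /dot (bigD1 j)//= expr2 lerDl.
  by apply: sumr_ge0 => k _; rewrite -expr2 sqr_ge0.
rewrite -[leRHS]sqr_sqrtr ?dot_ge0// ler_pXn2r ?nnegrE ?sqrtr_ge0//.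
exact: (mxnorm_le (sqrtr_ge0 _) h).
Qed.

Lemma dot_eq0 n (u : 'rV[R]_n) : dot u u = 0 -> u = 0.
Proof.
move=> u0; apply/eqP; rewrite -normr_eq0 -sqrf_eq0 eq_le sqr_ge0 andbT.
by rewrite -u0 norm_le_dot.
Qed.

Lemma norm2_sqr n (u : 'rV[R]_n) : norm2 u ^+ 2 = dot u u.
Proof. by rewrite sqr_sqrtr// dot_ge0. Qed.

Lemma norm2_le n (u : 'rV[R]_n) : norm2 u <= n.+1%:R * `|u|.
Proof.
rewrite -(@ler_pXn2r _ 2)// ?nnegrE ?sqrtr_ge0 ?mulr_ge0// norm2_sqr.
rewrite exprMn (le_trans (ler_norm _))// (le_trans (norm_dot _ _))//.
rewrite -mulrA -expr2.
by rewrite ler_wpM2r ?sqr_ge0// -natrX ler_nat expnS expn1 (leq_trans (leqnSn n))// leq_pmull.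
Qed.

Lemma blin_dot n (u : 'rV[R]_n) : blin (dot u).
Proof. by apply: lin_rV_blin => a v w; rewrite dotDr dotZr. Qed.

Lemma sdiff_dot (U : normedModType R) n (f g : U -> 'rV[R]_n) x L M :
  sdiff f x L -> sdiff g x M ->
  sdiff (fun y => dot (f y) (g y)) x (fun v => dot (L v) (g x) + dot (f x) (M v)).
Proof.
apply: (@sdiff_bilin _ _ _ _ _ (@dot R n) f g x L M n%:R).
- by move=> u a v w; rewrite dotDr dotZr.
- by move=> u a v w; rewrite dotDl dotZl.
- exact: norm_dot.
Qed.

End DotProduct.

Section Rules.
Context {R : realType}.
Implicit Types U V W : normedModType R.

Lemma sdiff_eqL V W (f : V -> W) x L L' : (forall v, L v = L' v) ->
  sdiff f x L -> sdiff f x L'.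
Proof. by move=> /funext ->. Qed.

Lemma sdiffZ V W (f : V -> W) x L a :
  sdiff f x L -> sdiff (fun y => a *: f y) x (fun v => a *: L v).
Proof.
move=> hf; apply: (sdiff_comp (sdiff_lin _ _) hf).
exact/blin_scale/blin_id.
Qed.

Lemma sdiffN V W (f : V -> W) x L : sdiff f x L -> sdiff (fun y => - f y) x (fun v => - L v).
Proof.
move=> /(sdiffZ (-1)); under eq_fun do rewrite scaleN1r.
by apply: sdiff_eqL => v; rewrite scaleN1r.
Qed.

Lemma sdiffB V W (f g : V -> W) x L M :
  sdiff f x L -> sdiff g x M -> sdiff (fun y => f y - g y) x (fun v => L v - M v).
Proof. by move=> hf /sdiffN; exact: sdiffD. Qed.

Lemma sdiff_id V (x : V) : sdiff id x id.
Proof. exact/sdiff_lin/blin_id. Qed.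

Lemma sdiff_shift V W (f : V -> W) x c L :
  sdiff f (x + c) L -> sdiff (fun y => f (y + c)) x L.
Proof.
move=> hf; have := sdiffD (sdiff_id x) (sdiff_cst c x).
move=> /(@sdiff_comp _ _ _ _ f (fun y => y + c) x L _ hf).
by apply: sdiff_eqL => v /=; rewrite addr0.
Qed.

End Rules.

(** * Second-order expansions *)

Section SecondOrder.
Context {R : realType} {n : nat}.
Variables (f : 'rV[R]_n -> R) (K Q : 'rV[R]_n -> 'rV[R]_n) (x : 'rV[R]_n).
Hypothesis fK : \forall y \near x, sdiff f y (dot (K y)).
Hypothesis KQ : sdiff K x Q.

(** The mean value theorem is applied to [z |-> f (z + t v) - f z] on the segment
    from [x] to [x + t u]. *)
Lemma second_difference e u v : 0 < e -> exists2 T, 0 < T & forall t, 0 < t < T ->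
  `|f (x + t *: u + t *: v) - f (x + t *: u) - f (x + t *: v) + f x
    - t ^+ 2 * dot (Q v) u| <= e * t ^+ 2.
Proof.
move=> e0; have [hQ /(_ (e / (n%:R * `|u| * `|v| + 1))) []] := (sdiffP _ _ _).1 KQ.
  by rewrite divr_gt0// ltr_wpDl// !mulr_ge0.
move=> d1 d10 hd1; have [d2 d20 hd2] := (near_distP _ _).1 fK.
pose d := Num.min d1 d2; have d0 : 0 < d by rewrite lt_min d10 d20.
have uv0 : 0 < `|u| + `|v| + 1 by rewrite ltr_wpDl// addr_ge0.
exists (d / (`|u| + `|v| + 1)) => [|t /andP[t0]]; first exact: divr_gt0.
rewrite ltr_pdivlMr// => td.
have near_x s b : 0 <= s <= 1 -> 0 <= b <= 1 ->
    `|x - (x + b *: (t *: v) + s *: (t *: u))| < d.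
  move=> /andP[s0 s1] /andP[b0 b1]; rewrite -addrA opprD addrA subrr add0r normrN.
  rewrite (le_lt_trans (ler_normD _ _))// !normrZ !ger0_norm ?(ltW t0)//.
  have [u0 v0] := (normr_ge0 u, normr_ge0 v).
  have : b * (t * `|v|) <= t * `|v| by rewrite ler_piMl// mulr_ge0// ltW.
  have : s * (t * `|u|) <= t * `|u| by rewrite ler_piMl// mulr_ge0// ltW.
  by move: td; rewrite !mulrDr mulr1; lra.
have [s s01|s /andP[s0 s1]] := @mvt_segment _ _ (fun z => f (z + t *: v) - f z) x (t *: u)
    (fun s w => dot (K (x + t *: v + s *: (t *: u)) - K (x + s *: (t *: u))) w).
  have n1 := near_x s 1 s01 _; have n0 := near_x s 0 s01 _.
  rewrite scale1r ler01 lexx in n1; rewrite scale0r addr0 ler01 lexx in n0.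
  move: (n1 isT) (n0 isT); rewrite !lt_min => /andP[_ m1] /andP[_ m0].
  apply: sdiff_diff.
  apply: (@sdiff_eqL _ _ _ _ _ (fun w => dot (K (x + t *: v + s *: (t *: u))) w -
     dot (K (x + s *: (t *: u))) w)); first by move=> w; rewrite dotBl.
  apply: sdiffB; last exact: hd2.
  by apply: sdiff_shift; rewrite addrAC; exact: hd2.
rewrite /= => h.
have s01 : 0 <= s <= 1 by rewrite !ltW.
have n1 := near_x s 1 s01 _; have n0 := near_x s 0 s01 _.
rewrite scale1r ler01 lexx in n1; rewrite scale0r addr0 ler01 lexx in n0.
move: (n1 isT) (n0 isT); rewrite !lt_min => /andP[m1 _] /andP[m0 _].
have := hd1 _ _ m1 m0.
rewrite (_ : x + t *: v + s *: (t *: u) - (x + s *: (t *: u)) = t *: v); last by zmod.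
set k := K _ - K _ in h * => hk.
rewrite (_ : _ - _ = dot (k - Q (t *: v)) (t *: u)); last first.
  rewrite dotBl -h (blinZ hQ) dotZl dotZr expr2 mulrA; ring.
rewrite (le_trans (norm_dot _ _))//.
rewrite (@le_trans _ _ (n%:R * (e / (n%:R * `|u| * `|v| + 1) * `|t *: v|) * `|t *: u|))//.
  by rewrite ler_wpM2r// ler_wpM2l.
rewrite !normrZ !(gtr0_norm t0).
rewrite (_ : _ * _ = e / (n%:R * `|u| * `|v| + 1) * (n%:R * `|u| * `|v|) * t ^+ 2); last by ring.
rewrite ler_pM2r ?exprn_gt0// mulrAC ler_pdivrMr ?ltr_wpDl ?mulr_ge0//.
by rewrite ler_pM2l//; lra.
Qed.

(** The second difference is symmetric in [u] and [v], and divided by [t ^+ 2] it approximates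
    either side. *)
Lemma hessian_sym u v : dot (Q u) v = dot (Q v) u.
Proof.
apply/eqP; rewrite -subr_eq0 -normr_eq0 eq_le normr_ge0 andbT.
apply/ler_addgt0Pr => e e0; rewrite add0r.
have e20 : 0 < e / 2 by lra.
have [T T0 hT] := second_difference u v e20.
have [S S0 hS] := second_difference v u e20.
pose t := Num.min T S / 2.
have m0 : 0 < Num.min T S by rewrite lt_min T0 S0.
have t0 : 0 < t by rewrite /t; lra.
have tm : t < Num.min T S by rewrite /t; lra.
move: (tm); rewrite lt_min => /andP[tT tS].
have := hT t; rewrite t0 tT => /(_ isT).
have := hS t; rewrite t0 tS => /(_ isT).
rewrite (addrAC x (t *: v)).
set A := f _; set B := f _; set C := f _; set D := f x; set a := dot _ _; set b := dot _ _.
move=> h1 h2.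
have t20 : 0 < t ^+ 2 by rewrite exprn_gt0.
rewrite -(ler_pM2l t20) -{1}(gtr0_norm t20) -normrM.
rewrite (_ : _ * (a - b) = (A - C - B + D - t ^+ 2 * b) - (A - B - C + D - t ^+ 2 * a)); last by ring.
by rewrite (le_trans (ler_normB _ _))// (_ : _ * e = e / 2 * t ^+ 2 + e / 2 * t ^+ 2); [exact: lerD|field].
Qed.

(** The mean value theorem is applied to [f] minus the quadratic term. By [hessian_sym] the gradient
    of that term is [Q (z - x)], so the remaining gradient differs from [K x] by the strict
    differentiability error of [K]. *)
Lemma second_order_expansion e : 0 < e ->
  \forall y \near x, `|f y - f x - dot (K x) (y - x) - dot (Q (y - x)) (y - x) / 2|
    <= e * `|y - x| ^+ 2.
Proof.
move=> e0; have [hQ /(_ (e / (n%:R + 1))) []] := (sdiffP _ _ _).1 KQ.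
  by rewrite divr_gt0// ltr_wpDl.
move=> d1 d10 hd1; have [d2 d20 hd2] := (near_distP _ _).1 fK.
apply/near_distP; exists (Num.min d1 d2) => [|y]; first by rewrite lt_min d10 d20.
rewrite lt_min => /andP[yd1 yd2].
pose g z := f z - 2^-1 * dot (Q (z - x)) (z - x).
have seg d t : 0 <= t <= 1 -> `|x - y| < d -> `|x - (x + t *: (y - x))| < d.
  move=> /andP[t0 t1]; rewrite opprD addrA subrr add0r normrN normrZ (ger0_norm t0).
  by apply: le_lt_trans; rewrite distrC ler_piMl.
have [t t01|t /andP[t0 t1]] := @mvt_segment _ _ g x (y - x)
   (fun t w => dot (K (x + t *: (y - x)) - Q (t *: (y - x))) w).
  apply: sdiff_diff.
  have sQ : sdiff (fun z : 'rV[R]_n => Q (z - x)) (x + t *: (y - x)) Q.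
    by apply: sdiff_shift; apply: sdiff_lin.
  have sI : sdiff (fun z : 'rV[R]_n => z - x) (x + t *: (y - x)) id.
    by apply: (@sdiff_shift _ _ _ id); apply: sdiff_id.
  have := sdiffB (hd2 _ (seg _ t t01 yd2)) (sdiffZ 2^-1 (sdiff_dot sQ sI)).
  apply: sdiff_eqL => w; rewrite dotBl; congr (_ - _).
  rewrite (addrC x) addrK (hessian_sym w).
  by rewrite /GRing.scale /=; lra.
have -> : x + (y - x) = y by rewrite addrC subrK.
rewrite /g subrr dot0r mulr0 subr0 => h.
have t01 : 0 <= t <= 1 by rewrite !ltW.
have := hd1 _ x (seg _ t t01 yd1) _; rewrite subrr normr0 => /(_ d10).
rewrite (addrC x) addrK => hk.
rewrite (_ : _ - _ = dot (K (t *: (y - x) + x) - K x - Q (t *: (y - x))) (y - x)); last first.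
  by move: h; rewrite (addrC x) !dotBl; lra.
rewrite (le_trans (norm_dot _ _))//.
rewrite (@le_trans _ _ (n%:R * (e / (n%:R + 1) * `|y - x|) * `|y - x|))//.
  rewrite ler_wpM2r// ler_wpM2l// (le_trans hk)// ler_wpM2l//.
    by rewrite divr_ge0// ltW.
  by rewrite normrZ gtr0_norm// ler_piMl// ltW.
rewrite (_ : _ * _ = e / (n%:R + 1) * n%:R * `|y - x| ^+ 2); last by ring.
rewrite ler_wpM2r ?sqr_ge0// mulrAC ler_pdivrMr ?ltr_wpDl//.
by rewrite ler_pM2l//; lra.
Qed.

End SecondOrder.

(** * Lyusternik's theorem and the implicit function theorem *)

Section Ljusternik.
Context {R : realType} {n q : nat}.
Variables (G : 'rV[R]_n -> 'rV[R]_q) (x : 'rV[R]_n).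
Variables (J : 'M[R]_(n, q)) (C : 'M[R]_(q, n)).
Hypothesis GJ : sdiff G x (fun v => v *m J).
Hypothesis CJ : C *m J = 1%:M.
Hypothesis Gx0 : G x = 0.

(** The point is [x + t u + s C], where [s] is the fixed point of the contraction
    [s |-> s - G (x + t u + s C)]. *)
Lemma ljusternik u e : u *m J = 0 -> 0 < e -> exists2 T, 0 < T &
  forall t, 0 < t < T -> exists2 y, G y = 0 & `|y - (x + t *: u)| <= e * t.
Proof.
move=> uJ e0.
pose k := q%:R * `|C| + 1; have k0 : 0 < k by rewrite ltr_wpDl// mulr_ge0.
have kC (s : 'rV[R]_q) : `|s *m C| <= k * `|s|.
  rewrite (le_trans (mulmx_norm _ _))// mulrAC ler_wpM2r// /k; lra.
pose u1 := `|u| + 1; have u10 : 0 < u1 by rewrite ltr_wpDl.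
(* The first bound gives the contraction factor 1/2. The second keeps the image of 0 within
   [rad / 2], so that the ball of radius [rad] is mapped into itself; [k * rad = e * t] is the
   distance allowed. *)
pose e1 := Num.min (2 * k)^-1 (e / (2 * k * u1)).
have e10 : 0 < e1.
  by rewrite lt_min invr_gt0 divr_gt0 ?mulr_gt0.
have e1k : e1 * k <= 2^-1.
  rewrite -ler_pdivlMr// -invfM ge_min (mulrC 2) lexx//.
have e1u : e1 * u1 <= e / (2 * k).
  by rewrite -ler_pdivlMr// -mulrA -invfM ge_min lexx orbT.
have [hJ /(_ _ e10) [d d0 hd]] := (sdiffP _ _ _).1 GJ.
have u1e : 0 < u1 + e by exact: addr_gt0.
exists (d / (u1 + e)) => [|t /andP[t0]]; first exact: divr_gt0.
rewrite ltr_pdivlMr// => td.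
pose rad := e / k * t; have rad0 : 0 < rad by rewrite mulr_gt0 ?divr_gt0.
have krad : k * rad = e * t by rewrite /rad mulrA mulrCA divff ?mulr1 ?gt_eqF.
pose pt s := x + t *: u + s *m C.
have tu : t * `|u| < t * u1 by rewrite ltr_pM2l// /u1; lra.
have near_pt s : `|s| <= rad -> `|x - pt s| < d.
  move=> hs; rewrite /pt -addrA opprD addrA subrr add0r normrN.
  rewrite (le_lt_trans (ler_normD _ _))// normrZ (gtr0_norm t0).
  have : `|s *m C| <= k * rad by rewrite (le_trans (kC s))// ler_pM2l.
  by rewrite krad; move: td; rewrite mulrDr; lra.
pose T s := s - G (pt s).
have contr s s' : `|s| <= rad -> `|s'| <= rad -> `|T s - T s'| <= 2^-1 * `|s - s'|.
  move=> hs hs'; have := hd _ _ (near_pt s hs) (near_pt s' hs').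
  have -> : pt s - pt s' = (s - s') *m C by rewrite /pt mulmxBl; zmod.
  rewrite -mulmxA CJ mulmx1 => h.
  have -> : T s - T s' = - (G (pt s) - G (pt s') - (s - s')) by rewrite /T; zmod.
  rewrite normrN (le_trans h)// (@le_trans _ _ (e1 * (k * `|s - s'|)))//.
    by rewrite ler_pM2l.
  by rewrite mulrA ler_wpM2r.
have T0 : `|T 0| <= rad / 2.
  rewrite /T sub0r normrN.
  have := hd (pt 0) x _ _; rewrite Gx0 subr0 subrr normr0 => /(_ _ d0).
  have E0 : pt 0 - x = t *: u by rewrite /pt mul0mx addr0 addrAC subrr add0r.
  rewrite E0 -scalemxAl uJ scaler0 subr0.
  have n0 : `|x - pt 0| < d by apply: near_pt; rewrite normr0 ltW.
  move=> /(_ n0) /le_trans; apply; rewrite normrZ (gtr0_norm t0).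
  rewrite (@le_trans _ _ (t * (e1 * u1)))//.
    by rewrite mulrCA ler_pM2l// ler_pM2l// /u1; lra.
  rewrite (@le_trans _ _ (t * (e / (2 * k))))// ?ler_pM2l//.
  by rewrite le_eqVlt; apply/orP; left; apply/eqP; rewrite /rad; field; rewrite gt_eqF.
pose U := [set s : 'rV[R]_q | `|s| <= rad].
have TU : {homo T : s / U s >-> U s}.
  move=> s Us /=; rewrite /U /=.
  have := contr s 0 Us; rewrite normr0 ltW// => /(_ isT).
  rewrite subr0 => h; rewrite -(subrK (T 0) (T s)) (le_trans (ler_normD _ _))//.
  by rewrite /U /= in Us; lra.
pose TT : {fun U >-> U} := mkfun_fun TU.
have cT : is_contraction TT.
  exists 2^-1%:nng; split=> /=; first by rewrite invf_lt1// ltr1n.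
  by move=> [s s'] [Us Us'] /=; exact: contr.
have clU : closed U.
  have := @closed_closed_ball_ _ _ (0 : 'rV[R]_q) rad.
  by rewrite /closed_ball_; under eq_set do rewrite sub0r normrN.
pose X : completeNormedModType R :=
  HB.pack 'rV[R]_q (NormedModule.on 'rV[R]_q) (Complete.on 'rV[R]_q).
have [|s Us sT] := @banach_fixed_point R X U TT cT clU.
  by exists 0; rewrite /U /= normr0 ltW.
exists (pt s).
  by move: sT; rewrite /TT /= /mkfun /T => /eqP; rewrite -subr_eq0 opprB addrC subrK => /eqP.
have -> : pt s - (x + t *: u) = s *m C by rewrite /pt addrAC subrr add0r.
by rewrite -krad (le_trans (kC s))// ler_pM2l.
Qed.

End Ljusternik.

(** * Implicit functions that are already known to be continuous *)

Section ImplicitFunction.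
Context {R : realType}.
Implicit Types U V W : normedModType R.

Lemma inj_left_inverse n m (A : 'rV[R]_n -> 'rV[R]_m) : linear A ->
  (forall v, A v = 0 -> v = 0) -> exists2 B : 'rV[R]_m -> 'rV[R]_n,
    blin B & forall v, B (A v) = v.
Proof.
move=> lA iA.
pose AM := GRing.isLinear.Build _ _ _ _ _ lA.
pose AL : {linear 'rV[R]_n -> 'rV[R]_m} := HB.pack A AM.
have AE v : A v = v *m lin1_mx AL by rewrite mul_rV_lin1.
have free : row_free (lin1_mx AL).
  rewrite -kermx_eq0; apply/eqP/row_matrixP => i; rewrite row0; apply: iA.
  by rewrite AE -row_mul mulmx_ker row0.
exists (fun w => w *m pinvmx (lin1_mx AL)); first exact: blin_mulmxr.
by move=> v; rewrite AE mulmxKp.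
Qed.

Lemma near_near (T : topologicalType) (P : T -> Prop) (x : T) :
  (\forall y \near x, P y) -> \forall y \near x, \forall z \near y, P z.
Proof. by move=> /nbhs_interior. Qed.

Lemma cont_id V (x : V) : {for x, continuous (id : V -> V)}.
Proof. exact: cvg_id. Qed.

Lemma cont_pair U V W (f : U -> V) (g : U -> W) x :
  {for x, continuous f} -> {for x, continuous g} ->
  {for x, continuous (fun y => (f y, g y))}.
Proof. by move=> cf cg; apply: cvg_pair. Qed.

(** As the implicit function [p] is given, only its differentiability is at stake, and a left
    inverse [B] of the partial derivative suffices. Along the graph [Psi] does not change, so [L] of
    an increment is small, and [B] solves for its second component. *)
Lemma implicit_point V n m (Psi : V * 'rV[R]_n -> 'rV[R]_m) (p : V -> 'rV[R]_n) x L B :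
  sdiff Psi (x, p x) L -> blin B -> (forall v, B (L (0, v)) = v) ->
  {for x, continuous p} -> (\forall y \near x, Psi (y, p y) = 0) ->
  sdiff p x (fun u => - B (L (u, 0))).
Proof.
move=> hPsi hB BL cp Pp0; have [hL hPsi'] := (sdiffP _ _ _).1 hPsi.
pose D u := B (L (u, 0)).
have hD : blin D.
  apply: (blin_comp hB); apply: (blin_comp hL).
  exact: (blin_pair (blin_id V) (blin_cst0 _ _)).
have [[_ [b b0 hb]] [_ [c c0 hc]]] := (hB, hD).
apply/sdiffP; split=> [|e e0].
  rewrite (_ : (fun _ => _) = fun u => -1 *: D u); first exact: blin_scale.
  by apply/funext => u; rewrite scaleN1r.
(* The factor 1/2 lets [|v|] be absorbed on the left, which gives the Lipschitz bound
   [|v| <= (2 * c + 1) * |w|]; the other bound then absorbs [|w| + |v| <= (2 * c + 2) * |w|]. *)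
pose e1 := Num.min 2^-1 (e / (2 * c + 2)) / (b + 1).
have b10 : 0 < b + 1 by lra.
have m0 : 0 < Num.min 2^-1 (e / (2 * c + 2)).
  by rewrite lt_min invr_gt0 ltr0n divr_gt0//; lra.
have e10 : 0 < e1 by rewrite divr_gt0.
have be1 : b * e1 <= Num.min 2^-1 (e / (2 * c + 2)).
  rewrite /e1 mulrCA; apply: ler_piMr; first exact: ltW.
  by rewrite ler_pdivrMr//; lra.
have [d d0 hd] := hPsi' _ e10.
have d20 : 0 < d / 2 by lra.
have [d1 d10 hd1] := (near_distP _ _).1 (nearI Pp0 ((cont_distP _ _).1 cp (d / 2) d20)).
exists (Num.min d1 d); first by rewrite lt_min d10 d0.
move=> y z; rewrite !lt_min => /andP[/hd1 [Py cy] yd] /andP[/hd1 [Pz cz] zd].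
have := hd (y, p y) (z, p z) _ _; rewrite Py Pz subrr sub0r normrN /= => h.
have {}h : `|L (y - z, p y - p z)| <= e1 * (`|y - z| + `|p y - p z|).
  rewrite (le_trans (h _ _))//.
  - by rewrite prod_normE gt_max /= yd /=; lra.
  - by rewrite prod_normE gt_max /= zd /=; lra.
  - by rewrite ler_pM2l// prod_normE ge_max /= lerDl lerDr !normr_ge0.
set w := y - z in h *; set v := p y - p z in h *.
have LE : L (w, v) = L (w, 0) + L (0, v).
  by rewrite -(blinD hL); congr (L (_, _)); rewrite ?addr0 ?add0r.
have := hb (L (w, v)); rewrite LE (blinD hB) BL -/(D w) opprK (addrC v) => h1.
have h2 : `|D w + v| <= Num.min 2^-1 (e / (2 * c + 2)) * (`|w| + `|v|).
  rewrite (le_trans h1)// -LE (le_trans (ler_wpM2l b0 h))// mulrA ler_wpM2r//.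
have [w0 v0] := (normr_ge0 w, normr_ge0 v).
have h3 : `|v| <= (2 * c + 1) * `|w|.
  have : `|D w + v| <= 2^-1 * (`|w| + `|v|).
    by rewrite (le_trans h2)// ler_wpM2r ?addr_ge0// ge_min lexx.
  have : `|v| <= `|D w + v| + `|D w|.
    by rewrite -{1}(addKr (D w) v) addrC (le_trans (ler_normB _ _)).
  by have := hc w; lra.
rewrite (le_trans h2)// (@le_trans _ _ (e / (2 * c + 2) * ((2 * c + 2) * `|w|)))//.
  rewrite ler_pM ?addr_ge0 ?(ltW m0) ?ge_min ?lexx ?orbT//; lra.
by rewrite mulrA divfK// gt_eqF//; lra.
Qed.

(** The hypotheses of [implicit_point] persist near [x]: injectivity is stable under perturbations
    that are small against the bound of [B], and [p] is Lipschitz, hence continuous, near a point of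
    strict differentiability. *)
Lemma implicit_near V n m (Psi : V * 'rV[R]_n -> 'rV[R]_m) (p : V -> 'rV[R]_n) x L :
  (\forall z \near (x, p x), exists M, sdiff Psi z M) ->
  sdiff Psi (x, p x) L ->
  (forall v, L (0, v) = 0 -> v = 0) ->
  {for x, continuous p} -> (\forall y \near x, Psi (y, p y) = 0) ->
  \forall y \near x, exists M, sdiff p y M.
Proof.
move=> nPsi hL iL cp Pp0; have bL := hL.1.
have lin0 (M : V * 'rV[R]_n -> 'rV[R]_m) : blin M -> linear (fun v : 'rV[R]_n => M (0, v) : 'rV[R]_m).
  by move=> hM; exact: (blin_comp hM (blin_pair (blin_cst0 _ _) (blin_id _))).1.
have [B hB BL] := inj_left_inverse (lin0 _ bL) iL.
have sp := implicit_point hL hB BL cp Pp0.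
have [_ [b b0 hb]] := hB.
have e0 : 0 < (2 * (b + 1))^-1 by rewrite invr_gt0//; lra.
have cpair := cont_pair (@cont_id _ x) cp.
have n1 : \forall y \near x, exists M, sdiff Psi (y, p y) M by exact: cpair nPsi.
have n2 : \forall y \near x, forall M, sdiff Psi (y, p y) M ->
    forall v, `|M v - L v| <= (2 * (b + 1))^-1 * `|v|.
  exact: cpair (sdiff_near_deriv hL e0).
have n3 : \forall y \near x, {for y, continuous p}.
  have [C C0 /near2_distP [d d0 hd]] := sdiff_lip sp.
  have nd : \forall y \near x, `|x - y| < d by apply/near_distP; exists d.
  apply: nearS (near_near nd) => y ny; have yd := nbhs_singleton ny.
  apply/cont_distP => e e'0.
  have n4 : \forall z \near y, `|y - z| < e / C by apply/near_distP; exists (e / C) => //; rewrite divr_gt0.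
  apply: nearS2 ny n4 => z zd; rewrite ltr_pdivlMr// => yz.
  by rewrite (le_trans (hd _ _ yd zd))//= mulrC ltW.
near=> y.
have [M hM] : exists M, sdiff Psi (y, p y) M by near: y.
have iM v : M (0, v) = 0 -> v = 0.
  have hML : forall M, sdiff Psi (y, p y) M ->
    forall v, `|M v - L v| <= (2 * (b + 1))^-1 * `|v| by near: y.
  move=> Mv; have := hML _ hM (0, v).
  rewrite Mv sub0r normrN prod_normE /= normr0 max_r// => h.
  have := hb (L (0, v)); rewrite BL => h'.
  have : b * `|L (0, v)| <= b * ((2 * (b + 1))^-1 * `|v|) by rewrite ler_wpM2l.
  have : b * (2 * (b + 1))^-1 <= 2^-1.
    by rewrite ler_pdivrMr; lra.
  move=> /(ler_wpM2r (normr_ge0 v)); rewrite -mulrA => h1 h2.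
  by apply/eqP; rewrite -normr_eq0 eq_le normr_ge0 andbT; lra.
have [B' hB' BL'] := inj_left_inverse (lin0 _ hM.1) iM.
exists (fun u => - B' (M (u, 0))); apply: implicit_point hM hB' BL' _ _; first by near: y.
by near: y; exact: near_near.
Unshelve. all: by end_near. Qed.

End ImplicitFunction.

Lemma sdiff_dist (R : realType) (V W : normedModType R) (f : V -> W) x L e :
  sdiff f x L -> 0 < e -> \forall y \near x, `|f x - f y| <= e.
Proof. by move=> /sdiff_cvg /cvgrPdist_le; apply. Qed.

Lemma blin_norm_cont (R : realType) (V W : normedModType R) (L : V -> W) :
  blin L -> continuous (fun v => `|L v|).
Proof. by move=> hL v; apply: cvg_norm; exact: (blin_cont hL). Qed.

Lemma blin_lsubmx (R : realType) m n : blin (fun u : 'rV[R]_(m + n) => lsubmx u).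
Proof. by apply: lin_rV_blin => a u v; rewrite linearP. Qed.

Lemma blin_rsubmx (R : realType) m n : blin (fun u : 'rV[R]_(m + n) => rsubmx u).
Proof. by apply: lin_rV_blin => a u v; rewrite linearP. Qed.

Lemma sdiff_row_mx (R : realType) (V : normedModType R) p m n
    (f : V -> 'M[R]_(p, m)) (h : V -> 'M[R]_(p, n)) x L M :
  sdiff f x L -> sdiff h x M ->
  sdiff (fun y => row_mx (f y) (h y)) x (fun v => row_mx (L v) (M v)).
Proof.
have E (u : 'M[R]_(p, m)) (v : 'M[R]_(p, n)) : row_mx u v =
    u *m row_mx 1%:M 0 + v *m row_mx 0 1%:M.
  by rewrite !mul_mx_row !mulmx1 !mulmx0 add_row_mx addr0 add0r.
move=> hf hh; rewrite (_ : (fun y => _) = (fun y => f y *m row_mx 1%:M 0 + h y *m row_mx 0 1%:M)).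
  apply: (@sdiff_eqL _ _ _ _ _ (fun v => L v *m row_mx 1%:M 0 + M v *m row_mx 0 1%:M)).
    by move=> v; rewrite -E.
  apply: sdiffD.
    exact: (sdiff_comp (sdiff_lin (f x) (blin_mulmxr p (row_mx 1%:M 0))) hf).
  exact: (sdiff_comp (sdiff_lin (h x) (blin_mulmxr p (row_mx 0 1%:M))) hh).
by apply/funext => y; rewrite -E.
Qed.

(** * Parametric constrained minimization *)

Section Rayleigh.
Context {R : realType} {n q : nat}.
Variables (J : 'M[R]_(n, q)) (H Q M : 'rV[R]_n -> 'rV[R]_n).
Hypothesis (hH : blin H) (hQ : blin Q).
Hypothesis Hsym : forall u v, dot (H u) v = dot (H v) u.
Hypothesis Qsym : forall u v, dot (Q u) v = dot (Q v) u.
Hypothesis Hpos : forall v, v *m J = 0 -> v != 0 -> 0 < dot (H v) v.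

Lemma quad_cont (A : 'rV[R]_n -> 'rV[R]_n) (v : 'rV[R]_n) :
  blin A -> {for v, continuous (fun v => dot (A v) v)}.
Proof. by move=> hA; apply: (sdiff_cvg (sdiff_dot (sdiff_lin v hA) (sdiff_id v))). Qed.

(** The sphere of the sup norm is as good as the Euclidean one, since the Rayleigh quotient is
    homogeneous of degree zero. *)
Lemma sphere_compact : compact [set v : 'rV[R]_n | v *m J = 0 /\ `|v| = 1].
Proof.
apply: bounded_closed_compact.
  exists 1; split=> [|b b1 v /= [_ ->]]; [exact: num_real|exact: ltW].
have cJ : continuous (fun v : 'rV[R]_n => `|v *m J|).
  exact: (blin_norm_cont (@blin_mulmxr R 1 n q J)).
have cN : continuous (fun v : 'rV[R]_n => `|v|) by exact: norm_continuous.
rewrite (_ : [set v | _] = ((fun v => `|v *m J|) @^-1` [set t | t <= 0]) `&`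
   ((fun v : 'rV[R]_n => `|v|) @^-1` [set 1])); last first.
  by apply/seteqP; split=> v /=; rewrite normr_le0 => -[/eqP].
apply: closedI; first by apply: closed_comp => [? _|]; [exact: cJ|exact: closed_le].
by apply: closed_comp => [? _|]; [exact: cN|exact: closed_eq].
Qed.

Lemma rayleigh_min u : u *m J = 0 -> dot (Q u) u < 0 -> exists2 k, k < 0 &
  exists v, [/\ v *m J = 0, v != 0 &
    forall w, w *m J = 0 -> dot (Q v) w = k * dot (H v) w].
Proof.
move=> uJ Qu.
pose K := [set v : 'rV[R]_n | v *m J = 0 /\ `|v| = 1].
have Kneq v : K v -> v != 0.
  by move=> [_ v1]; apply/eqP => v0; move: v1; rewrite v0 normr0 => /eqP; rewrite eq_sym oner_eq0.
have scaleK v : v *m J = 0 -> v != 0 -> K (`|v|^-1 *: v).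
  move=> vJ v0; split; first by rewrite -scalemxAl vJ scaler0.
  by rewrite normrZ normfV normr_id mulVf// normr_eq0.
have u0 : u != 0 by apply: contraTneq Qu => ->; rewrite dot0r ltxx.
pose rho v := dot (Q v) v / dot (H v) v.
have rhoZ a v : a != 0 -> rho (a *: v) = rho v.
  move=> a0; rewrite /rho !(blinZ hQ, blinZ hH) !dotZl !dotZr !mulrA -mulf_div divff ?mul1r//.
  by rewrite mulf_neq0.
have cr : {within K, continuous rho}.
  apply: continuous_in_subspaceT => v /set_mem Kv.
  have Hv0 : dot (H v) v != 0 by rewrite gt_eqF// Hpos//; [exact: Kv.1|exact: Kneq].
  exact: (cvgM (quad_cont hQ) (cvgV Hv0 (quad_cont hH))).
have [|v /set_mem Kv hv] := @EVT_min_rV R n rho K _ sphere_compact cr.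
  by exists (`|u|^-1 *: u); exact: scaleK.
have vJ := Kv.1; have v0 := Kneq v Kv.
have hvw w : w *m J = 0 -> rho v * dot (H w) w <= dot (Q w) w.
  move=> wJ; have [->|w0] := eqVneq w 0; first by rewrite !dot0r mulr0.
  rewrite -ler_pdivlMr ?Hpos// -/(rho w) -(rhoZ `|w|^-1 w); last by rewrite invr_eq0 normr_eq0.
  by apply: hv; apply: mem_set; exact: scaleK.
exists (rho v).
  have : rho v <= rho u.
    rewrite -(rhoZ `|u|^-1 u); last by rewrite invr_eq0 normr_eq0.
    by apply: hv; apply: mem_set; exact: scaleK.
  move=> /le_lt_trans; apply.
  by rewrite /rho pmulr_llt0// invr_gt0 Hpos.
exists v; split=> // w wJ.
have Ev : dot (Q v) v = rho v * dot (H v) v.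
  by rewrite /rho divfK// gt_eqF// Hpos.
set k := rho v in Ev hvw *.
pose b := dot (Q v) w - k * dot (H v) w.
pose c := dot (Q w) w - k * dot (H w) w.
have c0 : 0 <= c by rewrite subr_ge0 hvw.
have hb t : 0 <= 2 * t * b + t ^+ 2 * c.
  have : (v + t *: w) *m J = 0 by rewrite mulmxDl -scalemxAl vJ wJ scaler0 addr0.
  move=> /hvw; rewrite !(blinD hQ, blinD hH, blinZ hQ, blinZ hH).
  rewrite !(dotDl, dotDr, dotZl, dotZr) Ev (Hsym w) (Qsym w) /b /c; lra.
suff : b = 0 by move=> /eqP; rewrite subr_eq0 => /eqP.
apply/eqP; rewrite -sqrf_eq0 eq_le sqr_ge0 andbT.
(* Near the minimizer [- b / c] of the polynomial, with [c + 1] to allow for [c = 0]; the value is a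
   negative multiple of [b ^+ 2]. *)
have := hb (- b / (c + 1)).
have c1 : 0 < c + 1 by lra.
rewrite (_ : _ + _ = - b ^+ 2 * ((c + 2) / (c + 1) ^+ 2)); last by field; rewrite gt_eqF.
by rewrite mulNr oppr_ge0 pmulr_lle0// divr_gt0 ?exprn_gt0//; lra.
Qed.

Hypothesis MJ : forall u, u *m J = 0 -> M u *m J = 0.
Hypothesis HM : forall u v, u *m J = 0 -> v *m J = 0 ->
  dot (H (M u - u)) v = - dot (Q u) v.

(** For the minimizer [v] of the Rayleigh quotient, the vector [M v - v + k v] is tangent, while
    [HM] and the eigenvector equation make its image under [H] orthogonal to all tangent vectors.
    Definiteness makes it zero. *)
Lemma eigenvector_gt1 u : u *m J = 0 -> dot (Q u) u < 0 ->
  exists2 a, 1 < a & exists2 v, v != 0 & M v = a *: v.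
Proof.
move=> uJ Qu; have [k k0 [v [vJ v0 hv]]] := rayleigh_min uJ Qu.
exists (1 - k); first by lra.
exists v => //.
pose w := M v - v + k *: v.
have wJ : w *m J = 0 by rewrite !(mulmxDl, mulNmx) -scalemxAl vJ MJ// scaler0 oppr0 !addr0.
have : dot (H w) w = 0.
  by rewrite {1}/w (blinD hH) dotDl HM// hv// (blinZ hH) dotZl addNr.
have [w0 _|/(Hpos wJ)] := eqVneq w 0; last by move=> + h; rewrite h ltxx.
by apply: subr0_eq; rewrite scalerBl scale1r -w0 /w; zmod.
Qed.

End Rayleigh.

(** * First-order conditions under equality constraints *)

Section Lagrange.
Context {R : realType} {n q : nat}.
Variables (phi : 'rV[R]_n -> R) (G : 'rV[R]_n -> 'rV[R]_q) (x g : 'rV[R]_n).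
Variables (J : 'M[R]_(n, q)) (C : 'M[R]_(q, n)).
Hypothesis phig : sdiff phi x (dot g).
Hypothesis GJ : sdiff G x (fun v => v *m J).
Hypothesis CJ : C *m J = 1%:M.
Hypothesis Gx0 : G x = 0.
Hypothesis xmin : \forall y \near x, G y = 0 -> phi x <= phi y.

(** By [ljusternik] a feasible point lies within [e * t] of [x + t u], so minimality passes to the
    linear term up to errors of order [e * t]. *)
Lemma gradient_ge0 u : u *m J = 0 -> 0 <= dot g u.
Proof.
move=> uJ; apply/ler_addgt0Pr => e0 e00.
(* The coefficients of [e * t]: pairing [g] with the curve error, the differentiability error over a
   distance [t * (|u| + 1)], and 1 to spare. *)
pose k := n%:R * `|g| + `|u| + 2.
have k0 : 0 < k by rewrite ltr_wpDl// addr_ge0// mulr_ge0.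
pose e := Num.min 1 (e0 / k).
have e_gt0 : 0 < e by rewrite lt_min ltr01 divr_gt0.
have [_ /(_ _ e_gt0) [d d0 hd]] := (sdiffP _ _ _).1 phig.
have [d' d'0 hd'] := (near_distP _ _).1 xmin.
have [T T0 hT] := ljusternik GJ CJ Gx0 uJ e_gt0.
have u1 : 0 < `|u| + 2 by rewrite ltr_wpDl.
pose m := Num.min T (Num.min d d' / (`|u| + 2)).
have m0 : 0 < m by rewrite lt_min T0 divr_gt0// lt_min d0.
pose t := m / 2; have t0 : 0 < t by rewrite /t; lra.
have tm : t < m by rewrite /t; lra.
move: (tm); rewrite lt_min => /andP[tT]; rewrite ltr_pdivlMr// => tdd.
have [|y Gy hy] := hT t; first by rewrite t0.
have e1 : e <= 1 by rewrite ge_min lexx.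
have ek : e * k <= e0 by rewrite -ler_pdivlMr// ge_min lexx orbT.
set r := y - (x + t *: u) in hy.
have yE : y - x = t *: u + r by rewrite /r; zmod.
have yxt : `|y - x| <= t * (`|u| + 1).
  rewrite yE (le_trans (ler_normD _ _))// normrZ (gtr0_norm t0) mulrDr mulr1.
  by rewrite lerD2l (le_trans hy)// ger_pMl.
have yx : `|x - y| < Num.min d d'.
  by rewrite distrC (le_lt_trans yxt)// (le_lt_trans _ tdd)// ler_pM2l//; lra.
move: yx; rewrite lt_min => /andP[yd yd'].
have := hd y x yd; rewrite subrr normr0 => /(_ d0).
have := hd' y yd' Gy.
rewrite yE dotDr dotZr -yE => h1; rewrite ler_distl => /andP[_ h2].
have h3 : dot g r <= n%:R * `|g| * (e * t).
  rewrite (le_trans (ler_norm _))// (le_trans (norm_dot _ _))// ler_wpM2l//.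
have h4 : e * `|y - x| <= e * (t * (`|u| + 1)) by rewrite ler_pM2l.
rewrite -(ler_pM2l t0) mulr0 mulrDr.
have h5 : t * (e * k) <= t * e0 by rewrite ler_pM2l.
have : t * (e * k) = n%:R * `|g| * (e * t) + e * (t * (`|u| + 1)) + e * t by rewrite /k; ring.
by have : 0 < e * t by [rewrite mulr_gt0]; lra.
Qed.

(** Since [C J = 1], the map [v |-> v - v J C] takes values in the kernel of [J], and the left side
    is its adjoint applied to [g]. Its squared norm is therefore [g] paired with a tangent vector,
    hence zero by [gradient_ge0] in both directions. *)
Lemma lagrange_multiplier : g - g *m C^T *m J^T = 0.
Proof.
have h u : u *m J = 0 -> dot g u = 0.
  move=> uJ; apply/eqP; rewrite eq_le gradient_ge0// andbT.
  by rewrite -oppr_ge0 -dotNr gradient_ge0// mulNmx uJ oppr0.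
apply: dot_eq0; set w := _ - _.
rewrite {1}/w dotBl !dot_mulmx !trmxK -dotBr; apply: h.
by rewrite mulmxBl -!mulmxA CJ mulmx1 subrr.
Qed.

End Lagrange.

(** * Solutions of smooth parametric problems through the KKT system *)

Section Parametric.
Context {R : realType} {d q : nat}.
Variables (phi : 'rV[R]_d -> 'rV[R]_d -> R) (g : 'rV[R]_d -> 'rV[R]_d -> 'rV[R]_d).
Variables (G : 'rV[R]_d -> 'rV[R]_d -> 'rV[R]_q) (J : 'rV[R]_d -> 'rV[R]_d -> 'M[R]_(d, q)).
Variables (S : 'rV[R]_d -> 'rV[R]_d) (x0 : 'rV[R]_d) (C0 : 'M[R]_(q, d)) (c : R).
Hypothesis smooth_g : \forall z \near (x0, x0), exists L, sdiff (fun z => g z.1 z.2) z L.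
Hypothesis smooth_G : \forall z \near (x0, x0), exists L, sdiff (fun z => G z.1 z.2) z L.
Hypothesis smooth_J : \forall z \near (x0, x0), exists L, sdiff (fun z => J z.1 z.2) z L.
Hypothesis grad_phi : \forall z \near (x0, x0), sdiff (phi z.1) z.2 (dot (g z.1 z.2)).
Hypothesis jac_G : \forall z \near (x0, x0), sdiff (G z.1) z.2 (fun v => v *m J z.1 z.2).
Hypothesis C0J : C0 *m J x0 x0 = 1%:M.
Hypothesis Sx0 : S x0 = x0.
Hypothesis contS : {for x0, continuous S}.
Hypothesis feasS : \forall x \near x0, G x (S x) = 0.
Hypothesis minS : \forall x \near x0, \forall y \near S x, G x y = 0 -> phi x (S x) <= phi x y.

Lemma pair_cont : {for x0, continuous (fun x => (x, S x))}.
Proof. exact: cont_pair (@cont_id _ _ x0) contS. Qed.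

Lemma near_pairS (P : 'rV[R]_d * 'rV[R]_d -> Prop) :
  (\forall z \near (x0, x0), P z) -> \forall x \near x0, P (x, S x).
Proof. by rewrite -{2}Sx0; apply: pair_cont. Qed.

(** [C0 J] is close to the identity near the base point, hence invertible. *)
Lemma right_inverse_near : \forall z \near (x0, x0),
  exists B, B *m J z.1 z.2 = 1%:M.
Proof.
have [L sJ] := nbhs_singleton smooth_J.
pose k := q%:R * d%:R * `|C0| + 1.
have k0 : 0 < k by rewrite ltr_wpDl// !mulr_ge0.
have := sdiff_dist sJ (_ : 0 < (2 * k)^-1); rewrite invr_gt0 mulr_gt0// => /(_ isT).
apply: nearS => z /= hz.
have h (s : 'rV[R]_q) : `|s *m (C0 *m J z.1 z.2) - s| <= 2^-1 * `|s|.
  rewrite -{2}(mulmx1 s) -C0J -mulmxBr -mulmxBr.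
  rewrite (le_trans (mulmx_norm _ _))//.
  rewrite (@le_trans _ _ (q%:R * `|s| * (d%:R * `|C0| * (2 * k)^-1)))//.
    rewrite ler_wpM2l ?mulr_ge0// (le_trans (mulmx_norm _ _))//.
    by rewrite ler_wpM2l ?mulr_ge0// distrC.
  rewrite (_ : _ * _ = (q%:R * d%:R * `|C0|) / (2 * k) * `|s|); last by ring.
  by rewrite ler_wpM2r// ler_pdivrMr ?mulr_gt0// mulrA mulVf// mul1r /k; lra.
have u : C0 *m J z.1 z.2 \in unitmx.
  rewrite -row_free_unit -kermx_eq0; apply/eqP/row_matrixP => i; rewrite row0.
  have := h (row i (kermx (C0 *m J z.1 z.2))).
  rewrite -row_mul mulmx_ker row0 sub0r normrN => h'.
  by apply/eqP; rewrite -normr_eq0; have := normr_ge0 (row i (kermx (C0 *m J z.1 z.2))); lra.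
exists (invmx (C0 *m J z.1 z.2) *m C0).
by rewrite -mulmxA mulVmx.
Qed.

(** The pseudo-inverse plays the part of [C] in [lagrange_multiplier] wherever [J] has full column
    rank. *)
Definition multiplier x : 'rV[R]_q := - (g x (S x) *m (pinvmx (J x (S x)))^T).

Lemma multiplierP : \forall x \near x0, g x (S x) + multiplier x *m (J x (S x))^T = 0.
Proof.
have n1 := near_pairS right_inverse_near.
have n2 := near_pairS grad_phi.
have n3 := near_pairS jac_G.
near=> x.
have [B BJ] : exists B, B *m J x (S x) = 1%:M by near: x.
have full : row_full (J x (S x)) by apply/row_fullP; exists B.
rewrite /multiplier mulNmx.
apply: (@lagrange_multiplier _ _ _ (phi x) (G x) (S x)); last by near: x.
- by near: x.
- by near: x.
- exact: mulVpmx.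
- by near: x.
Unshelve. all: by end_near. Qed.

(** Continuity is drawn from the stationarity equation, not from the formula with [pinvmx]:
    subtracting the equations at [x] and [x0] and applying [C0^T] expresses the change of the
    multiplier by the changes of [g] and [J]. *)
Lemma multiplier_cont : {for x0, continuous multiplier}.
Proof.
have [Lg sg] := nbhs_singleton smooth_g.
have [LJ sJ] := nbhs_singleton smooth_J.
pose k := d%:R * `|C0| + 1; have k0 : 0 < k by rewrite ltr_wpDl// mulr_ge0.
pose m := q%:R * k; pose l0 := `|multiplier x0|.
have m0 : 0 <= m by rewrite mulr_ge0// ltW.
have l00 : 0 <= l0 by exact: normr_ge0.
apply/cont_distP => e e0.
(* The multiplier at [x] enters its own estimate through [|l| <= |dl| + l0]: the first bound absorbs
   the [|dl|] part, the second makes the rest at most [e / 2]. *)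
pose e1 := Num.min (2 * (m + 1))^-1 (e / (2 * (m * l0 + k))).
have mlk : 0 < m * l0 + k by rewrite ltr_wpDl// mulr_ge0.
have e10 : 0 < e1 by rewrite lt_min invr_gt0 divr_gt0 ?mulr_gt0//; lra.
have cg := near_pairS (sdiff_dist sg e10).
have cJ := near_pairS (sdiff_dist sJ e10).
have M0 := nbhs_singleton multiplierP.
near=> x.
have M1 : g x (S x) + multiplier x *m (J x (S x))^T = 0 by near: x; exact: multiplierP.
have h1 : `|g x0 x0 - g x (S x)| <= e1 by near: x.
have h2 : `|J x0 x0 - J x (S x)| <= e1 by near: x.
rewrite Sx0 in M0.
set l := multiplier x in M1 *.
set l' := multiplier x0 in M0 *.
pose dl := l' - l.
have E : dl = (l *m (J x (S x) - J x0 x0)^T + (g x (S x) - g x0 x0)) *m C0^T.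
  have -> : dl = dl *m (J x0 x0)^T *m C0^T.
    by rewrite -mulmxA -trmx_mul C0J trmx1 mulmx1.
  congr (_ *m _); rewrite /dl mulmxBl raddfB /= mulmxBr.
  have -> : l' *m (J x0 x0)^T = - g x0 x0 by apply/eqP; rewrite -addr_eq0 addrC M0.
  have -> : l *m (J x (S x))^T = - g x (S x) by apply/eqP; rewrite -addr_eq0 addrC M1.
  by zmod.
have h3 : `|dl| <= k * (q%:R * `|l| * e1 + e1).
  rewrite E (le_trans (mulmx_norm _ _))// norm_trmx mulrAC.
  apply: ler_pM; rewrite ?mulr_ge0//; first by rewrite /k; lra.
  rewrite (le_trans (ler_normD _ _))// lerD// 1?distrC//.
  by rewrite (le_trans (mulmx_norm _ _))// norm_trmx distrC ler_wpM2l// mulr_ge0.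
have h4 : `|l| <= `|dl| + l0.
  have -> : l = l' - dl by rewrite /dl opprB addrC subrK.
  by rewrite (le_trans (ler_normB _ _))// addrC.
have e1m : e1 * m <= 2^-1.
  rewrite (@le_trans _ _ ((2 * (m + 1))^-1 * m))//.
    by rewrite ler_wpM2r// ge_min lexx.
  rewrite mulrC ler_pdivrMr; lra.
have e1k : e1 * (m * l0 + k) <= e / 2.
  rewrite -ler_pdivlMr// -mulrA -invfM ge_min (mulrC 2) lexx orbT//.
have h5 : e1 * m * `|dl| <= 2^-1 * `|dl| by rewrite ler_wpM2r.
have h6 : e1 * m * `|l| <= e1 * m * (`|dl| + l0).
  by rewrite ler_wpM2l// mulr_ge0// ltW.
rewrite -/dl.
have : k * (q%:R * `|l| * e1 + e1) = e1 * m * `|l| + e1 * k by rewrite /m; ring.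
have : e1 * (m * l0 + k) = e1 * m * l0 + e1 * k by ring.
by move: h6; rewrite mulrDr; lra.
Unshelve. all: by end_near. Qed.

(** The second component of [z] stacks the point and its multiplier. *)
Let kkt (z : 'rV[R]_d * 'rV[R]_(d + q)) : 'rV[R]_(d + q) :=
  row_mx (g z.1 (lsubmx z.2) + rsubmx z.2 *m (J z.1 (lsubmx z.2))^T) (G z.1 (lsubmx z.2)).

Let sol x := row_mx (S x) (multiplier x).

Let kkt_deriv (Lg : 'rV[R]_d * 'rV[R]_d -> 'rV[R]_d) (LJ : 'rV[R]_d * 'rV[R]_d -> 'M[R]_(d, q))
    (LG : 'rV[R]_d * 'rV[R]_d -> 'rV[R]_q) x w (z : 'rV[R]_d * 'rV[R]_(d + q)) :=
  row_mx (Lg (z.1, lsubmx z.2) + (rsubmx z.2 *m (J x (lsubmx w))^T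
     + rsubmx w *m (LJ (z.1, lsubmx z.2))^T)) (LG (z.1, lsubmx z.2)).

Lemma kkt_sdiff x w Lg LJ LG :
  sdiff (fun z => g z.1 z.2) (x, lsubmx w) Lg -> sdiff (fun z => J z.1 z.2) (x, lsubmx w) LJ ->
  sdiff (fun z => G z.1 z.2) (x, lsubmx w) LG ->
  sdiff kkt (x, w) (kkt_deriv Lg LJ LG x w).
Proof.
move=> sg sJ sG.
pose pr (z : 'rV[R]_d * 'rV[R]_(d + q)) := (z.1, lsubmx z.2).
have bl : blin pr.
  by apply: blin_pair; [exact: blin_fst|exact: (blin_comp (blin_lsubmx _ _ _) (blin_snd _ _))].
have bp := sdiff_lin (x, w) bl.
have br : blin (fun z : 'rV[R]_d * 'rV[R]_(d + q) => rsubmx z.2).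
  exact: (blin_comp (blin_rsubmx _ _ _) (blin_snd _ _)).
have sgp : sdiff (fun z => g z.1 (lsubmx z.2)) (x, w) (Lg \o pr) by exact: (sdiff_comp sg bp).
have sJp : sdiff (fun z => J z.1 (lsubmx z.2)) (x, w) (LJ \o pr) by exact: (sdiff_comp sJ bp).
have sGp : sdiff (fun z => G z.1 (lsubmx z.2)) (x, w) (LG \o pr) by exact: (sdiff_comp sG bp).
have sJT := sdiff_comp (sdiff_lin _ (blin_trmx d q)) sJp.
exact: (sdiff_row_mx (sdiffD sgp (sdiff_mulmx (sdiff_lin (x, w) br) sJT)) sGp).
Qed.

Lemma kkt_sol : \forall x \near x0, kkt (x, sol x) = 0.
Proof.
apply: nearS2 multiplierP feasS => x h1 h2.
by rewrite /kkt /sol /= row_mxKl row_mxKr h1 h2 row_mx0.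
Qed.

Lemma sol_cont : {for x0, continuous sol}.
Proof.
have cS := contS; have cM := multiplier_cont.
apply/cont_distP => e e0.
apply: nearS2 ((cont_distP _ _).1 cS e e0) ((cont_distP _ _).1 cM e e0) => x h1 h2.
rewrite /sol opp_row_mx add_row_mx; apply: mxnorm_le => [|i j]; first exact: ltW.
rewrite mxE; case: splitP => k _; exact: le_trans (coord_le_norm _ _ _) _.
Qed.

(** The model is exact to first order at its base point: along the diagonal the
    total derivatives of [phi] and [G] equal the partial ones in [y]. *)
Hypothesis diag_phi : \forall y \near x0, sdiff (fun y => phi y y) y (dot (g y y)).
Hypothesis diag_G : \forall y \near x0, sdiff (fun y => G y y) y (fun v => v *m J y y).
Hypothesis c0 : 0 < c.
Hypothesis grow : \forall y \near x0, G x0 y = 0 ->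
  phi x0 x0 + c * dot (y - x0) (y - x0) <= phi x0 y.

Section Derivatives.
Variables (Lg : 'rV[R]_d * 'rV[R]_d -> 'rV[R]_d) (LJ : 'rV[R]_d * 'rV[R]_d -> 'M[R]_(d, q)).
Variables (LG : 'rV[R]_d * 'rV[R]_d -> 'rV[R]_q).
Hypothesis sg : sdiff (fun z => g z.1 z.2) (x0, x0) Lg.
Hypothesis sJ : sdiff (fun z => J z.1 z.2) (x0, x0) LJ.
Hypothesis sG : sdiff (fun z => G z.1 z.2) (x0, x0) LG.

Let l0 := multiplier x0.
(** The derivative, in both variables, of the [y]-gradient of the Lagrangian with its multiplier
    frozen at [l0]. [H] is its part in [y]; [Q] is taken along the diagonal, where [diag_phi] and
    [diag_G] make it a Hessian too. *)
Let A z := Lg z + l0 *m (LJ z)^T.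
Let H v := A (0, v).
Let Q v := A (v, v).

Lemma blinA : blin A.
Proof.
apply: blin_add; first exact: sg.1.
exact: (blin_comp (blin_mulmxl d l0) (blin_comp (blin_trmx _ _) sJ.1)).
Qed.

Lemma blinH : blin H.
Proof. exact: (blin_comp blinA (blin_pair (blin_cst0 _ _) (blin_id _))). Qed.

Lemma blinQ : blin Q.
Proof. exact: (blin_comp blinA (blin_pair (blin_id _) (blin_id _))). Qed.

Lemma lagrange0 : g x0 x0 + l0 *m (J x0 x0)^T = 0.
Proof. by have := nbhs_singleton multiplierP; rewrite Sx0. Qed.

Lemma G00 : G x0 x0 = 0.
Proof. by have := nbhs_singleton feasS; rewrite Sx0. Qed.

Let lag y := phi x0 y + dot l0 (G x0 y).
Let lagd y := phi y y + dot l0 (G y y).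

Lemma near_slice (P : 'rV[R]_d * 'rV[R]_d -> Prop) :
  (\forall z \near (x0, x0), P z) -> \forall y \near x0, P (x0, y).
Proof. by apply: (cont_pair (@cvg_cst _ _ _ _ _) (@cont_id _ _ x0)). Qed.

Lemma near_diag (P : 'rV[R]_d * 'rV[R]_d -> Prop) :
  (\forall z \near (x0, x0), P z) -> \forall y \near x0, P (y, y).
Proof. by apply: (cont_pair (@cont_id _ _ x0) (@cont_id _ _ x0)). Qed.

Lemma lag_grad : \forall y \near x0, sdiff lag y (dot (g x0 y + l0 *m (J x0 y)^T)).
Proof.
apply: nearS2 (near_slice grad_phi) (near_slice jac_G) => y /= h1 h2.
have := sdiffD h1 (sdiff_comp (sdiff_lin (G x0 y) (blin_dot l0)) h2).
by apply: sdiff_eqL => v /=; rewrite dotDl dot_mulmx trmxK.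
Qed.

Lemma lagd_grad : \forall y \near x0, sdiff lagd y (dot (g y y + l0 *m (J y y)^T)).
Proof.
apply: nearS2 diag_phi diag_G => y /= h1 h2.
have := sdiffD h1 (sdiff_comp (sdiff_lin (G y y) (blin_dot l0)) h2).
by apply: sdiff_eqL => v /=; rewrite dotDl dot_mulmx trmxK.
Qed.

Lemma lag_hess : sdiff (fun y => g x0 y + l0 *m (J x0 y)^T) x0 H.
Proof.
have sp : sdiff (fun y : 'rV[R]_d => (x0, y)) x0 (fun v => (0, v)).
  exact: (sdiff_pair (sdiff_cst _ _) (sdiff_id _)).
have s1 := sdiff_comp sg sp.
have s2 := sdiff_comp (sdiff_lin _ (blin_mulmxl d l0))
  (sdiff_comp (sdiff_lin _ (blin_trmx _ _)) (sdiff_comp sJ sp)).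
exact: (sdiffD s1 s2).
Qed.

Lemma lagd_hess : sdiff (fun y => g y y + l0 *m (J y y)^T) x0 Q.
Proof.
have sp : sdiff (fun y : 'rV[R]_d => (y, y)) x0 (fun v => (v, v)).
  exact: (sdiff_pair (sdiff_id _) (sdiff_id _)).
have s1 := sdiff_comp sg sp.
have s2 := sdiff_comp (sdiff_lin _ (blin_mulmxl d l0))
  (sdiff_comp (sdiff_lin _ (blin_trmx _ _)) (sdiff_comp sJ sp)).
exact: (sdiffD s1 s2).
Qed.

Lemma LG_slice v : LG (0, v) = v *m J x0 x0.
Proof.
have sp : sdiff (fun y : 'rV[R]_d => (x0, y)) x0 (fun v => (0, v)).
  exact: (sdiff_pair (sdiff_cst _ _) (sdiff_id _)).
have := sdiff_uniq (sdiff_comp sG sp) (nbhs_singleton jac_G).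
by move=> /(congr1 (fun f => f v)).
Qed.

(** By [diag_G] the derivative along the diagonal is already the partial derivative in [y], which
    leaves nothing for the derivative in [x]. *)
Lemma LG_left v : LG (v, 0) = 0.
Proof.
have sp : sdiff (fun y : 'rV[R]_d => (y, y)) x0 (fun v => (v, v)).
  exact: (sdiff_pair (sdiff_id _) (sdiff_id _)).
have := sdiff_uniq (sdiff_comp sG sp) (nbhs_singleton diag_G).
move=> /(congr1 (fun f => f v)) /=; rewrite -LG_slice => h.
have : LG (v, v) = LG (v, 0) + LG (0, v).
  by rewrite -(blinD sG.1); congr (LG (_, _)); rewrite ?addr0 ?add0r.
by rewrite h => /esym/eqP; rewrite -subr_eq0 addrK => /eqP.
Qed.

(** On feasible points the Lagrangian equals [phi], so its second-order expansion inherits the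
    quadratic growth; [ljusternik] supplies feasible points [x0 + t w] with [w] close to [v]. *)
Lemma H_pos v : v *m J x0 x0 = 0 -> v != 0 -> 0 < dot (H v) v.
Proof.
move=> vJ v0; rewrite ltNge; apply/negP => Hv.
pose psi w := c * dot w w - dot (H w) w / 2.
have vv : 0 < dot v v by rewrite (lt_le_trans _ (norm_le_dot v))// exprn_gt0// normr_gt0.
have psiv : 0 < psi v by rewrite /psi; have := mulr_gt0 c0 vv; lra.
have cpsi : {for v, continuous psi}.
  rewrite (_ : psi = fun w => dot (c *: w + - 2^-1 *: H w) w).
    exact: quad_cont (blin_add (blin_scale c (blin_id _)) (blin_scale (- 2^-1) blinH)).
  by apply/funext => w; rewrite /psi [RHS]dotDl ![in RHS]dotZl; ring.
pose v1 := (`|v| + 1) ^+ 2.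
have v10 : 0 < v1 by rewrite exprn_gt0// ltr_wpDl.
(* The expansion gives [psi w <= e * |w| ^+ 2 <= psi v / 2], while continuity keeps [psi w] above
   two thirds of [psi v]. *)
pose e := psi v / 2 / v1; have e0 : 0 < e by rewrite !divr_gt0.
have psi20 : 0 < psi v / 2 by lra.
have [d1 d10 hd1] := (near_distP _ _).1 ((cont_distP _ _).1 cpsi (psi v / 3) (divr_gt0 psiv (ltr0Sn _ _))).
have [d2 d20 hd2] := (near_distP _ _).1 (nearI grow (second_order_expansion lag_grad lag_hess e0)).
pose e2 := Num.min 1 (d1 / 2).
have e20 : 0 < e2 by rewrite lt_min ltr01; lra.
have [T T0 hT] := ljusternik (nbhs_singleton jac_G) C0J G00 vJ e20.
have vd0 : 0 < `|v| + 2 by rewrite ltr_wpDl.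
pose m := Num.min T (d2 / (`|v| + 2)).
have m0 : 0 < m by rewrite lt_min T0 divr_gt0.
pose t := m / 2; have t0 : 0 < t by rewrite /t; lra.
have tm : t < m by rewrite /t; lra.
move: (tm); rewrite lt_min => /andP[tT]; rewrite ltr_pdivlMr// => tdd.
have [|y Gy hy] := hT t; first by rewrite t0.
pose w := t^-1 *: (y - x0).
have yE : y - x0 = t *: w by rewrite /w scalerA divff ?gt_eqF// scale1r.
have wv : `|v - w| <= e2.
  rewrite -(ler_pM2l t0) -{1}(gtr0_norm t0) -normrZ scalerBr -yE mulrC.
  by rewrite distrC (le_trans _ hy)// opprD addrA.
have w1 : `|w| <= `|v| + 1.
  have : `|w| <= `|v| + `|v - w| by rewrite -{1}(subKr v w) ler_normB.
  have : e2 <= 1 by rewrite ge_min lexx.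
  by lra.
clearbody w.
have [|gr ex] := hd2 y.
  rewrite distrC yE normrZ gtr0_norm// (le_lt_trans _ tdd)// ler_pM2l//; lra.
have := hd1 w; rewrite (le_lt_trans wv); last by rewrite gt_min; apply/orP; right; lra.
move=> /(_ isT) /(le_trans (ler_norm _)) hpsi.
have := gr Gy; move: ex.
rewrite lagrange0 dot0l subr0 /lag Gy G00 dot0r !addr0 yE.
rewrite (blinZ blinH) !dotZl !dotZr normrZ gtr0_norm// exprMn ler_distl => /andP[_ h1] h2.
have h3 : t ^+ 2 * psi w <= t ^+ 2 * (e * `|w| ^+ 2).
  by move: h1 h2; rewrite /psi; lra.
have t2 : 0 < t ^+ 2 by rewrite exprn_gt0.
move: h3; rewrite ler_pM2l// => h3.
have h4 : e * `|w| ^+ 2 <= e * v1 by rewrite ler_pM2l// ler_pXn2r ?nnegrE ?addr_ge0.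
have : e * v1 = psi v / 2 by rewrite /e divfK// gt_eqF.
by lra.
Qed.

(** The mirror image of [H_pos] along the diagonal: quadratic decrease at feasible points forces a
    negative value of the second-order term. *)
Lemma Q_neg u a : u *m J x0 x0 = 0 -> a < 0 ->
  (forall e, 0 < e -> exists t, [/\ 0 < t, t < e & exists y, [/\ `|y - (x0 + t *: u)| <= e * t,
     G y y = 0 & phi y y - phi x0 x0 <= a * t ^+ 2]]) ->
  dot (Q u) u < 0.
Proof.
move=> uJ a0 h; rewrite ltNge; apply/negP => Qu.
pose psi w := dot (Q w) w / 2.
have cpsi : {for u, continuous psi}.
  rewrite (_ : psi = fun w => dot (2^-1 *: Q w) w).
    exact: quad_cont (blin_scale 2^-1 blinQ).
  by apply/funext => w; rewrite /psi dotZl mulrC.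
pose v1 := (`|u| + 1) ^+ 2.
have v10 : 0 < v1 by rewrite exprn_gt0// ltr_wpDl.
have a30 : 0 < - a / 3 by lra.
(* The expansion error and the change from [psi u] to [psi w] cost [- a / 3] each, so
   [psi u <= a / 3 < 0]. *)
pose e := - a / 3 / v1; have e0 : 0 < e by rewrite divr_gt0.
have [d1 d10 hd1] := (near_distP _ _).1 ((cont_distP _ _).1 cpsi _ a30).
have [d2 d20 hd2] := (near_distP _ _).1 (second_order_expansion lagd_grad lagd_hess e0).
have vd0 : 0 < `|u| + 2 by rewrite ltr_wpDl.
pose e2 := Num.min (Num.min 1 (d1 / 2)) (d2 / (`|u| + 2)).
have e20 : 0 < e2.
  by rewrite !lt_min ltr01 /=; apply/andP; split; [lra|exact: divr_gt0].
have [t [t0 te [y [hy Gy hphi]]]] := h e2 e20.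
move: (te); rewrite lt_min => /andP[_]; rewrite ltr_pdivlMr// => tdd.
pose w := t^-1 *: (y - x0).
have yE : y - x0 = t *: w by rewrite /w scalerA divff ?gt_eqF// scale1r.
have wv : `|u - w| <= Num.min 1 (d1 / 2).
  rewrite (@le_trans _ _ e2)//; last by rewrite /e2 ge_min lexx.
  rewrite -(ler_pM2l t0) -{1}(gtr0_norm t0) -normrZ scalerBr -yE mulrC.
  by rewrite distrC (le_trans _ hy)// opprD addrA.
have w1 : `|w| <= `|u| + 1.
  have : `|w| <= `|u| + `|u - w| by rewrite -{1}(subKr u w) ler_normB.
  have : Num.min 1 (d1 / 2) <= 1 by rewrite ge_min lexx.
  by lra.
clearbody w.
have ex := hd2 y _.
have {}ex : `|lagd y - lagd x0 - dot (g x0 x0 + l0 *m (J x0 x0)^T) (y - x0)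
    - dot (Q (y - x0)) (y - x0) / 2| <= e * `|y - x0| ^+ 2.
  apply: ex; rewrite distrC yE normrZ gtr0_norm// (le_lt_trans _ tdd)// ler_pM2l//; lra.
have := hd1 w; rewrite (le_lt_trans wv); last by rewrite gt_min; apply/orP; right; lra.
move=> /(_ isT) /(le_trans (ler_norm _)) hpsi.
move: ex.
rewrite lagrange0 dot0l subr0 /lagd Gy G00 dot0r !addr0 yE.
rewrite (blinZ blinQ) !dotZl !dotZr normrZ gtr0_norm// exprMn ler_distl => /andP[h1 _].
have h3 : t ^+ 2 * (psi w - e * `|w| ^+ 2) <= t ^+ 2 * a.
  by move: h1 hphi; rewrite /psi; lra.
have t2 : 0 < t ^+ 2 by rewrite exprn_gt0.
move: h3; rewrite ler_pM2l// => h3.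
have h4 : e * `|w| ^+ 2 <= e * v1 by rewrite ler_pM2l// ler_pXn2r ?nnegrE ?addr_ge0.
have : e * v1 = - a / 3 by rewrite /e divfK// gt_eqF.
have : 0 <= psi u by rewrite /psi; lra.
by lra.
Qed.

(** Pairing the linearized stationarity equation with the tangent vector [v] removes the multiplier,
    so [H_pos] gives [v = 0]; then the full rank of [J] gives [m = 0]. *)
Lemma kkt_inj w : kkt_deriv Lg LJ LG x0 (sol x0) (0, w) = 0 -> w = 0.
Proof.
rewrite /kkt_deriv /= /sol row_mxKl row_mxKr Sx0 -row_mx0 => /eq_row_mx[].
set v := lsubmx w; set m := rsubmx w; rewrite LG_slice => h vJ.
have Hv : H v + m *m (J x0 x0)^T = 0 by rewrite -h /H /A; zmod.
have : dot (H v) v = 0.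
  have -> : H v = - (m *m (J x0 x0)^T) by apply/eqP; rewrite -addr_eq0 Hv.
  by rewrite dotNl dot_mulmx trmxK vJ dot0r oppr0.
have [v0 _|/(H_pos vJ) + h0] := eqVneq v 0; last by rewrite h0 ltxx.
have m0 : m = 0.
  move: Hv; rewrite v0 (blin0 blinH) add0r => mJ.
  by rewrite -(mulmx1 m) -trmx1 -C0J trmx_mul mulmxA mJ mul0mx.
by rewrite -(hsubmxK w) -/v -/m v0 m0 row_mx0.
Qed.

End Derivatives.

Lemma sol_sdiff : \forall x \near x0, exists M, sdiff sol x M.
Proof.
have [Lg sg] := nbhs_singleton smooth_g.
have [LJ sJ] := nbhs_singleton smooth_J.
have [LG sG] := nbhs_singleton smooth_G.
have lE : lsubmx (sol x0) = x0 by rewrite /sol row_mxKl Sx0.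
have sk : sdiff kkt (x0, sol x0) (kkt_deriv Lg LJ LG x0 (sol x0)).
  by apply: kkt_sdiff; rewrite lE.
have nk : \forall z \near (x0, sol x0), exists M, sdiff kkt z M.
  pose pr (z : 'rV[R]_d * 'rV[R]_(d + q)) := (z.1, lsubmx z.2).
  have bl : blin pr.
    by apply: blin_pair; [exact: blin_fst|exact: (blin_comp (blin_lsubmx _ _ _) (blin_snd _ _))].
  have cpr := blin_cont bl (x := (x0, sol x0)).
  have := nearI smooth_g (nearI smooth_J smooth_G).
  rewrite -{2}lE => /cpr; apply: nearS => -[x w] /= [[Mg hg] [[MJ hJ] [MG hG]]].
  by exists (kkt_deriv Mg MJ MG x w); exact: kkt_sdiff.
exact: implicit_near nk sk (kkt_inj sg sJ sG) sol_cont kkt_sol.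
Qed.

Lemma solution_sdiff : \forall x \near x0, exists M, sdiff S x M.
Proof.
apply: nearS sol_sdiff => x [M hM].
have := sdiff_comp (sdiff_lin (sol x) (blin_lsubmx _ _ _)) hM.
move=> h; exists (lsubmx \o M); move: h; congr (sdiff _ _ _).
by apply/funext => y; rewrite /sol /= row_mxKl.
Qed.

Lemma solution_eigenvalue u a M : sdiff S x0 M -> u *m J x0 x0 = 0 -> a < 0 ->
  (forall e, 0 < e -> exists t, [/\ 0 < t, t < e & exists y, [/\ `|y - (x0 + t *: u)| <= e * t,
     G y y = 0 & phi y y - phi x0 x0 <= a * t ^+ 2]]) ->
  exists2 k, 1 < k & exists2 v, v != 0 & M v = k *: v.
Proof.
have [Lg sg] := nbhs_singleton smooth_g.
have [LJ sJ] := nbhs_singleton smooth_J.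
have [LG sG] := nbhs_singleton smooth_G.
move=> sS uJ a0 h.
pose l0 := multiplier x0.
pose A z := Lg z + l0 *m (LJ z)^T.
have bA : blin A by exact: blinA.
have [P hP] := nbhs_singleton sol_sdiff.
have [N sN] : exists N, sdiff multiplier x0 N.
  have := sdiff_comp (sdiff_lin (sol x0) (blin_rsubmx _ _ _)) hP.
  move=> h'; exists (rsubmx \o P); move: h'; congr (sdiff _ _ _).
  by apply/funext => y; rewrite /sol /= row_mxKr.
have sp : sdiff (fun x => (x, S x)) x0 (fun v => (v, M v)).
  exact: sdiff_pair (sdiff_id x0) sS.
have sGS : sdiff (fun x => G x (S x)) x0 (fun v => LG (v, M v)).
  by apply: (@sdiff_comp _ _ _ _ (fun z => G z.1 z.2) (fun x => (x, S x)) x0 LG _ _ sp); rewrite Sx0.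
have sgS : sdiff (fun x => g x (S x)) x0 (fun v => Lg (v, M v)).
  by apply: (@sdiff_comp _ _ _ _ (fun z => g z.1 z.2) (fun x => (x, S x)) x0 Lg _ _ sp); rewrite Sx0.
have sJS : sdiff (fun x => J x (S x)) x0 (fun v => LJ (v, M v)).
  by apply: (@sdiff_comp _ _ _ _ (fun z => J z.1 z.2) (fun x => (x, S x)) x0 LJ _ _ sp); rewrite Sx0.
have hG v : LG (v, M v) = 0.
  have := sdiff_uniq (sdiff_near_eq feasS sGS) (sdiff_cst 0 x0).
  by move=> /(congr1 (fun f => f v)).
have sJT := sdiff_comp (sdiff_lin _ (blin_trmx d q)) sJS.
have hA v : A (v, M v) + N v *m (J x0 x0)^T = 0.
  have := sdiff_uniq (sdiff_near_eq multiplierP (sdiffD sgS (sdiff_mulmx sN sJT))) (sdiff_cst 0 x0).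
  by move=> /(congr1 (fun f => f v)) <- /=; rewrite Sx0 /A -/l0; zmod.
have split2 (W : normedModType R) (B : 'rV[R]_d * 'rV[R]_d -> W) v w : blin B -> B (v, w) = B (v, 0) + B (0, w).
  by move=> hB; rewrite -(blinD hB); congr (B (_, _)); rewrite ?addr0 ?add0r.
(* [M v] is tangent even when [v] is not, because the constraints do not depend on [x] to first
   order. *)
have MJ v : M v *m J x0 x0 = 0.
  have := split2 _ LG v (M v) sG.1.
  by rewrite hG (LG_left sG) add0r (LG_slice sG).
apply: (@eigenvector_gt1 _ _ _ (J x0 x0) (fun v => A (0, v)) (fun v => A (v, v)) M _ _ _ _ _ _ _ u) => //.
- exact: blinH.
- exact: blinQ.
- exact: hessian_sym (lag_grad) (lag_hess sg sJ).
- exact: hessian_sym (lagd_grad) (lagd_hess sg sJ).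
- exact: H_pos sg sJ.
- move=> w v wJ vJ.
  have -> : A (0, M w - w) = A (w, M w) - A (w, w).
    by rewrite -(blinB bA); congr (A (_, _)); rewrite subrr.
  have -> : A (w, M w) = - (N w *m (J x0 x0)^T) by apply/eqP; rewrite -addr_eq0 hA.
  by rewrite dotBl dotNl dot_mulmx trmxK vJ dot0r oppr0 sub0r.
- exact: (Q_neg sg sJ (a := a)).
Qed.

End Parametric.

(** * Weakly convex functions *)

Section WeaklyConvex.
Context {R : realType}.
Implicit Types n : nat.

(** [D] is the domain of an extended-valued function and [f] its real part; for
    [c < 0] this is strong convexity. *)
Definition wcvx n (c : R) (D : set 'rV[R]_n) (f : 'rV[R]_n -> R) :=
  forall t x y, 0 <= t <= 1 -> D x -> D y -> D (t *: x + (1 - t) *: y) /\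
    f (t *: x + (1 - t) *: y) <= t * f x + (1 - t) * f y
       + c / 2 * (t * (1 - t)) * dot (x - y) (x - y).

Definition subgradient n (D : set 'rV[R]_n) (f : 'rV[R]_n -> R) x v :=
  D x /\ forall e, 0 < e -> \forall y \near x, D y ->
    f x + dot v (y - x) - e * norm2 (y - x) <= f y.

Lemma wcvx_le n c c' (D : set 'rV[R]_n) f : c <= c' -> wcvx c D f -> wcvx c' D f.
Proof.
move=> cc' h t x y t01 Dx Dy; have [Dz hz] := h t x y t01 Dx Dy; split=> //.
rewrite (le_trans hz)// lerD2l ler_wpM2r ?dot_ge0//.
by move/andP: t01 => [t0 t1]; rewrite ler_wpM2r ?mulr_ge0 ?subr_ge0// ler_pM2r.
Qed.

Lemma wcvxD n c c' (D : set 'rV[R]_n) f f' :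
  wcvx c D f -> wcvx c' D f' -> wcvx (c + c') D (fun x => f x + f' x).
Proof.
move=> h h' t x y t01 Dx Dy; have [Dz hz] := h t x y t01 Dx Dy.
by have [_ hz'] := h' t x y t01 Dx Dy; split=> //; lra.
Qed.

Lemma wcvxS n c (D D' : set 'rV[R]_n) f :
  wcvx c D f -> (forall t x y, 0 <= t <= 1 -> D' x -> D' y -> D' (t *: x + (1 - t) *: y)) ->
  (forall x, D' x -> D x) -> wcvx c D' f.
Proof.
move=> h cD sub t x y t01 Dx Dy; have [_ hz] := h t x y t01 (sub _ Dx) (sub _ Dy).
by split=> //; exact: cD.
Qed.

Lemma wcvx_quad n (a : R) (p : 'rV[R]_n) : wcvx (- (2 * a)) setT (fun x => a * dot (x - p) (x - p)).
Proof.
move=> t x y _ _ _; split=> //.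
have -> : t *: x + (1 - t) *: y - p = t *: (x - p) + (1 - t) *: (y - p).
  by rewrite !(scalerBr, scalerBl, scale1r); zmod.
have -> : x - y = (x - p) - (y - p) by zmod.
rewrite !(dotDl, dotDr, dotNl, dotNr, dotZl, dotZr) (dotC y x) (dotC p x) (dotC p y).
by rewrite le_eqVlt; apply/orP; left; apply/eqP; field.
Qed.

Lemma wcvx_affine n m (h : 'rV[R]_m -> R) (A : 'M[R]_(n, m)) (b : 'rV[R]_m) :
  wcvx 0 setT h -> wcvx 0 setT (fun x => h (b + x *m A)).
Proof.
move=> hc t x y t01 _ _; split=> //; rewrite !mul0r addr0.
have [_] := hc t (b + x *m A) (b + y *m A) t01 I I.
rewrite !mul0r addr0; apply: le_trans; rewrite le_eqVlt; apply/orP; left; apply/eqP; congr h.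
by rewrite mulmxDl -!scalemxAl !(scalerDr, scalerBl, scale1r); zmod.
Qed.

(** The local inequality at [t y + (1 - t) x] is combined with weak convexity along the segment,
    divided by [t], and [t] is taken small. *)
Lemma subgradient_global n c (D : set 'rV[R]_n) f x v : wcvx c D f -> subgradient D f x v ->
  forall y, D y -> f x + dot v (y - x) - c / 2 * dot (y - x) (y - x) <= f y.
Proof.
move=> cf [Dx sv] y Dy.
have [->|yx] := eqVneq y x; first by rewrite subrr !dot0r mulr0 subr0 addr0.
apply/ler_addgt0Pr => e0 e00.
(* The first summand weighs the error term of the subgradient inequality; the second pays for
   replacing [1 - t] by 1 in the curvature term, since [t <= e]. *)
set w := y - x; pose N := norm2 w + `|c / 2 * dot w w| + 1.
have N0 : 0 < N by rewrite ltr_wpDl// addr_ge0// sqrtr_ge0.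
pose e := e0 / N; have e_gt0 : 0 < e by rewrite divr_gt0.
have [d d0 hd] := (near_distP _ _).1 (sv e e_gt0).
have w0 : 0 < `|w| by rewrite normr_gt0 subr_eq0.
pose t := Num.min (Num.min 1 e) (d / (2 * `|w|)).
have t0 : 0 < t by rewrite !lt_min ltr01 e_gt0 divr_gt0// mulr_gt0.
have t1 : t <= 1 by rewrite !ge_min lexx.
have te : t <= e by rewrite !ge_min lexx !orbT.
have td : t * `|w| < d.
  rewrite (@le_lt_trans _ _ (d / 2))//; last by lra.
  rewrite -ler_pdivlMr// (_ : d / 2 / `|w| = d / (2 * `|w|)); last by rewrite invfM mulrA.
  by rewrite ge_min lexx orbT.
have t01 : 0 <= t <= 1 by rewrite ltW.
have [Dz fz] := cf t y x t01 Dy Dx.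
have zE : t *: y + (1 - t) *: x - x = t *: w.
  by rewrite scalerBl scale1r /w scalerBr; zmod.
have := hd (t *: y + (1 - t) *: x); rewrite distrC zE normrZ (gtr0_norm t0) => /(_ td Dz).
have -> : norm2 (t *: w) = t * norm2 w.
  by rewrite /norm2 dotZl dotZr mulrA -expr2 sqrtrM ?sqr_ge0// sqrtr_sqr gtr0_norm.
rewrite dotZr => h1.
have {h1 fz} : t * (f x + dot v w - e * norm2 w) <= t * (f y + c / 2 * (1 - t) * dot w w).
  by move: h1 fz; rewrite -/w; lra.
rewrite ler_pM2l// => h1.
have h2 : - (c / 2 * t * dot w w) <= e * `|c / 2 * dot w w|.
  rewrite (le_trans (ler_norm _))// normrN mulrAC normrM mulrC (gtr0_norm t0).
  by rewrite ler_wpM2r.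
have : e * N = e0 by rewrite /e divfK// gt_eqF.
by rewrite /N; lra.
Qed.

Lemma min_subgradient n (D : set 'rV[R]_n) f x : D x -> (forall y, D y -> f x <= f y) ->
  subgradient D f x 0.
Proof.
move=> Dx h; split=> // e e0; apply/near_distP; exists 1 => // y _ Dy; rewrite dot0l addr0.
have N0 : 0 <= norm2 (y - x) by exact: sqrtr_ge0.
by have := mulr_ge0 (ltW e0) N0; have := h y Dy; lra.
Qed.

Lemma wcvx_min_growth n c (D : set 'rV[R]_n) f x : wcvx (- c) D f -> D x ->
  (forall y, D y -> f x <= f y) -> forall y, D y -> f x + c / 2 * dot (y - x) (y - x) <= f y.
Proof.
move=> cf Dx h y Dy; have := subgradient_global cf (min_subgradient Dx h) Dy.
by rewrite dot0l; lra.
Qed.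

Lemma quad_subgradient n c (D : set 'rV[R]_n) f x v : D x ->
  (forall y, D y -> f x + dot v (y - x) - c * dot (y - x) (y - x) <= f y) ->
  subgradient D f x v.
Proof.
move=> Dx h; split=> // e e0.
have e'0 : 0 < e / (`|c| + 1) / n.+1%:R by rewrite !divr_gt0// ltr_wpDl.
apply/near_distP; exists (e / (`|c| + 1) / n.+1%:R) => // y xy Dy.
rewrite (le_trans _ (h y Dy))// lerD2l lerN2.
rewrite -norm2_sqr expr2 mulrA ler_wpM2r ?sqrtr_ge0//.
have N0 : 0 <= norm2 (y - x) by exact: sqrtr_ge0.
have h1 : norm2 (y - x) <= e / (`|c| + 1).
  rewrite (le_trans (norm2_le _))// mulrC -ler_pdivlMr// ltW// distrC//.
rewrite (@le_trans _ _ ((`|c| + 1) * norm2 (y - x)))//.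
  by rewrite ler_wpM2r//; have := ler_norm c; lra.
by rewrite mulrC -ler_pdivlMr// ltr_wpDl.
Qed.

End WeaklyConvex.

(** * Continuity of finite convex functions *)

Section ConvexContinuous.
Context {R : realType} {m : nat}.
Variable h : 'rV[R]_m -> R.
Hypothesis hc : wcvx 0 setT h.

Lemma cvxP t x y : 0 <= t <= 1 -> h (t *: x + (1 - t) *: y) <= t * h x + (1 - t) * h y.
Proof. by move=> t01; have [_] := hc t01 (I : setT x) (I : setT y); rewrite !mul0r addr0. Qed.

(** Induction on the number of coordinates that may be nonzero: [y] is the midpoint of [s], twice
    [y] without its coordinate [i], and [a *: ei], which lies on the segment between [- ei] and
    [ei]. *)
Lemma cvx_bounded_above z : exists2 d, 0 < d & exists B, forall y, `|y - z| <= d -> h y <= B.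
Proof.
suff H k : (k <= m)%N -> exists2 d, 0 < d & exists B, forall y : 'rV[R]_m, `|y| <= d ->
    (forall i : 'I_m, (k <= i)%N -> y 0 i = 0) -> h (z + y) <= B.
  have [d d0 [B hB]] := H m (leqnn m).
  exists d => //; exists B => y yz; have -> : y = z + (y - z) by rewrite addrC subrK.
  by apply: hB => // i; rewrite leqNgt ltn_ord.
elim: k => [_|k IH km].
  exists 1 => //; exists (h z) => y _ y0.
  have -> : y = 0 by apply/rowP => i; rewrite y0// mxE.
  by rewrite addr0.
have [d d0 [B hB]] := IH (ltnW km).
pose i := Ordinal km; pose ei : 'rV[R]_m := delta_mx 0 i.
exists (Num.min (d / 2) (1 / 2)); first by rewrite lt_min; lra.
exists (B / 2 + Num.max (h (z + ei)) (h (z - ei)) / 2) => y.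
rewrite le_min => /andP[yd y1] y0.
pose s := 2 *: (y - y 0 i *: ei); pose a := 2 * y 0 i.
have hs : h (z + s) <= B.
  apply: hB.
    rewrite normrZ gtr0_norm// mulrC -ler_pdivlMr//.
    apply: mxnorm_le => [|p j]; first by lra.
    rewrite ord1 !mxE eqxx /=; have [->|ji] := eqVneq j i.
      by rewrite mulr1 subrr normr0; lra.
    by rewrite mulr0 subr0 (le_trans (coord_le_norm _ _ _)).
  move=> j; rewrite leq_eqVlt => /orP[/eqP kj|kj].
    have -> : j = i by apply/val_inj.
    by rewrite !mxE !eqxx mulr1 subrr mulr0.
  rewrite !mxE eqxx /= y0//; have [ji|] := eqVneq j i; last by rewrite mulr0 subrr mulr0.
  by move: kj; rewrite ji /= ltnn.
have a1 : `|a| <= 1.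
  by rewrite /a normrM gtr0_norm//; have := coord_le_norm y 0 i; lra.
have ha : h (z + a *: ei) <= Num.max (h (z + ei)) (h (z - ei)).
  have t01 : 0 <= (1 + a) / 2 <= 1.
    by move: a1; rewrite ler_norml => /andP[? ?]; apply/andP; split; lra.
  have := cvxP (z + ei) (z - ei) t01.
  have -> : ((1 + a) / 2) *: (z + ei) + (1 - (1 + a) / 2) *: (z - ei) = z + a *: ei.
    rewrite !scalerDr addrACA -scalerDl scalerN -scalerBl.
    congr (_ + _ *: _); last by field.
    by rewrite (_ : _ + _ = 1) ?scale1r//; field.
  move/le_trans; apply.
  set M := Num.max _ _.
  have h1 : h (z + ei) <= M by rewrite le_max lexx.
  have h2 : h (z - ei) <= M by rewrite le_max lexx orbT.
  move/andP: t01 => [t0 t1].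
  have := ler_wpM2l t0 h1; have : 0 <= 1 - (1 + a) / 2 by lra.
  by move=> /ler_wpM2l /(_ _ _ h2); lra.
have h12 : 0 <= (2^-1 : R) <= 1 by apply/andP; split; lra.
have := cvxP (z + s) (z + a *: ei) h12.
have -> : 2^-1 *: (z + s) + (1 - 2^-1) *: (z + a *: ei) = z + y.
  have -> : 1 - 2^-1 = 2^-1 :> R by field.
  rewrite -scalerDr addrACA scalerDr; congr (_ + _).
    by rewrite scalerDr -scalerDl (_ : 2^-1 + 2^-1 = 1) ?scale1r//; field.
  rewrite /s scalerDr scalerA mulVf// scale1r scalerA /a mulrA mulVf// mul1r subrK//.
by lra.
Qed.

Lemma cvx_continuous z : {for z, continuous h}.
Proof.
have [d d0 [B hB]] := cvx_bounded_above z.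
apply/cont_distP => e e0.
pose K := Num.max 1 (B - h z).
have K0 : 0 < K by rewrite lt_max ltr01.
pose t := Num.min 1 (e / K).
have t0 : 0 < t by rewrite lt_min ltr01 divr_gt0.
have t1 : t <= 1 by rewrite ge_min lexx.
have tK : t * (B - h z) <= e.
  rewrite (@le_trans _ _ (t * K))//; first by rewrite ler_pM2l// le_max lexx orbT.
  by rewrite -ler_pdivlMr// ge_min lexx orbT.
apply/near_distP; exists (t * d); first exact: mulr_gt0.
move=> y zy; pose u := t^-1 *: (y - z).
have yE : y = z + t *: u by rewrite /u scalerA divff ?gt_eqF// scale1r addrC subrK.
have ud : `|u| <= d.
  by rewrite /u normrZ gtr0_norm ?invr_gt0// ler_pdivrMl// distrC ltW.
have hp : h (z + u) <= B by apply: hB; rewrite addrAC subrr add0r.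
have hm : h (z - u) <= B by apply: hB; rewrite addrAC subrr add0r normrN.
clearbody u; rewrite yE ler_norml; apply/andP; split.
  have t01 : 0 <= t <= 1 by rewrite ltW.
  have := cvxP (z + u) z t01.
  have -> : t *: (z + u) + (1 - t) *: z = z + t *: u.
    by rewrite scalerDr scalerBl scale1r; zmod.
  by have := ler_wpM2l (ltW t0) hp; lra.
(* For the lower bound on [h (z + t u)], [z] is written as a convex combination of [z + t u] and
   [z - u]. *)
have s01 : 0 <= (1 + t)^-1 <= 1.
  by rewrite invr_ge0 invf_le1; [apply/andP; split; lra|lra].
have := cvxP (z + t *: u) (z - u) s01.
have tp : 1 + t != 0 by rewrite gt_eqF//; lra.
have -> : 1 - (1 + t)^-1 = t / (1 + t) by field.
have -> : (1 + t)^-1 *: (z + t *: u) + (t / (1 + t)) *: (z - u) = z.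
  rewrite !scalerDr addrACA -scalerDl scalerN !scalerA [t / _]mulrC subrr addr0.
  by rewrite (_ : _ + _ = 1) ?scale1r//; field.
have -> : (1 + t)^-1 * h (z + t *: u) + t / (1 + t) * h (z - u) =
  (h (z + t *: u) + t * h (z - u)) / (1 + t) by field.
rewrite ler_pdivlMr; last by lra.
by have := ler_wpM2l (ltW t0) hm; lra.
Qed.

End ConvexContinuous.

(** * Separation and the sum rule for convex functions *)

Section SumRule.
Context {R : realType}.

(** Hahn-Banach in finite dimension: the functional is extended one coordinate at
    a time. *)
Lemma convex_set_support m (C : set ('rV[R]_m * R)) :
  (forall t p p', 0 <= t <= 1 -> C p -> C p' ->
    C (t *: p.1 + (1 - t) *: p'.1, t * p.2 + (1 - t) * p'.2)) ->
  (forall z, exists a, C (z, a)) -> (forall a, C (0, a) -> 0 <= a) ->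
  exists w, forall z a, C (z, a) -> dot w z <= a.
Proof.
move=> cC fC C0.
suff H k : (k <= m)%N -> exists w : 'rV[R]_m, forall (z : 'rV[R]_m) a, C (z, a) ->
    (forall i : 'I_m, (k <= i)%N -> z 0 i = 0) -> dot w z <= a.
  have [w hw] := H m (leqnn m); exists w => z a Cza; apply: hw => // i.
  by rewrite leqNgt ltn_ord.
elim: k => [_|k IH km].
  exists 0 => z a Cza z0; rewrite dot0l; apply: C0.
  by rewrite (_ : 0 = z)//; apply/rowP => i; rewrite z0// mxE.
have [w hw] := IH (ltnW km).
pose i := Ordinal km; pose ei : 'rV[R]_m := delta_mx 0 i.
pose supp (z : 'rV[R]_m) := forall j : 'I_m, (k.+1 <= j)%N -> z 0 j = 0.
(* Points with positive coordinate [i] bound the new coefficient from above and those with negative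
   coordinate from below; the two families of bounds are compatible. *)
have key z a z' a' : C (z, a) -> C (z', a') -> supp z -> supp z' -> 0 < z 0 i -> z' 0 i < 0 ->
    (a' - dot w z') / z' 0 i <= (a - dot w z) / z 0 i.
  move=> Cz Cz' sz sz' zi zi'.
  set s := z 0 i in zi *; set s' := z' 0 i in zi' *.
  have ss' : 0 < s - s' by lra.
  (* The weight for which coordinate [i] of the combination vanishes, so that the induction
     hypothesis applies. *)
  pose t := - s' / (s - s').
  have t01 : 0 <= t <= 1.
    by rewrite /t divr_ge0 ?ler_pdivrMr//; [apply/andP; split; lra|lra|lra].
  have ss'0 : s - s' != 0 by rewrite gt_eqF.
  have tE : 1 - t = s / (s - s') by rewrite /t; field.
  have := hw _ _ (cC t _ _ t01 Cz Cz') _ => /=.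
  rewrite tE /t dotDr !dotZr => h.
  have {}h : - s' / (s - s') * dot w z + s / (s - s') * dot w z' <=
      - s' / (s - s') * a + s / (s - s') * a'.
    apply: h => j; rewrite leq_eqVlt => /orP[/eqP kj|kj].
      by have -> : j = i by [apply/val_inj]; rewrite !mxE -/s -/s'; field.
    by rewrite !mxE sz// sz'// !mulr0 addr0.
  have {}h : - s' * dot w z + s * dot w z' <= - s' * a + s * a'.
    rewrite -(ler_pM2r (_ : 0 < (s - s')^-1)) ?invr_gt0//.
    by move: h; rewrite !mulrDl !(mulrAC _ (s - s')^-1).
  rewrite ler_pdivlMr// mulrAC ler_ndivrMr//.
  by lra.
have [a1 Ca1] := fC ei; have [a2 Ca2] := fC (- ei).
have sei : supp ei.
  by move=> j kj; rewrite !mxE eqxx /=; case: eqP => // ji; move: kj; rewrite ji ltnn.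
have sei' : supp (- ei) by move=> j kj; rewrite mxE sei// oppr0.
have eii : ei 0 i = 1 by rewrite !mxE !eqxx.
have eii' : (- ei) 0 i = -1 by rewrite mxE eii.
pose low := [set b : R | exists z a, [/\ C (z, a), supp z, z 0 i < 0 & b = (a - dot w z) / z 0 i]].
have lowU b z a : low b -> C (z, a) -> supp z -> 0 < z 0 i -> b <= (a - dot w z) / z 0 i.
  by move=> [z' [a' [Cz' sz' zi' ->]]] Cz sz zi; exact: key.
have hl : has_sup low.
  split; first by exists ((a2 - dot w (- ei)) / (- ei) 0 i), (- ei), a2; rewrite eii'; split=> //; lra.
  by exists ((a1 - dot w ei) / ei 0 i) => b hb; apply: lowU; rewrite ?eii.
exists (w + sup low *: ei) => z a Cz sz.
have dei : dot ei z = z 0 i.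
  rewrite /dot (bigD1 i)//= eii mul1r big1 ?addr0// => j ji.
  by rewrite !mxE eqxx /= (negbTE ji) mul0r.
rewrite dotDl dotZl dei.
have [zi|zi|zi] := ltgtP (z 0 i) 0.
- have : (a - dot w z) / z 0 i <= sup low.
    by apply: sup_upper_bound => //; exists z, a.
  by rewrite ler_ndivrMr//; lra.
- have : sup low <= (a - dot w z) / z 0 i.
    by apply: ge_sup => [|b hb]; [exact: hl.1|exact: lowU].
  by rewrite ler_pdivlMr//; lra.
- rewrite zi mulr0 addr0; apply: hw => // j; rewrite leq_eqVlt => /orP[/eqP kj|kj]; last exact: sz.
  by have -> : j = i by apply/val_inj.
Qed.

(** [w] supports the epigraph of the optimal value of the problem in which the
    argument of [h] is perturbed. *)
Lemma sum_rule n m (h : 'rV[R]_m -> R) (b : 'rV[R]_m) (A : 'M[R]_(n, m))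
    (D : set 'rV[R]_n) (psi : 'rV[R]_n -> R) y :
  wcvx 0 setT h -> wcvx 0 D psi -> D y ->
  (forall x, D x -> h (b + y *m A) + psi y <= h (b + x *m A) + psi x) ->
  exists w, (forall z, h (b + y *m A) + dot w (z - (b + y *m A)) <= h z) /\
    (forall x, D x -> psi y - dot w ((x - y) *m A) <= psi x).
Proof.
move=> hc pc Dy ymin; set z := b + y *m A.
pose C := [set p : 'rV[R]_m * R | exists2 x, D x &
  h (z + p.1 + (x - y) *m A) - h z + psi x - psi y <= p.2].
have [|zt|a [x Dx /= hx]|w hw] := @convex_set_support m C.
- move=> t [z1 a1] [z2 a2] t01 [x1 Dx1 /= h1] [x2 Dx2 /= h2].
  have [Dx hp] := pc t x1 x2 t01 Dx1 Dx2.
  exists (t *: x1 + (1 - t) *: x2) => //=.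
  have := cvxP hc (z + z1 + (x1 - y) *m A) (z + z2 + (x2 - y) *m A) t01.
  have -> : t *: (z + z1 + (x1 - y) *m A) + (1 - t) *: (z + z2 + (x2 - y) *m A) =
    z + (t *: z1 + (1 - t) *: z2) + (t *: x1 + (1 - t) *: x2 - y) *m A.
    by rewrite !(mulmxDl, mulNmx) -?scalemxAl !(scalerDr, scalerBl, scale1r, scalerN, mulmxDl, mulNmx) -?scalemxAl; zmod.
  move/andP: t01 => [t0 t1] hh.
  have := ler_wpM2l t0 h1; have : 0 <= 1 - t by lra.
  by move=> /ler_wpM2l /(_ _ _ h2); move: hp hh; rewrite !mul0r; lra.
- by exists (h (z + zt + (y - y) *m A) - h z + psi y - psi y), y.
- apply: le_trans hx; have := ymin x Dx; rewrite -/z addr0.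
  have -> : z + (x - y) *m A = b + x *m A by rewrite /z mulmxBl; zmod.
  by lra.
exists w; split=> [t|x Dx].
  have : dot w (t - z) <= h t - h z.
    by apply: hw; exists y => //=; rewrite subrr mul0mx addr0 (addrC z) subrK; lra.
  by lra.
have := hw (- ((x - y) *m A)) (psi x - psi y) _; rewrite dotNr => h'.
have : - dot w ((x - y) *m A) <= psi x - psi y.
  by apply: h'; exists x => //=; rewrite subrK; lra.
by lra.
Qed.

End SumRule.

(** * The proximal linear subproblem *)

Lemma cont_comp (R : realType) (U V W : normedModType R) (f : U -> V) (g : V -> W) x :
  {for x, continuous f} -> {for f x, continuous g} -> {for x, continuous (g \o f)}.
Proof. exact: continuous_comp. Qed.

Lemma cont_near (R : realType) (U V : normedModType R) (f : U -> V) (P : V -> Prop) x y :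
  {for x, continuous f} -> f x = y -> (\forall z \near y, P z) -> \forall z \near x, P (f z).
Proof. by move=> cf <- hP; exact: cf. Qed.

Lemma mul_div_succ_le (R : realType) (k e : R) : 0 <= k -> 0 <= e -> k * (e / (k + 1)) <= e.
Proof.
move=> k0 e0; rewrite mulrCA ler_piMr// ler_pdivrMr ?mul1r ?lerDl//.
by rewrite ltr_wpDl.
Qed.

Lemma dot_delta (R : realType) (n : nat) (v : 'rV[R]_n) j : dot v (delta_mx 0 j) = v 0 j.
Proof.
rewrite /dot (bigD1 j)//= big1 => [|i ij]; rewrite !mxE ?eqxx ?mulr1 ?addr0//.
by rewrite (negbTE ij) mulr0.
Qed.

(** * Limits of subgradients tested along curves *)

Section Curves.
Context {R : realType} {n : nat}.
Variables (c : R) (D : set 'rV[R]_n) (f : 'rV[R]_n -> R) (x0 v0 : 'rV[R]_n).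
Hypothesis fc : wcvx c D f.
Hypothesis sub_v : subgradient D f x0 v0.

(** Points of the domain leave [x0] in direction [u] with [f] growing at most at the rate given by
    [v0]. Only this upper estimate is needed to test subgradients, so no equations of a manifold
    appear. *)
Definition curve_along u := forall e, 0 < e -> exists2 T, 0 < T & forall t, 0 < t < T ->
  exists y, [/\ D y, `|y - (x0 + t *: u)| <= e * t & f y <= f x0 + t * dot v0 u + e * t].

Lemma dot_self_le (v : 'rV[R]_n) a : `|v| <= a -> dot v v <= n%:R * a ^+ 2.
Proof.
move=> va; rewrite (le_trans (ler_norm _))// (le_trans (norm_dot _ _))//.
by rewrite -mulrA -expr2 ler_wpM2l// ler_pXn2r ?nnegrE// (le_trans _ va).
Qed.

Lemma dot_le (u v : 'rV[R]_n) a b : `|u| <= a -> `|v| <= b -> dot u v <= n%:R * (a * b).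
Proof.
move=> ua vb; rewrite (le_trans (ler_norm _))// (le_trans (norm_dot _ _))//.
by rewrite -mulrA ler_wpM2l// ler_pM.
Qed.

(** The subgradient inequality at [y] is evaluated at the point of the curve with
    a parameter [t] that is fixed before [y] tends to [x0]. *)
Lemma subgradient_limit u B eps : curve_along u -> 0 < eps -> 0 <= B ->
  \forall y \near x0, forall v, subgradient D f y v -> `|v| <= B -> dot (v - v0) u <= eps.
Proof.
move=> hu eps0 B0.
have fc' : wcvx `|c| D f by apply: wcvx_le fc; exact: ler_norm.
have [c0 u0 v00] : [/\ 0 <= `|c|, 0 <= `|u| & 0 <= `|v0|] by [].
(* The errors below, each a multiple of [e * t], add up to [e * K * t]. *)
pose K := 1 + n%:R * `|v0| + 2 * n%:R * B + `|c| / 2 * n%:R * (1 + (`|u| + 2) ^+ 2).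
have K0 : 0 < K.
  rewrite /K -!addrA ltr_wpDr// !addr_ge0 ?mulr_ge0//; by rewrite ?addr_ge0 ?sqr_ge0.
pose e := Num.min 1 (eps / K).
have e0 : 0 < e by rewrite lt_min ltr01 divr_gt0.
have e1 : e <= 1 by rewrite ge_min lexx.
have eK : e * K <= eps by rewrite -ler_pdivlMr// ge_min lexx orbT.
have [T T0 hT] := hu e e0.
pose t := Num.min T e / 2.
have m0 : 0 < Num.min T e by rewrite lt_min T0.
have t0 : 0 < t by rewrite /t; lra.
have tm : t < Num.min T e by rewrite /t; lra.
move: tm; rewrite lt_min => /andP[tT te].
have [|yt [Dyt hyt fyt]] := hT t; first by rewrite t0.
apply/near_distP; exists (e * t); first exact: mulr_gt0.
move=> y xy v sv vB.
have yx : `|y - x0| <= e * t by rewrite distrC ltW.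
have et0 : 0 < e * t by exact: mulr_gt0.
(* [h1] bounds [dot v (yt - y)] by [f yt - f y] up to curvature; [h2] supplies the lower bound of
   [f y] near [f x0]. *)
have h1 := subgradient_global fc' sv Dyt.
have h2 := subgradient_global fc' sub_v sv.1.
pose rr := (yt - (x0 + t *: u)) - (y - x0).
have rrE : yt - y = t *: u + rr by rewrite /rr; zmod.
have hrr : `|rr| <= 2 * (e * t).
  by rewrite (le_trans (ler_normB _ _))//; lra.
have hyy : `|yt - y| <= t * (`|u| + 2).
  rewrite rrE (le_trans (ler_normD _ _))// normrZ gtr0_norm//.
  have : e * t <= t by rewrite ler_piMl// ltW.
  by lra.
have q1 := dot_self_le hyy.
have q2 := dot_self_le yx.
have q3 : - dot v0 (y - x0) <= n%:R * (`|v0| * (e * t)).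
  by rewrite -dotNl; apply: dot_le => //; rewrite normrN.
have q4 : - dot v rr <= n%:R * (B * (2 * (e * t))).
  by rewrite -dotNl; apply: dot_le => //; rewrite normrN.
have q5 : (t * (`|u| + 2)) ^+ 2 <= e * t * (`|u| + 2) ^+ 2.
  by rewrite exprMn ler_wpM2r ?sqr_ge0// expr2 ler_pM2r// ltW.
have q6 : (e * t) ^+ 2 <= e * t.
  have et1 : e * t <= 1 by apply: mulr_ile1 => //; apply: ltW => //; exact: lt_le_trans te e1.
  by rewrite expr2 ler_piMr// ltW.
have c20 : 0 <= `|c| / 2 by rewrite divr_ge0.
have n0 : 0 <= n%:R :> R by [].
have q7 : `|c| / 2 * dot (yt - y) (yt - y) <= `|c| / 2 * (n%:R * (e * t * (`|u| + 2) ^+ 2)).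
  by rewrite ler_wpM2l// (le_trans q1)// ler_wpM2l.
have q8 : `|c| / 2 * dot (y - x0) (y - x0) <= `|c| / 2 * (n%:R * (e * t)).
  by rewrite ler_wpM2l// (le_trans q2)// ler_wpM2l.
rewrite -(ler_pM2l t0) dotBl mulrBr.
have : dot v (yt - y) = t * dot v u + dot v rr by rewrite rrE dotDr dotZr.
have : t * (e * K) <= t * eps by rewrite ler_pM2l.
have : t * (e * K) = e * t + n%:R * (`|v0| * (e * t)) + n%:R * (B * (2 * (e * t)))
   + `|c| / 2 * (n%:R * (e * t)) + `|c| / 2 * (n%:R * (e * t * (`|u| + 2) ^+ 2)) by rewrite /K; ring.
move: h1 h2 q3 q4 q7 q8 fyt.
set A1 := dot v (yt - y); set A2 := dot (yt - y) _; set A3 := dot v0 (y - x0).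
set A4 := dot (y - x0) _; set A5 := dot v rr; set A6 := dot v u; set A7 := dot v0 u.
set A8 := n%:R * (`|v0| * _); set A9 := n%:R * (B * _); set A10 := `|c| / 2 * (n%:R * (e * t)).
set A11 := `|c| / 2 * (n%:R * (e * t * _)); set A12 := t * (e * K); set A13 := e * t.
clearbody A1 A2 A3 A4 A5 A6 A7 A8 A9 A10 A11 A12 A13.
lra.
Qed.

Variables (q : nat) (G : 'rV[R]_n -> 'rV[R]_q) (J : 'M[R]_(n, q)) (C : 'M[R]_(q, n)).
Variables (fh : 'rV[R]_n -> R) (gf : 'rV[R]_n).
Hypothesis GJ : sdiff G x0 (fun v => v *m J).
Hypothesis CJ : C *m J = 1%:M.
Hypothesis Gx0 : G x0 = 0.
Hypothesis fhg : sdiff fh x0 (dot gf).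
Hypothesis f_fh : \forall y \near x0, G y = 0 -> D y /\ f y = fh y.

(** The subgradient inequality makes [x0] a local minimizer on [G = 0] of [fh] minus [v0] plus a
    quadratic with zero gradient at [x0], so [gradient_ge0] applies to [u] and [- u]. *)
Lemma gradient_on_tangent u : u *m J = 0 -> dot gf u = dot v0 u.
Proof.
have ge w : w *m J = 0 -> 0 <= dot (gf - v0) w.
  pose phi y := fh y - dot v0 (y - x0) + c / 2 * dot (y - x0) (y - x0).
  have sI : sdiff (fun y : 'rV[R]_n => y - x0) x0 id by apply: (@sdiff_shift _ _ _ id); apply: sdiff_id.
  have sphi : sdiff phi x0 (dot (gf - v0)).
    have := sdiffD (sdiffB fhg (@sdiff_comp _ _ _ _ (dot v0) (fun y : 'rV[R]_n => y - x0) x0 _ _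
        (sdiff_lin (x0 - x0) (blin_dot v0)) sI))
      (sdiffZ (c / 2) (sdiff_dot sI sI)).
    by apply: sdiff_eqL => v /=; rewrite subrr dot0r dot0l addr0 scaler0 addr0 dotBl.
  apply: (gradient_ge0 sphi GJ CJ Gx0).
  have [_ fx0] := nbhs_singleton f_fh Gx0.
  apply: nearS f_fh => y hy /hy [Dy fy].
  have := subgradient_global fc sub_v Dy.
  by rewrite /phi subrr !dot0r mulr0 subr0 addr0 -fx0 -fy; lra.
move=> uJ; have h1 := ge u uJ; have : 0 <= dot (gf - v0) (- u) by apply: ge; rewrite mulNmx uJ oppr0.
by move: h1; rewrite dotNr dotBl; lra.
Qed.

Lemma tangent_curve u : u *m J = 0 -> curve_along u.
Proof.
move=> uJ e e0; have gu := gradient_on_tangent uJ.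
pose K := n%:R * `|gf| + `|u| + 2.
have K0 : 0 < K by rewrite ltr_wpDl// addr_ge0// mulr_ge0.
have [_ fx0] := nbhs_singleton f_fh Gx0.
pose e1 := Num.min (Num.min 1 e) (e / K).
have e10 : 0 < e1 by rewrite !lt_min ltr01 e0 divr_gt0.
have e1e : e1 <= e by rewrite !ge_min lexx orbT.
have e11 : e1 <= 1 by rewrite !ge_min lexx.
have e1K : e1 * K <= e by rewrite -ler_pdivlMr// ge_min lexx orbT.
have [_ /(_ _ e10) [d1 d10 hd1]] := (sdiffP _ _ _).1 fhg.
have [d2 d20 hd2] := (near_distP _ _).1 f_fh.
have [T T0 hT] := ljusternik GJ CJ Gx0 uJ e10.
have u10 : 0 < `|u| + 2 by rewrite ltr_wpDl.
exists (Num.min T (Num.min d1 d2 / (`|u| + 2))).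
  by rewrite lt_min T0 divr_gt0// lt_min d10.
move=> t /andP[t0]; rewrite lt_min => /andP[tT]; rewrite ltr_pdivlMr// => td.
have [|y Gy hy] := hT t; first by rewrite t0.
have yE : y - x0 = t *: u + (y - (x0 + t *: u)) by zmod.
have yx : `|y - x0| <= t * (`|u| + 1).
  rewrite yE (le_trans (ler_normD _ _))// normrZ gtr0_norm//.
  have : e1 * t <= t by rewrite ler_piMl// ltW.
  by lra.
have yd : `|x0 - y| < Num.min d1 d2.
  by rewrite distrC (le_lt_trans yx)// (le_lt_trans _ td)// ler_pM2l//; lra.
move: yd; rewrite lt_min => /andP[yd1 yd2].
have [Dy fy] := hd2 y yd2 Gy.
exists y; split=> //; first by rewrite (le_trans hy)// ler_pM2r.
have := hd1 y x0 yd1; rewrite subrr normr0 => /(_ d10).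
rewrite ler_distl => /andP[_].
rewrite fy fx0 yE dotDr dotZr gu -yE => h1.
have h2 := dot_le (lexx `|gf|) hy.
have h3 : e1 * `|y - x0| <= e1 * (t * (`|u| + 1)) by rewrite ler_pM2l.
have : e1 * K * t <= e * t by rewrite ler_pM2r.
have : e1 * K * t = n%:R * (`|gf| * (e1 * t)) + e1 * (t * (`|u| + 1)) + e1 * t by rewrite /K; ring.
have : 0 < e1 * t by exact: mulr_gt0.
by lra.
Qed.

End Curves.

(** * Existence, continuity and multipliers of the subproblem *)

Section ProxLinear.
Context {R : realType} {d m : nat}.
Variables (F : 'rV[R]_d -> 'rV[R]_m) (JF : 'rV[R]_d -> 'M[R]_(d, m)) (h : 'rV[R]_m -> R).
Variables (D : set 'rV[R]_d) (r : 'rV[R]_d -> R) (rho mu : R).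
Variables (x0 v0 : 'rV[R]_d) (w0 : 'rV[R]_m).
Hypothesis hc : wcvx 0 setT h.
Hypothesis rc : wcvx rho D r.
Hypothesis r_closed : closed [set p : 'rV[R]_d * R | D p.1 /\ r p.1 <= p.2].
Hypothesis sub_w : subgradient setT h (F x0) w0.
Hypothesis sub_v : subgradient D r x0 v0.
Hypothesis opt : w0 *m (JF x0)^T + v0 = 0.
Hypothesis mu0 : 0 < mu.
Hypothesis rho_mu : rho < mu^-1.

Definition proxlin x y := h (F x + (y - x) *m JF x) + r y + (2 * mu)^-1 * dot (y - x) (y - x).

(** Modulus of strong convexity: [mu^-1] from the proximal term, less the weak convexity of [r]. *)
Let c := mu^-1 - rho.

Lemma c_gt0 : 0 < c.
Proof. by rewrite subr_gt0. Qed.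

Lemma proxlin_wcvx x : wcvx (- c) D (proxlin x).
Proof.
have cD : forall t y z, 0 <= t <= 1 -> D y -> D z -> D (t *: y + (1 - t) *: z).
  by move=> t y z t01 Dy Dz; have [] := rc t01 Dy Dz.
have h1 : wcvx 0 D (fun y => h (F x + (y - x) *m JF x)).
  have := wcvxS (wcvx_affine (JF x) (F x - x *m JF x) hc) cD (fun _ _ => I).
  congr wcvx; apply/funext => y; congr h.
  by rewrite mulmxBl; zmod.
have h2 := wcvxS (wcvx_quad (2 * mu)^-1 x) cD (fun _ _ => I).
have := wcvxD (wcvxD h1 rc) h2; congr wcvx.
by rewrite /c; field; rewrite gt_eqF.
Qed.

(** Adding the subgradient inequalities of [h] at [F x0] and of [r] at [x0], and expanding the
    proximal term about [x0], leaves [a x] as coefficient of [y - x0] and [b x] free of [y]. Both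
    vanish at [x0], the former by [opt]. *)
Let a x := w0 *m (JF x)^T + v0 - mu^-1 *: (x - x0).
Let b x := dot w0 (F x - F x0 - (x - x0) *m JF x) + (2 * mu)^-1 * dot (x - x0) (x - x0).

Lemma proxlin_lower x y : D y ->
  h (F x0) + r x0 + dot (a x) (y - x0) + b x + c / 2 * dot (y - x0) (y - x0) <= proxlin x y.
Proof.
move=> Dy.
have h1 := subgradient_global hc sub_w (I : setT (F x + (y - x) *m JF x)).
have h2 := subgradient_global rc sub_v Dy.
move: h1 h2; rewrite !mul0r subr0 /proxlin /a /b /c.
have -> : y - x = (y - x0) - (x - x0) by zmod.
set s := x - x0; set e := y - x0.
have -> : F x + (e - s) *m JF x - F x0 = (F x - F x0 - s *m JF x) + e *m JF x.
  by rewrite mulmxBl; zmod.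
set z := F x - F x0 - _.
clearbody z e s.
rewrite dotDr [dot (_ - _) (_ - _)]dotDl !dotDr !dotNl !dotNr.
rewrite [dot (_ + _ - _) e]dotDl dotDl dotNl dotZl dot_mulmx trmxK (dotC e s).
set A := h _; set B := dot w0 (e *m _); set C := dot w0 z; set E := dot e e.
set G := dot s s; set P := dot s e; set Q := dot v0 e.
have -> : (2 * mu)^-1 = mu^-1 / 2 by rewrite invfM mulrC.
by lra.
Qed.

Lemma ab0 : a x0 = 0 /\ b x0 = 0.
Proof.
rewrite /a /b opt !subrr mul0mx subr0 !dot0r mulr0 addr0 scaler0 subr0; by [].
Qed.

Lemma norm_quad_ge (n : nat) (e k : R) (u v : 'rV[R]_n) : 0 < e -> n%:R * `|u| <= k ->
  e / 2 * `|v| ^+ 2 - k * `|v| <= dot u v + e / 2 * dot v v.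
Proof.
move=> e0 uk; have := norm_dot u v; rewrite ler_norml => /andP[h1 _].
have h2 := norm_le_dot v.
have h3 : n%:R * `|u| * `|v| <= k * `|v| by rewrite ler_wpM2r.
have : e / 2 * `|v| ^+ 2 <= e / 2 * dot v v by rewrite ler_wpM2l//; lra.
by lra.
Qed.

Lemma proxlin_bounded x : exists B, forall y, D y -> B <= proxlin x y.
Proof.
exists (h (F x0) + r x0 + b x - (d%:R * `|a x|) ^+ 2 / (2 * c)) => y Dy.
apply: le_trans (proxlin_lower x Dy).
have := norm_quad_ge (y - x0) c_gt0 (lexx (d%:R * `|a x|)).
set k := _ * `|a x|; set t := `|y - x0|; have cgt0 := c_gt0.
have : - (k ^+ 2 / (2 * c)) <= c / 2 * t ^+ 2 - k * t.
  rewrite -subr_ge0 (_ : _ - _ = (c * t - k) ^+ 2 / (2 * c)); last by field; rewrite gt_eqF.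
  by rewrite divr_ge0 ?sqr_ge0//; lra.
by lra.
Qed.

Lemma proxlin_rest_cont x : continuous (fun y : 'rV[R]_d =>
  h (F x + (y - x) *m JF x) + (2 * mu)^-1 * dot (y - x) (y - x)).
Proof.
move=> y.
have sI : sdiff (fun z : 'rV[R]_d => z - x) y id by apply: (@sdiff_shift _ _ _ id); apply: sdiff_id.
have c1 := sdiff_cvg (sdiffZ (2 * mu)^-1 (sdiff_dot sI sI)).
have sA := sdiffD (sdiff_cst (F x) y) (@sdiff_comp _ _ _ _ (fun v => v *m JF x)
  (fun z : 'rV[R]_d => z - x) y _ _ (sdiff_lin (y - x) (blin_mulmxr 1 (JF x))) sI).
have c2 := sdiff_cvg sA.
have c3 : {for y, continuous (h \o (fun z => F x + (z - x) *m JF x))}.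
  by apply: (@cont_comp _ _ _ _ (fun z : 'rV[R]_d => F x + (z - x) *m JF x) h y c2); apply: cvx_continuous.
exact: (cvgD c3 c1).
Qed.

(** Strong convexity makes a minimizing sequence Cauchy, and closedness of the epigraph of [r] puts
    its limit in the domain with the right value. *)
Lemma proxlin_argmin_exists x : exists y, D y /\ forall z, D z -> proxlin x y <= proxlin x z.
Proof.
have [B hB] := proxlin_bounded x.
pose V := [set proxlin x y | y in D].
have hi : has_inf V.
  split; first by exists (proxlin x x0), x0 => //; exact: sub_v.1.
  by exists B => _ [y Dy <-]; exact: hB.
pose i := inf V.
have inf_le y : D y -> i <= proxlin x y by move=> Dy; apply: ge_inf; [exact: hi.2|exists y].
have ex n : exists y, D y /\ proxlin x y <= i + n.+1%:R^-1.
  have [|_ [y Dy <-] hy] := @inf_adherent _ V n.+1%:R^-1 _ hi; first by rewrite invr_gt0.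
  by exists y; split=> //; exact: ltW.
have [y hy] := choice ex.
have cgt0 := c_gt0.
(* The value at the midpoint of [y p] and [y q] is at least [i], and strong convexity turns this
   into a distance bound. *)
have dist p q : c / 8 * `|y p - y q| ^+ 2 <= (p.+1%:R^-1 + q.+1%:R^-1) / 2.
  have [[Dp hp] [Dq hq]] := (hy p, hy q).
  have t01 : 0 <= (2^-1 : R) <= 1 by apply/andP; split; lra.
  have [Dz hz] := proxlin_wcvx x t01 Dp Dq.
  have := inf_le _ Dz; have h2 := norm_le_dot (y p - y q).
  have : c / 8 * `|y p - y q| ^+ 2 <= c / 8 * dot (y p - y q) (y p - y q) by rewrite ler_wpM2l//; lra.
  move: hp hq hz; set ep := p.+1%:R^-1; set eq := q.+1%:R^-1.
  set P := proxlin x (y p); set Q := proxlin x (y q); set M := proxlin x _.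
  set N := `|_| ^+ 2; set T := dot _ _; clearbody P Q M ep eq N T i; lra.
have cy : cvgn y.
  apply/cauchy_cvgP/cauchy_ballP => e e0; near_simpl.
  have ce : 0 < c / 8 * e ^+ 2 by rewrite mulr_gt0 ?exprn_gt0//; lra.
  have hn : \forall n \near \oo, n.+1%:R^-1 < c / 8 * e ^+ 2.
    exact: (near_infty_natSinv_lt (PosNum ce)).
  near=> p q; rewrite -ball_normE /=.
  have h1 : p.+1%:R^-1 < c / 8 * e ^+ 2 by near: p.
  have h2 : q.+1%:R^-1 < c / 8 * e ^+ 2 by near: q.
  have c8 : 0 < c / 8 by lra.
  rewrite -(@ltr_pXn2r _ 2)// ?nnegrE ?(ltW e0)// -(ltr_pM2l c8).
  move: h1 h2 (dist p q); set u := p.+1%:R^-1; set v := q.+1%:R^-1; clearbody u v; lra.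
pose l := limn y.
(* All but [r] is continuous, so moving it to the other side gives a convergent sequence of points
   in the epigraph of [r]. *)
have [Dl rl] : D l /\ r l <= i - (h (F x + (l - x) *m JF x) + (2 * mu)^-1 * dot (l - x) (l - x)).
  pose k := fun y : 'rV[R]_d => h (F x + (y - x) *m JF x) + (2 * mu)^-1 * dot (y - x) (y - x).
  have ck : k (y n) @[n --> \oo] --> k l by apply: (cvg_comp y k cy); exact: proxlin_rest_cont.
  have ci : i + n.+1%:R^-1 - k (y n) @[n --> \oo] --> i - k l.
    apply: cvgB => //; rewrite -[X in _ --> X]addr0.
    by apply: cvgD; [exact: cvg_cst|exact: cvg_harmonic].
  have cp : (y n, i + n.+1%:R^-1 - k (y n)) @[n --> \oo] --> (l, i - k l).
    exact: cvg_pair cy ci.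
  apply: (@closed_cvg _ _ _ _ (fun n => (y n, i + n.+1%:R^-1 - k (y n))) _ r_closed _ _ cp).
  apply: nearW => n /=.
  have [Dn hn] := hy n; split=> //.
  by move: hn; rewrite /proxlin /k; set u := n.+1%:R^-1; clearbody u; lra.
exists l; split=> // z Dz; rewrite (le_trans _ (inf_le z Dz))//.
by move: rl; rewrite /proxlin; lra.
Unshelve. all: by end_near. Qed.

Section ArgminMap.
Variable S : 'rV[R]_d -> 'rV[R]_d.
Hypothesis S_argmin : forall x, D (S x) /\ forall z, D z -> proxlin x (S x) <= proxlin x z.

Lemma argmin_growth x z : D z -> proxlin x (S x) + c / 2 * dot (z - S x) (z - S x) <= proxlin x z.
Proof.
have [DS hS] := S_argmin x.
exact: wcvx_min_growth (proxlin_wcvx x) DS hS z.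
Qed.

Lemma argmin_unique x y : D y -> (forall z, D z -> proxlin x y <= proxlin x z) -> y = S x.
Proof.
move=> Dy hy; apply: subr0_eq; apply: dot_eq0; apply/eqP.
rewrite eq_le dot_ge0 andbT; have := argmin_growth x Dy; have := hy _ (S_argmin x).1.
have c20 : 0 < c / 2 by rewrite divr_gt0// c_gt0.
move=> h1 h2; have : c / 2 * dot (y - S x) (y - S x) <= c / 2 * 0 by rewrite mulr0; lra.
by rewrite ler_pM2l.
Qed.

Lemma argmin_center : S x0 = x0.
Proof.
apply/esym/argmin_unique; first exact: sub_v.1.
move=> z Dz; have := proxlin_lower x0 Dz.
rewrite ab0.1 ab0.2 dot0l !addr0 {2}/proxlin => h1.
rewrite {1}/proxlin subrr mul0mx dot0r mulr0 !addr0.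
apply: le_trans h1; rewrite lerDl mulr_ge0 ?dot_ge0//.
by rewrite divr_ge0// ltW// c_gt0.
Qed.

Variables (LF : 'rV[R]_d -> 'rV[R]_m) (LJ : 'rV[R]_d -> 'M[R]_(d, m)).
Hypothesis sF : sdiff F x0 LF.
Hypothesis sJF : sdiff JF x0 LJ.

(** The gap at [y = x0] between [proxlin x y] and the lower bound of [proxlin_lower]. *)
Let ex x := h (F x + (x0 - x) *m JF x) + (2 * mu)^-1 * dot (x0 - x) (x0 - x) - h (F x0) - b x.

Lemma sdiff_sub_l : sdiff (fun x : 'rV[R]_d => x - x0) x0 id.
Proof. by apply: (@sdiff_shift _ _ _ id); apply: sdiff_id. Qed.

Lemma sdiff_sub_r : sdiff (fun x : 'rV[R]_d => x0 - x) x0 (fun v => - v).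
Proof.
have := sdiffN sdiff_sub_l; under eq_fun do rewrite opprB.
by [].
Qed.

Lemma a_cont : {for x0, continuous a}.
Proof.
have sT := sdiff_comp (sdiff_lin (JF x0) (blin_trmx d m)) sJF.
exact: sdiff_cvg (sdiffB (sdiffD (sdiff_mulmx (sdiff_cst w0 x0) sT) (sdiff_cst v0 x0))
  (sdiffZ mu^-1 sdiff_sub_l)).
Qed.

Lemma b_cont : {for x0, continuous b}.
Proof.
have s1 := sdiffB (sdiffB sF (sdiff_cst (F x0) x0)) (sdiff_mulmx sdiff_sub_l sJF).
exact: sdiff_cvg (sdiffD (sdiff_dot (sdiff_cst w0 x0) s1)
  (sdiffZ (2 * mu)^-1 (sdiff_dot sdiff_sub_l sdiff_sub_l))).
Qed.

Lemma ex_cont : {for x0, continuous ex}.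
Proof.
have s1 := sdiffD sF (sdiff_mulmx sdiff_sub_r sJF).
have c3 : {for x0, continuous (h \o (fun x => F x + (x0 - x) *m JF x))}.
  apply: (@cont_comp _ _ _ _ (fun x => F x + (x0 - x) *m JF x) h x0 (sdiff_cvg s1)).
  exact: cvx_continuous.
have c1 := sdiff_cvg (sdiffZ (2 * mu)^-1 (sdiff_dot sdiff_sub_r sdiff_sub_r)).
exact: (cvgB (cvgB (cvgD c3 c1) (@cvg_cst _ (h (F x0)) _ (nbhs x0) _)) b_cont).
Qed.

(** With [x0] as competitor, [proxlin_lower] at [S x] gives [c / 2 * t ^+ 2 - d |a x| t <= ex x] for
    [t = |S x - x0|], and both [a] and [ex] tend to zero. *)
Lemma argmin_continuous : {for x0, continuous S}.
Proof.
have cgt0 := c_gt0.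
apply/cont_distP => e e0.
have ce : 0 < c * e / (4 * (d%:R + 1)) by rewrite !divr_gt0 ?mulr_gt0// ltr_wpDl.
have ce2 : 0 < c * e ^+ 2 / 8 by rewrite divr_gt0 ?mulr_gt0 ?exprn_gt0.
have [ax0 bx0] := ab0.
have ex0 : ex x0 = 0.
  by rewrite /ex subrr mul0mx addr0 dot0r mulr0 addr0 subrr bx0 subr0.
apply: nearS2 ((cont_distP _ _).1 a_cont _ ce) ((cont_distP _ _).1 ex_cont _ ce2) => x.
rewrite ax0 ex0 !sub0r !normrN => ha hex; rewrite argmin_center leNgt; apply/negP => he.
have [DS hS] := S_argmin x.
have h1 := proxlin_lower x DS; have := hS x0 sub_v.1.
set y := S x in he h1 *.
have hk : d%:R * `|a x| <= c * e / 4.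
  rewrite (@le_trans _ _ (d%:R * (c * e / (4 * (d%:R + 1)))))//; first by rewrite ler_wpM2l.
  have -> : d%:R * (c * e / (4 * (d%:R + 1))) = c * e / 4 * (d%:R / (d%:R + 1)).
    by field; rewrite gt_eqF// ltr_wpDl.
  apply: ler_piMr; first by rewrite divr_ge0 ?mulr_ge0// ltW.
  by rewrite ler_pdivrMr ?ltr_wpDl//; lra.
have := norm_quad_ge (y - x0) cgt0 hk.
move: hex => /(le_trans (ler_norm _)); rewrite /ex [proxlin x x0]/proxlin.
rewrite distrC in he; move: h1.
set t := `|y - x0| in he *; set A := dot (a x) _; set B := dot _ (y - x0).
set P := proxlin x y; set Q := h (_ + _); set G := dot (x0 - x) _; set H := h (F x0).
clearbody A B P Q G H t; move=> h1 h2 h3 h4.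
have : c / 2 * t ^+ 2 - c * e / 4 * t <= c * e ^+ 2 / 8 by lra.
have : e ^+ 2 < t ^+ 2 by rewrite ltr_pXn2r// nnegrE ltW// (lt_trans e0).
move=> h5 h6.
have h7 : c * (e * t) <= c * t ^+ 2 by rewrite ler_pM2l// expr2 ler_pM2r ?ltW// (lt_trans e0).
have h8 : c * e ^+ 2 < c * t ^+ 2 by rewrite ltr_pM2l.
lra.
Qed.

(** The proximal term is put with [r], where it outweighs the weak convexity, so that [sum_rule]
    applies to convex functions. *)
Lemma argmin_multiplier x : exists w,
  subgradient setT h (F x + (S x - x) *m JF x) w /\
  subgradient D r (S x) (- (w *m (JF x)^T) - mu^-1 *: (S x - x)).
Proof.
have [DS hS] := S_argmin x; set y := S x in DS hS *.
have cD : forall t y z, 0 <= t <= 1 -> D y -> D z -> D (t *: y + (1 - t) *: z).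
  by move=> t y1 z t01 Dy Dz; have [] := rc t01 Dy Dz.
pose psi z := r z + (2 * mu)^-1 * dot (z - x) (z - x).
have psic : wcvx 0 D psi.
  apply: wcvx_le (wcvxD rc (wcvxS (wcvx_quad (2 * mu)^-1 x) cD (fun _ _ => I))).
  rewrite (_ : 2 * _ = mu^-1); last by field; rewrite gt_eqF.
  by have := rho_mu; lra.
have E z : F x - x *m JF x + z *m JF x = F x + (z - x) *m JF x by rewrite mulmxBl; zmod.
have [|w [hw hpsi]] := sum_rule (b := F x - x *m JF x) (A := JF x) hc psic DS.
  by move=> z Dz; rewrite !E; have := hS z Dz; rewrite /proxlin /psi !addrA.
exists w; split.
  apply: (@quad_subgradient _ _ 0) => // z _; rewrite mul0r subr0 -E; exact: hw.
apply: (@quad_subgradient _ _ (2 * mu)^-1) => // z Dz.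
have := hpsi z Dz; rewrite /psi.
have -> : z - x = (z - y) + (y - x) by zmod.
set u := z - y; set v := y - x.
clearbody u v.
rewrite [dot (u + v) _]dotDl !dotDr dotBl dotNl dotZl dot_mulmx trmxK (dotC u v).
have -> : (2 * mu)^-1 = mu^-1 / 2 by rewrite invfM mulrC.
lra.
Qed.


Let zS x := F x + (S x - x) *m JF x.

Lemma prediction_continuous : {for x0, continuous zS}.
Proof.
pose g (z : 'rV[R]_d * 'rV[R]_d) := F z.1 + (z.2 - z.1) *m JF z.1.
have s1 := sdiff_lin (x0, x0) (blin_fst 'rV[R]_d 'rV[R]_d).
have s2 := sdiff_lin (x0, x0) (blin_snd 'rV[R]_d 'rV[R]_d).
have sg : sdiff g (x0, x0) _ := sdiffD (@sdiff_comp _ _ _ _ F fst (x0, x0) _ _ sF s1)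
  (sdiff_mulmx (sdiffB s2 s1) (@sdiff_comp _ _ _ _ JF fst (x0, x0) _ _ sJF s1)).
apply: (@cont_comp _ _ _ _ (fun x => (x, S x)) g x0).
  exact: cont_pair (@cont_id _ _ x0) argmin_continuous.
by rewrite /= argmin_center; exact: sdiff_cvg sg.
Qed.

Lemma prediction_center : zS x0 = F x0.
Proof. by rewrite /zS argmin_center subrr mul0mx addr0. Qed.

(** A step of length [e / 2] along a coordinate axis, in either direction, changes [h] by at most 2,
    which bounds each coordinate of a subgradient. *)
Lemma subgradient_bounded (z0 : 'rV[R]_m) : exists2 B, 0 <= B & \forall z \near z0, forall w,
  subgradient setT h z w -> `|w| <= B.
Proof.
have [e e0 he] := (near_distP _ _).1 ((cont_distP _ _).1 (cvx_continuous hc (z := z0)) 1 ltr01).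
have e20 : 0 < e / 2 by rewrite divr_gt0.
exists (2 / (e / 2)); first by rewrite divr_ge0// ltW.
apply/near_distP; exists (e / 2) => // z hz w hw.
have hz' : `|z0 - z| < e by rewrite (lt_trans hz)//; lra.
have key s : `|s| <= e / 2 -> dot w s <= 2.
  move=> hs; have := subgradient_global hc hw (I : setT (z + s)).
  have zsE : z + s - z = s by zmod.
  rewrite zsE !mul0r subr0.
  have : `|z0 - (z + s)| < e.
    have -> : z0 - (z + s) = z0 - z - s by zmod.
    by rewrite (le_lt_trans (ler_normB _ _))//; lra.
  move/he; rewrite distrC => /ler_normlW h1.
  have := ler_normlW (he z hz').
  by lra.
apply: mxnorm_le => [|i j]; first by rewrite divr_ge0// ltW.
rewrite ord1 ler_pdivlMr//.
have nd (s : R) : `|s| = 1 -> `|(s * (e / 2)) *: delta_mx 0 j : 'rV[R]_m| <= e / 2.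
  move=> s1; rewrite normrZ normrM s1 mul1r gtr0_norm// ler_piMr//; first exact: ltW.
  by apply: mxnorm_le => // i1 j1; rewrite mxE; case: (_ && _); rewrite ?normr1 ?normr0.
have dw (s : R) : dot w (s *: delta_mx 0 j) = s * w 0 j by rewrite dotZr dot_delta.
have := key _ (nd 1 (normr1 _)); have := key _ (nd (-1) (normrN1 _)); rewrite !dw.
set y := w 0 j; case: (ger0P y) => _; lra.
Qed.

(** The error in the stationarity equation when [JF x] is replaced by [JF x0] and the proximal term
    is dropped; see [residualE]. *)
Let E x (w : 'rV[R]_m) := w *m (JF x0 - JF x)^T - mu^-1 *: (S x - x).

Lemma multiplier_error_small B eps : 0 <= B -> 0 < eps -> \forall x \near x0, forall w,
  `|w| <= B -> `|E x w| <= eps.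
Proof.
move=> B0 eps0; have k0 : 0 < m%:R * B + 1 by rewrite ltr_wpDl// mulr_ge0.
have e10 : 0 < eps / 2 / (m%:R * B + 1) by rewrite !divr_gt0.
have e20 : 0 < eps / 2 * mu by rewrite mulr_gt0// divr_gt0.
have cSx : {for x0, continuous (fun x => S x - x)}.
  exact: cvgB argmin_continuous (@cont_id _ _ x0).
apply: nearS2 ((cont_distP _ _).1 (sdiff_cvg sJF) _ e10) ((cont_distP _ _).1 cSx _ e20) => x hx.
rewrite argmin_center subrr sub0r normrN => hS w wB.
rewrite /E (le_trans (ler_normB _ _))// normrZ gtr0_norm ?invr_gt0//.
have : mu^-1 * `|S x - x| <= eps / 2 by rewrite mulrC ler_pdivrMr.
have : `|w *m (JF x0 - JF x)^T| <= eps / 2.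
  rewrite (le_trans (mulmx_norm _ _))// norm_trmx.
  rewrite (@le_trans _ _ (m%:R * B * (eps / 2 / (m%:R * B + 1))))//.
    by rewrite ler_pM// ?mulr_ge0// ler_wpM2l.
  by apply: mul_div_succ_le; [exact: mulr_ge0|exact/ltW/divr_gt0].
lra.
Qed.

Hypothesis transversal : forall z, exists u s,
  [/\ curve_along D r x0 v0 u, curve_along D r x0 v0 (- u),
     curve_along setT h (F x0) w0 s & z = u *m JF x0 + s].

Let is_multiplier x w := subgradient setT h (zS x) w /\
  subgradient D r (S x) (- (w *m (JF x)^T) - mu^-1 *: (S x - x)).

Lemma multiplier_bounded : exists2 B, 0 <= B & \forall x \near x0, forall w,
  is_multiplier x w -> `|w| <= B.
Proof.
have [B B0 hB] := subgradient_bounded (F x0).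
exists B => //.
have : \forall x \near x0, forall w, subgradient setT h (zS x) w -> `|w| <= B.
  exact: (cont_near prediction_continuous prediction_center hB).
by apply: nearS => x hx w [hw _]; apply: hx.
Qed.

Lemma residualE x w :
  - (w *m (JF x)^T) - mu^-1 *: (S x - x) - v0 = E x w - (w - w0) *m (JF x0)^T.
Proof.
have -> : v0 = - (w0 *m (JF x0)^T) by apply/eqP; rewrite -addr_eq0 addrC opt.
rewrite /E [(JF x0 - JF x)^T]linearB /= mulmxBr mulmxBl.
by zmod.
Qed.

(** Write [z = u JF + s]. The [s] part is bounded by [subgradient_limit] for [h]. For the [u] part,
    [residualE] trades [(w - w0) (JF x0)^T] for the subgradient of [r], which [subgradient_limit]
    bounds in direction [- u]. *)
Lemma multiplier_test z eps : 0 < eps -> \forall x \near x0, forall w,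
  is_multiplier x w -> dot (w - w0) z <= eps.
Proof.
move=> eps0; have [B B0 hB] := multiplier_bounded.
have [u [s [hu hu' hs ->]]] := transversal z.
have e3 : 0 < eps / 3 by rewrite divr_gt0.
have e4 : 0 < eps / 3 / (d%:R * `|u| + 1) by rewrite !divr_gt0// ltr_wpDl// mulr_ge0.
have h1 := multiplier_error_small B0 ltr01.
have h2 := multiplier_error_small B0 e4.
pose k := `|v0| + 1 + m%:R * (B + `|w0|) * `|JF x0|.
have k0 : 0 <= k by rewrite /k !addr_ge0// !mulr_ge0// addr_ge0.
have h3 : \forall x \near x0, forall w, subgradient setT h (zS x) w -> `|w| <= B ->
    dot (w - w0) s <= eps / 3.
  exact: (cont_near prediction_continuous prediction_center (subgradient_limit hc sub_w hs e3 B0)).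
have h4 : \forall x \near x0, forall v, subgradient D r (S x) v -> `|v| <= k ->
    dot (v - v0) (- u) <= eps / 3.
  exact: (cont_near argmin_continuous argmin_center (subgradient_limit rc sub_v hu' e3 k0)).
apply: nearS2 (nearI h1 h2) (nearI hB (nearI h3 h4)) => x [q1 q2] [q3 [q4 q5]] w hw.
have wB := q3 w hw; have {}q1 := q1 w wB; have {}q2 := q2 w wB.
have {}q4 := q4 w hw.1 wB.
have wk : `|- (w *m (JF x)^T) - mu^-1 *: (S x - x)| <= k.
  have -> : - (w *m (JF x)^T) - mu^-1 *: (S x - x) = v0 + E x w - (w - w0) *m (JF x0)^T.
    by rewrite -addrA -residualE; zmod.
  rewrite (le_trans (ler_normB _ _))// lerD//.
    by rewrite (le_trans (ler_normD _ _))// lerD.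
  rewrite (le_trans (mulmx_norm _ _))// norm_trmx ler_wpM2r// ler_wpM2l//.
  by rewrite (le_trans (ler_normB _ _))// lerD.
have := q5 _ hw.2 wk; rewrite residualE dotNr (dotBl (E x w)) dot_mulmx trmxK dotDr.
have := norm_dot (E x w) u.
have : d%:R * `|E x w| * `|u| <= eps / 3.
  rewrite mulrAC (@le_trans _ _ (d%:R * `|u| * (eps / 3 / (d%:R * `|u| + 1))))//.
    by rewrite ler_wpM2l// mulr_ge0.
  by apply: mul_div_succ_le; [exact: mulr_ge0|exact: ltW].
move=> t1 /(le_trans (ler_norm _)); move: t1 q4.
set a1 := dot _ s; set a2 := dot (E x w) u; set a3 := dot _ (u *m _); lra.
Qed.

Lemma multipliers_close eps : 0 < eps -> \forall x \near x0, forall w,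
  is_multiplier x w ->
  `|w - w0| <= eps /\ `|- (w *m (JF x)^T) - mu^-1 *: (S x - x) - v0| <= eps.
Proof.
move=> eps0; have [B B0 hB] := multiplier_bounded.
pose K := m%:R * `|JF x0|.
have K0 : 0 <= K by rewrite mulr_ge0.
pose e := Num.min eps (eps / 2 / (K + 1)).
have K1 : 0 < K + 1 by rewrite ltr_wpDl.
have e0 : 0 < e by rewrite lt_min eps0 !divr_gt0.
have e20 : 0 < eps / 2 by rewrite divr_gt0.
have h1 := multiplier_error_small B0 e20.
have h2 : \forall x \near x0, forall j : 'I_m, forall w, is_multiplier x w ->
    dot (w - w0) (delta_mx 0 j) <= e.
  by apply: near_forall => j; exact: multiplier_test.
have h3 : \forall x \near x0, forall j : 'I_m, forall w, is_multiplier x w ->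
    dot (w - w0) (- delta_mx 0 j) <= e.
  by apply: near_forall => j; exact: multiplier_test.
apply: nearS2 (nearI h1 hB) (nearI h2 h3) => x [q1 q2] [q3 q4] w hw.
have we : `|w - w0| <= e.
  apply: mxnorm_le => [|i j]; first exact: ltW.
  rewrite ord1 ler_norml -(dot_delta (w - w0) j).
  by have := q4 j w hw; rewrite dotNr => q5; rewrite (q3 j w hw) andbT lerNl.
split; first by rewrite (le_trans we)// ge_min lexx.
rewrite residualE (le_trans (ler_normB _ _))//.
have := q1 w (q2 w hw).
have : `|(w - w0) *m (JF x0)^T| <= eps / 2.
  rewrite (le_trans (mulmx_norm _ _))// norm_trmx mulrAC -/K.
  have : (K + 1) * e <= eps / 2 by rewrite mulrC -ler_pdivlMr// ge_min lexx orbT.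
  have : K * `|w - w0| <= K * e by rewrite ler_wpM2l.
  lra.
lra.
Qed.

End ArgminMap.

End ProxLinear.

(** * Identification of the active manifolds *)

Section ActiveChart.
Context {R : realType} {n : nat}.
Variables (D : set 'rV[R]_n) (f : 'rV[R]_n -> R) (x0 v0 : 'rV[R]_n).

(** The active manifold is [G = 0], with [fh] a smooth extension of the restriction
    of [f]; the last clause is the positivity of the infimum over the subgradients
    of the tilted function off the manifold. *)
Definition active_chart q (G : 'rV[R]_n -> 'rV[R]_q) (fh : 'rV[R]_n -> R)
    (gf : 'rV[R]_n -> 'rV[R]_n) :=
  [/\ smooth_on 2 setT G, exists C, C *m 'J G x0 = 1%:M,
    \forall y \near x0, sdiff fh y (dot (gf y)) /\ exists L, sdiff gf y L,
    G x0 = 0 /\ \forall y \near x0, G y = 0 -> D y /\ f y = fh y &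
    exists2 e, 0 < e & \forall y \near x0, forall v, subgradient D f y v -> `|v - v0| <= e -> G y = 0].

Lemma smooth_jacobian k (G : 'rV[R]_n -> 'rV[R]_k) (U : set 'rV[R]_n) x :
  open U -> smooth_on 1 U G -> U x -> sdiff G x (fun v => v *m 'J G x).
Proof.
move=> oU sG Ux; apply: sdiff_eqL (smooth_sdiff oU sG Ux) => v.
by rewrite /jacobian mul_rV_lin1.
Qed.

Lemma active_chart_curve c q (G : 'rV[R]_n -> 'rV[R]_q) fh gf u :
  wcvx c D f -> subgradient D f x0 v0 -> active_chart G fh gf ->
  u *m 'J G x0 = 0 -> curve_along D f x0 v0 u.
Proof.
move=> fc sv [sG [C CJ] /nbhs_singleton[s2 _] [Gx0 ffh] _] uJ.
have s1 := smooth_jacobian openT (smooth_weaken sG) (I : setT x0).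
exact: (tangent_curve fc sv s1 CJ Gx0 s2 ffh uJ).
Qed.

End ActiveChart.

Lemma near_slicel (T T' : topologicalType) (P : T * T' -> Prop) (x : T) (y : T') :
  (\forall p \near (x, y), P p) -> \forall z \near y, P (x, z).
Proof.
move=> [[A B] /= [nA nB] AB]; apply: filterS nB => z Bz; apply: AB; split=> //=.
exact: nbhs_singleton nA.
Qed.

(** * The subproblem in charts of the active manifolds *)

Section ActiveProx.
Context {R : realType} {d m qR qH : nat}.
Variables (F : 'rV[R]_d -> 'rV[R]_m) (h : 'rV[R]_m -> R).
Variables (D : set 'rV[R]_d) (r : 'rV[R]_d -> R) (rho mu : R).
Variables (x0 v0 : 'rV[R]_d) (w0 : 'rV[R]_m).
Variables (GR : 'rV[R]_d -> 'rV[R]_qR) (rh : 'rV[R]_d -> R) (gr : 'rV[R]_d -> 'rV[R]_d).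
Variables (GH : 'rV[R]_m -> 'rV[R]_qH) (hh : 'rV[R]_m -> R) (gh : 'rV[R]_m -> 'rV[R]_m).
Hypothesis F_smooth : smooth_on 2 setT F.
Hypothesis hc : wcvx 0 setT h.
Hypothesis rc : wcvx rho D r.
Hypothesis sub_w : subgradient setT h (F x0) w0.
Hypothesis sub_v : subgradient D r x0 v0.
Hypothesis opt : w0 *m ('J F x0)^T + v0 = 0.
Hypothesis mu0 : 0 < mu.
Hypothesis rho_mu : rho < mu^-1.
Hypothesis chartR : active_chart D r x0 v0 GR rh gr.
Hypothesis chartH : active_chart setT h (F x0) w0 GH hh gh.
Hypothesis transversal : forall z : 'rV[R]_m, exists (u : 'rV[R]_d) (s : 'rV[R]_m),
  [/\ u *m 'J GR x0 = 0, s *m 'J GH (F x0) = 0 & z = u *m 'J F x0 + s].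

Let JF x := 'J F x.
Let prox := proxlin F JF h r mu.
Variable S : 'rV[R]_d -> 'rV[R]_d.
Hypothesis S_argmin : forall x, D (S x) /\ forall z, D z -> prox x (S x) <= prox x z.

Let zc (p : 'rV[R]_d * 'rV[R]_d) := F p.1 + (p.2 - p.1) *m JF p.1.
Let G x y := row_mx (GR y) (GH (zc (x, y))).
Let J x y := row_mx ('J GR y) (JF x *m 'J GH (zc (x, y))).
(** A smooth substitute for [prox], with the same values on [G = 0] near the base point
    ([prox_on_chart]). *)
Let phi x y := hh (zc (x, y)) + rh y + (2 * mu)^-1 * dot (y - x) (y - x).
Let g x y := gh (zc (x, y)) *m (JF x)^T + gr y + mu^-1 *: (y - x).

Lemma chart_prediction_sdiff p : exists L, sdiff zc p L.
Proof.
have s1 := sdiff_lin p (blin_fst 'rV[R]_d 'rV[R]_d).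
have s2 := sdiff_lin p (blin_snd 'rV[R]_d 'rV[R]_d).
have sF := smooth_jacobian openT (smooth_weaken F_smooth) (I : setT p.1).
have [LJ sJ] := jacobian_sdiff openT F_smooth (I : setT p.1).
by eexists; exact: (sdiffD (@sdiff_comp _ _ _ _ F fst p _ _ sF s1)
  (sdiff_mulmx (sdiffB s2 s1) (@sdiff_comp _ _ _ _ JF fst p _ _ sJ s1))).
Qed.

Lemma zc0 : zc (x0, x0) = F x0.
Proof. by rewrite /zc /= subrr mul0mx addr0. Qed.

Lemma zc_near (P : 'rV[R]_m -> Prop) :
  (\forall z \near F x0, P z) -> \forall p \near (x0, x0), P (zc p).
Proof.
have [L sz] := chart_prediction_sdiff (x0, x0).
exact: cont_near (sdiff_cvg sz) zc0.
Qed.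

Lemma snd_near (P : 'rV[R]_d -> Prop) :
  (\forall z \near x0, P z) -> \forall p \near (x0, x0), P p.2.
Proof.
have s2 := sdiff_lin (x0, x0) (blin_snd 'rV[R]_d 'rV[R]_d).
exact: (@cont_near _ _ _ snd P (x0, x0) x0 (sdiff_cvg s2)).
Qed.

Lemma near_gradients : \forall p \near (x0, x0),
  [/\ sdiff rh p.2 (dot (gr p.2)), exists L, sdiff gr p.2 L,
    sdiff hh (zc p) (dot (gh (zc p))) & exists L, sdiff gh (zc p) L].
Proof.
have [_ _ nR _ _] := chartR; have [_ _ nH _ _] := chartH.
by apply: nearS2 (snd_near nR) (zc_near nH) => p [? ?] [? ?].
Qed.

Lemma comp_fst V (f : 'rV[R]_d -> V : normedModType R) p L : sdiff f p.1 L ->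
  sdiff (fun z : 'rV[R]_d * 'rV[R]_d => f z.1) p (fun v => L v.1).
Proof.
move=> sf; exact: (@sdiff_comp _ _ _ _ f fst p _ _ sf (sdiff_lin p (blin_fst 'rV[R]_d 'rV[R]_d))).
Qed.

Lemma comp_snd V (f : 'rV[R]_d -> V : normedModType R) p L : sdiff f p.2 L ->
  sdiff (fun z : 'rV[R]_d * 'rV[R]_d => f z.2) p (fun v => L v.2).
Proof.
move=> sf; exact: (@sdiff_comp _ _ _ _ f snd p _ _ sf (sdiff_lin p (blin_snd 'rV[R]_d 'rV[R]_d))).
Qed.

Lemma comp_zc V (f : 'rV[R]_m -> V : normedModType R) p L : sdiff f (zc p) L ->
  exists L', sdiff (fun z : 'rV[R]_d * 'rV[R]_d => f (zc (z.1, z.2))) p L'.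
Proof.
have [Lz sz] := chart_prediction_sdiff p.
move=> sf; eexists; exact: (@sdiff_comp _ _ _ _ f zc p _ _ sf sz).
Qed.

Lemma JF_sdiff p : exists L, sdiff (fun z : 'rV[R]_d * 'rV[R]_d => JF z.1) p L.
Proof.
have [LJ sJ] := jacobian_sdiff openT F_smooth (I : setT p.1).
by eexists; exact: comp_fst sJ.
Qed.

Lemma smooth_g : \forall z \near (x0, x0), exists L, sdiff (fun z => g z.1 z.2) z L.
Proof.
apply: nearS near_gradients => p [_ [L1 s1] _ [L2 s2]].
have [L3 s3] := comp_zc s2; have [L4 s4] := JF_sdiff p.
have s5 := @sdiff_comp _ _ _ _ trmx (fun z : 'rV[R]_d * 'rV[R]_d => JF z.1) p _ _
  (sdiff_lin (JF p.1) (blin_trmx d m)) s4.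
have s6 := sdiffB (comp_snd (sdiff_id p.2)) (comp_fst (sdiff_id p.1)).
by eexists; exact: (sdiffD (sdiffD (sdiff_mulmx s3 s5) (comp_snd s1)) (sdiffZ mu^-1 s6)).
Qed.

Lemma smooth_G : \forall z \near (x0, x0), exists L, sdiff (fun z => G z.1 z.2) z L.
Proof.
have [sR _ _ _ _] := chartR; have [sH _ _ _ _] := chartH.
near=> p.
have s1 := smooth_jacobian openT (smooth_weaken sR) (I : setT p.2).
have s2 := smooth_jacobian openT (smooth_weaken sH) (I : setT (zc p)).
have [L s3] := comp_zc s2.
by eexists; exact: (sdiff_row_mx (comp_snd s1) s3).
Unshelve. all: by end_near. Qed.

Lemma smooth_J : \forall z \near (x0, x0), exists L, sdiff (fun z => J z.1 z.2) z L.
Proof.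
have [sR _ _ _ _] := chartR; have [sH _ _ _ _] := chartH.
near=> p.
have [L1 s1] := jacobian_sdiff openT sR (I : setT p.2).
have [L2 s2] := jacobian_sdiff openT sH (I : setT (zc p)).
have [L3 s3] := comp_zc s2; have [L4 s4] := JF_sdiff p.
by eexists; exact: (sdiff_row_mx (comp_snd s1) (sdiff_mulmx s4 s3)).
Unshelve. all: by end_near. Qed.

Lemma zc_slice p : sdiff (fun y => zc (p.1, y)) p.2 (fun v => v *m JF p.1).
Proof.
have sI : sdiff (fun z : 'rV[R]_d => z - p.1) p.2 id by apply: (@sdiff_shift _ _ _ id); apply: sdiff_id.
have := sdiffD (sdiff_cst (F p.1) p.2) (@sdiff_comp _ _ _ _ (fun v => v *m JF p.1)
  (fun z : 'rV[R]_d => z - p.1) p.2 _ _ (sdiff_lin (p.2 - p.1) (blin_mulmxr 1 (JF p.1))) sI).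
by apply: sdiff_eqL => v /=; rewrite add0r.
Qed.

Lemma grad_phi : \forall z \near (x0, x0), sdiff (phi z.1) z.2 (dot (g z.1 z.2)).
Proof.
apply: nearS near_gradients => -[x y] [s1 _ s2 _].
have s3 := @sdiff_comp _ _ _ _ hh (fun z => zc (x, z)) y _ _ s2 (zc_slice (x, y)).
have sI : sdiff (fun z : 'rV[R]_d => z - x) y id by apply: (@sdiff_shift _ _ _ id); apply: sdiff_id.
have := sdiffD (sdiffD s3 s1) (sdiffZ (2 * mu)^-1 (sdiff_dot sI sI)).
apply: sdiff_eqL => v /=; rewrite /g; set e := y - x; clearbody e.
rewrite !dotDl dot_mulmx trmxK dotZl [dot v _]dotC.
by rewrite /GRing.scale /=; field; rewrite gt_eqF.
Qed.

Lemma jac_G : \forall z \near (x0, x0), sdiff (G z.1) z.2 (fun v => v *m J z.1 z.2).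
Proof.
have [sR _ _ _ _] := chartR; have [sH _ _ _ _] := chartH.
apply: nearS (near_open openT (I : setT (x0, x0))) => -[x y] _ /=.
have s1 := smooth_jacobian openT (smooth_weaken sR) (I : setT y).
have s2 := smooth_jacobian openT (smooth_weaken sH) (I : setT (zc (x, y))).
have s3 := @sdiff_comp _ _ _ _ GH (fun z => zc (x, z)) y _ _ s2 (zc_slice (x, y)).
have := sdiff_row_mx s1 s3; apply: sdiff_eqL => v /=.
by rewrite /J mul_mx_row mulmxA.
Qed.

Lemma zc_diag : (fun y => zc (y, y)) = F.
Proof. by apply/funext => y; rewrite /zc /= subrr mul0mx addr0. Qed.

Lemma diag_phi : \forall y \near x0, sdiff (fun y => phi y y) y (dot (g y y)).
Proof.
apply: nearS (near_diag near_gradients) => y [s1 _ s2 _].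
have zy : zc (y, y) = F y by rewrite -zc_diag.
rewrite /= in s1; rewrite zy in s2.
have sF := smooth_jacobian openT (smooth_weaken F_smooth) (I : setT y).
have := sdiffD (@sdiff_comp _ _ _ _ hh F y _ _ s2 sF) s1.
rewrite (_ : (fun z => (hh \o F) z + rh z) = (fun y => phi y y)); last first.
  apply/funext => z /=; rewrite /phi subrr dot0r mulr0 addr0.
  by rewrite -[F z]/(F z) -[in LHS]zc_diag.
apply: sdiff_eqL => v /=; rewrite /g zy subrr scaler0 addr0 dotDl dot_mulmx trmxK.
by [].
Qed.

Lemma diag_G : \forall y \near x0, sdiff (fun y => G y y) y (fun v => v *m J y y).
Proof.
have [sR _ _ _ _] := chartR; have [sH _ _ _ _] := chartH.
apply: nearS (near_open openT (I : setT x0)) => y _.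
have s1 := smooth_jacobian openT (smooth_weaken sR) (I : setT y).
have s2 := smooth_jacobian openT (smooth_weaken sH) (I : setT (F y)).
have sF := smooth_jacobian openT (smooth_weaken F_smooth) (I : setT y).
have := sdiff_row_mx s1 (@sdiff_comp _ _ _ _ GH F y _ _ s2 sF).
have zE z : zc (z, z) = F z by rewrite -zc_diag.
rewrite (_ : (fun y => row_mx (GR y) ((GH \o F) y)) = (fun y => G y y)).
  by apply: sdiff_eqL => v /=; rewrite /J zE mul_mx_row mulmxA.
by apply/funext => z; rewrite /G zE.
Qed.

(** Full column rank is checked on a column [a] with [J a = 0]. Multiplying by the tangent vector
    [u] of a decomposition [z = u JF + s] shows that every [z] annihilates ['J GH (F x0) *m aH]; the
    two blocks of [a] then vanish by the ranks of the separate charts. *)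
Lemma constraint_qualification : exists C, C *m J x0 x0 = 1%:M.
Proof.
have [_ [CR CRJ] _ _ _] := chartR; have [_ [CH CHJ] _ _ _] := chartH.
suff ker (a : 'cV[R]_(qR + qH)) : J x0 x0 *m a = 0 -> a = 0.
  exists (pinvmx (J x0 x0)); apply: mulVpmx.
  have : row_free (J x0 x0)^T.
    rewrite -kermx_eq0; apply/eqP/row_matrixP => i; rewrite row0.
    apply: trmx_inj; rewrite trmx0; apply: ker; apply: trmx_inj.
    by rewrite trmx_mul trmxK -row_mul mulmx_ker row0 trmx0.
  by rewrite /row_full /row_free mxrank_tr.
rewrite /J zc0 -(vsubmxK a) mul_row_col => e.
set aR := usubmx a in e *; set aH := dsubmx a in e *.
have t0 : 'J GH (F x0) *m aH = 0.
  suff z0 (z : 'rV[R]_m) : z *m ('J GH (F x0) *m aH) = 0.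
    by apply/row_matrixP => i; rewrite rowE z0 row0.
  have [u [s [uJ sJ ->]]] := transversal z.
  have := congr1 (mulmx u) e; rewrite mulmxDr mulmx0 !mulmxA uJ mul0mx add0r => e'.
  by rewrite !mulmxDl sJ mul0mx addr0.
have aH0 : aH = 0 by rewrite -(mul1mx aH) -CHJ -mulmxA t0 mulmx0.
have aR0 : aR = 0.
  by move: e; rewrite aH0 mulmx0 addr0 => e; rewrite -(mul1mx aR) -CRJ -mulmxA e mulmx0.
by rewrite aR0 aH0 col_mx0.
Qed.

Let LFx := fun v : 'rV[R]_d => v *m 'J F x0.
Let sF0 : sdiff F x0 LFx.
Proof. exact: smooth_jacobian openT (smooth_weaken F_smooth) I. Qed.

Lemma prox_center : S x0 = x0.
Proof. exact: (argmin_center hc rc sub_w sub_v opt mu0 rho_mu S_argmin). Qed.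

Lemma prox_continuous : {for x0, continuous S}.
Proof.
have [LJ sJ] := jacobian_sdiff openT F_smooth (I : setT x0).
exact: (argmin_continuous hc rc sub_w sub_v opt mu0 rho_mu S_argmin sF0 sJ).
Qed.

Lemma prox_identifies : \forall x \near x0, G x (S x) = 0.
Proof.
have [LJ sJ] := jacobian_sdiff openT F_smooth (I : setT x0).
have [_ _ _ _ [e1 e10 h1]] := chartR; have [_ _ _ _ [e2 e20 h2]] := chartH.
pose e := Num.min e1 e2.
have e0 : 0 < e by rewrite lt_min e10.
have hcl := multipliers_close hc rc sub_w sub_v opt mu0 rho_mu S_argmin sF0 sJ _ e0.
have {}h1 := cont_near prox_continuous prox_center h1.
have {}h2 := cont_near (prediction_continuous hc rc sub_w sub_v opt mu0 rho_mu S_argmin sF0 sJ)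
  (prediction_center hc rc sub_w sub_v opt mu0 rho_mu S_argmin) h2.
have tr : forall z, exists u s, [/\ curve_along D r x0 v0 u, curve_along D r x0 v0 (- u),
     curve_along setT h (F x0) w0 s & z = u *m JF x0 + s].
  move=> z; have [u [s [uJ sH ->]]] := transversal z; exists u, s; split=> //.
  - exact: active_chart_curve rc sub_v chartR uJ.
  - by apply: active_chart_curve rc sub_v chartR _; rewrite mulNmx uJ oppr0.
  - exact: active_chart_curve hc sub_w chartH sH.
apply: nearS2 (hcl tr) (nearI h1 h2) => x q1 [q2 q3].
have [w [hw hv]] := argmin_multiplier hc rc mu0 rho_mu S_argmin x.
have [c1 c2] := q1 w (conj hw hv).
rewrite /G (q2 _ hv) ?(q3 _ hw) ?row_mx0//.
- by rewrite (le_trans c1)// ge_min lexx orbT.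
- by rewrite (le_trans c2)// ge_min lexx.
Qed.

Lemma prox_on_chart : \forall p \near (x0, x0), G p.1 p.2 = 0 ->
  D p.2 /\ prox p.1 p.2 = phi p.1 p.2.
Proof.
have [_ _ _ [_ h1] _] := chartR; have [_ _ _ [_ h2] _] := chartH.
apply: nearS2 (snd_near h1) (zc_near h2) => -[x y] /= q1 q2.
rewrite /G -row_mx0 => /eq_row_mx [/q1 [Dy ry] /q2 [_ hy]]; split=> //.
by rewrite /prox /proxlin /phi -ry -hy.
Qed.

Lemma prox_minimizes : \forall x \near x0, \forall y \near S x, G x y = 0 ->
  phi x (S x) <= phi x y.
Proof.
have h1 := near_pairS prox_center prox_continuous (near_near prox_on_chart).
apply: nearS2 h1 prox_identifies => x q1 q2.
have [_ e1] := nbhs_singleton q1 q2.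
apply: nearS (near_slicel q1) => y /= q3 /q3 [Dy e2].
by rewrite -e1 -e2; exact: (S_argmin x).2.
Qed.

Lemma prox_growth : \forall y \near x0, G x0 y = 0 ->
  phi x0 x0 + (mu^-1 - rho) / 2 * dot (y - x0) (y - x0) <= phi x0 y.
Proof.
have Gx0 : G x0 x0 = 0 by have := nbhs_singleton prox_identifies; rewrite prox_center.
have [_ e1] := nbhs_singleton prox_on_chart Gx0.
apply: nearS (near_slicel prox_on_chart) => y /= q3 /q3 [Dy e2].
have := argmin_growth hc rc mu0 S_argmin x0 Dy.
by rewrite prox_center -/prox e2 -[prox x0 x0]/(prox (x0, x0).1 (x0, x0).2) e1.
Qed.

Lemma prox_sdiff : \forall x \near x0, exists M, sdiff S x M.
Proof.
have [C CJ] := constraint_qualification.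
have c0 : 0 < (mu^-1 - rho) / 2 by rewrite divr_gt0// subr_gt0.
have X := solution_sdiff smooth_g smooth_G smooth_J grad_phi jac_G CJ prox_center prox_continuous
  prox_identifies prox_minimizes c0 prox_growth.
exact: X.
Qed.

Lemma prox_eigenvalue u a M : sdiff S x0 M -> a < 0 ->
  u *m 'J GR x0 = 0 -> u *m 'J F x0 *m 'J GH (F x0) = 0 ->
  (forall e, 0 < e -> exists t, [/\ 0 < t, t < e & exists y,
    [/\ `|y - (x0 + t *: u)| <= e * t, GR y = 0, GH (F y) = 0 &
      h (F y) + r y - (h (F x0) + r x0) <= a * t ^+ 2]]) ->
  exists2 k, 1 < k & exists2 v, v != 0 & M v = k *: v.
Proof.
move=> sM a0 uR uH hd.
have [C CJ] := constraint_qualification.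
have c0 : 0 < (mu^-1 - rho) / 2 by rewrite divr_gt0// subr_gt0.
apply: (solution_eigenvalue smooth_g smooth_G smooth_J grad_phi jac_G CJ prox_center prox_continuous
  prox_identifies prox_minimizes diag_phi diag_G c0 prox_growth sM (u := u) (a := a)) => //.
  by rewrite /J zc0 mul_mx_row mulmxA uR uH row_mx0.
(* On the diagonal the model is the objective itself, so descent of the objective is descent of
   [phi y y]. *)
have diagE y : prox y y = h (F y) + r y.
  by rewrite /prox /proxlin subrr mul0mx dot0r mulr0 !addr0.
have Gx0 : G x0 x0 = 0 by have := nbhs_singleton prox_identifies; rewrite prox_center.
have [_ e1] := nbhs_singleton prox_on_chart Gx0.
have [k k0 hk] := (near2_distP _ _).1 prox_on_chart.
move=> e e0; pose e2 := Num.min e (Num.min 1 (k / (`|u| + 2))).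
have u2 : 0 < `|u| + 2 by rewrite ltr_wpDl.
have e20 : 0 < e2 by rewrite !lt_min e0 ltr01 divr_gt0.
have [t [t0 te [y [hy Ry Hy hf]]]] := hd e2 e20.
have e2e : e2 <= e by rewrite ge_min lexx.
have e21 : e2 <= 1 by rewrite !ge_min lexx orbT.
have e2k : e2 <= k / (`|u| + 2) by rewrite !ge_min lexx !orbT.
exists t; split=> //; first exact: lt_le_trans te e2e.
have Gy : G y y = 0 by rewrite /G -[zc (y, y)]/((fun y => zc (y, y)) y) zc_diag Ry Hy row_mx0.
have yx : `|x0 - y| < k.
  have -> : x0 - y = - (t *: u) - (y - (x0 + t *: u)) by zmod.
  rewrite (le_lt_trans (ler_normB _ _))// normrN normrZ gtr0_norm//.
  have : e2 * t <= t by rewrite ler_piMl// ltW.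
  have : t * (`|u| + 2) < k by rewrite -ltr_pdivlMr// (lt_le_trans te).
  lra.
have [_ /= e3] := hk y y yx yx Gy.
exists y; split=> //; first by rewrite (le_trans hy)// ler_pM2r.
by rewrite -e3 -e1 /= !diagE.
Qed.

End ActiveProx.

(** * From extended-valued to real-valued data *)

Section Tangential.
Context {R : realType} {n : nat}.

(** Tangency without reference to equations, since [tangent] may use other local
    equations than those of a chosen chart. *)
Definition tangential (M : set 'rV[R]_n) x u := forall e, 0 < e ->
  exists2 T, 0 < T & forall t, 0 < t < T -> exists2 y, M y & `|y - (x + t *: u)| <= e * t.

Lemma curve_close (x y u : 'rV[R]_n) e t k : 0 < t -> `|y - (x + t *: u)| <= e * t ->
  t * (`|u| + e) < k -> `|x - y| < k.
Proof.
move=> t0 hy; apply: le_lt_trans.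
have -> : x - y = - (t *: u) - (y - (x + t *: u)) by zmod.
by rewrite (le_trans (ler_normB _ _))// normrN normrZ gtr0_norm//; lra.
Qed.

Lemma local_equations_near k M x (G : 'rV[R]_n -> 'rV[R]_(n - k)) :
  local_equations 2 M x G -> \forall y \near x, M y <-> G y = 0.
Proof.
move=> [_ [_ [U [[oU Ux] MU]]]]; apply: nearS (near_open oU Ux) => y Uy.
have := congr1 (fun A : set _ => A y) MU; rewrite /= => E.
split=> [My|Gy]; first by have [] : U y /\ G y = 0 by rewrite -E.
by have [] : (M `&` U) y by rewrite [(_ `&` _) _]E.
Qed.

Lemma local_equations_inverse k M x (G : 'rV[R]_n -> 'rV[R]_(n - k)) :
  local_equations 2 M x G -> exists C, C *m 'J G x = 1%:M.
Proof.
move=> [_ [rG _]]; exists (pinvmx ('J G x)); apply: mulVpmx.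
by rewrite /row_full rG.
Qed.

Lemma tangent_tangential M x u : M x -> tangent 2 M x u -> tangential M x u.
Proof.
move=> Mx [k [G [_ hG Gu]]] e e0.
have [C CJ] := local_equations_inverse hG.
have MG := local_equations_near hG.
have GJ := smooth_jacobian openT (smooth_weaken hG.1) (I : setT x).
have Gx0 : G x = 0 by apply/(nbhs_singleton MG).
have uJ : u *m 'J G x = 0 by rewrite /jacobian mul_rV_lin1.
have [T T0 hT] := ljusternik GJ CJ Gx0 uJ e0.
have [b b0 hb] := (near_distP _ _).1 MG.
have ue : 0 < `|u| + e by rewrite ltr_wpDl.
exists (Num.min T (b / (`|u| + e))); first by rewrite lt_min T0 divr_gt0.
move=> t /andP[t0]; rewrite lt_min => /andP[tT]; rewrite ltr_pdivlMr// => tb.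
have [|y Gy hy] := hT t; first by rewrite t0.
by exists y => //; apply/(hb y (curve_close t0 hy tb)).
Qed.

(** With [tangent_tangential] this carries a tangent vector from the equations that [tangent]
    happens to supply to the kernel of any other map constant on [M], such as the chart's equations
    or [GH \o F]. *)
Lemma tangential_kernel k M x u (H : 'rV[R]_n -> 'rV[R]_k) L : sdiff H x L ->
  (\forall y \near x, M y -> H y = H x) -> tangential M x u -> L u = 0.
Proof.
move=> sH HM hu; apply/eqP; rewrite -normr_eq0 eq_le normr_ge0 andbT.
have [[K K0 hK] hd] := ((sH.1).2, (sdiffP _ _ _).1 sH).
apply/ler_addgt0Pl => e e0; rewrite addr0.
pose k1 := `|u| + 1 + K.
have k10 : 0 < k1 by rewrite /k1; have := normr_ge0 u; lra.
pose e1 := Num.min 1 (e / k1).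
have e10 : 0 < e1 by rewrite lt_min ltr01 divr_gt0.
have e11 : e1 <= 1 by rewrite ge_min lexx.
have e1k : e1 * k1 <= e by rewrite -ler_pdivlMr// ge_min lexx orbT.
have [_ /(_ _ e10) [b b0 hb]] := hd.
have [b' b'0 hb'] := (near_distP _ _).1 HM.
have [T T0 hT] := hu e1 e10.
have ue : 0 < `|u| + e1 by rewrite ltr_wpDl.
pose t := Num.min T (Num.min b b' / (`|u| + e1)) / 2.
have m0 : 0 < Num.min T (Num.min b b' / (`|u| + e1)) by rewrite lt_min T0 divr_gt0// lt_min b0.
have t0 : 0 < t by rewrite divr_gt0.
have tm : t < Num.min T (Num.min b b' / (`|u| + e1)) by rewrite /t; lra.
move: tm; rewrite lt_min => /andP[tT]; rewrite ltr_pdivlMr// => tb.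
have [|y My hy] := hT t; first by rewrite t0.
have := curve_close t0 hy tb; rewrite lt_min => /andP[yb yb'].
have Hy := hb' y yb' My.
have := hb y x yb; rewrite subrr normr0 => /(_ b0).
rewrite Hy subrr sub0r normrN => h1.
pose w := y - (x + t *: u).
have yE : y - x = t *: u + w by rewrite /w; zmod.
have hw := hK w.
have h2 : `|y - x| <= t * (`|u| + e1).
  by rewrite yE (le_trans (ler_normD _ _))// normrZ gtr0_norm//; rewrite -/w in hy; lra.
have h3 : t * `|L u| <= `|L (y - x)| + `|L w|.
  have -> : t * `|L u| = `|L (y - x) - L w|.
    by rewrite yE (blinD sH.1) addrK (blinZ sH.1) normrZ gtr0_norm.
  exact: ler_normB.
have h4 : K * `|w| <= K * (e1 * t) by rewrite ler_wpM2l// ltW.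
have h5 : e1 * `|y - x| <= e1 * (t * (`|u| + e1)) by rewrite ler_pM2l.
have h6 : t * (e1 * (`|u| + e1)) <= t * (e1 * (`|u| + 1)).
  by rewrite ler_pM2l// ler_pM2l// lerD2l.
rewrite -(ler_pM2l t0).
have : t * (e1 * k1) <= t * e by rewrite ler_pM2l.
have -> : t * (e1 * k1) = t * (e1 * (`|u| + 1)) + K * (e1 * t) by rewrite /k1; ring.
rewrite (_ : t * (e1 * (`|u| + e1)) = e1 * (t * (`|u| + e1))) in h6; last by ring.
lra.
Qed.

End Tangential.

(** * Extended-valued functions as a domain and a real part *)

Section Extended.
Context {R : realType} {n : nat}.
Variable phi : 'rV[R]_n -> \bar R.
Hypothesis phi_gtNy : forall x, (-oo < phi x)%E.

Let dom : set 'rV[R]_n := [set x | phi x \is a fin_num].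
Let f x := fine (phi x).

Lemma dom_fine x : dom x -> phi x = (f x)%:E.
Proof. by move=> Dx; rewrite /f fineK. Qed.

Lemma dom_infty x : ~ dom x -> phi x = +oo%E.
Proof. by rewrite /dom /=; have := phi_gtNy x; case: (phi x) => [s| |] //= _; case. Qed.

Lemma weakly_convex_wcvx rho : weakly_convex rho phi -> wcvx rho dom f.
Proof.
move=> hphi t x y t01 Dx Dy; have /= := hphi t x y t01.
rewrite (dom_fine Dx) (dom_fine Dy).
set a := _ * norm2 x ^+ 2; set b := _ * norm2 y ^+ 2.
rewrite -[(_ + a%:E)%E]EFinD -[(_ + b%:E)%E]EFinD -!EFinM -EFinD {}/a {}/b.
set z := t *: x + _; have Dz : dom z \/ phi z = +oo%E.
  by have [|/dom_infty] := pselect (dom z); [left|right].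
case: Dz => [Dz|->]; last by rewrite addye.
rewrite (dom_fine Dz) -EFinD lee_fin !norm2_sqr => hz; split=> //.
move: hz; rewrite /z !dotDl !dotDr !dotNl !dotNr !dotZl !dotZr (dotC y x).
set A := dot x x; set B := dot x y; set E := dot y y.
clearbody A B E => hz; rewrite -subr_ge0; move: hz; rewrite -subr_ge0.
by congr (0 <= _); field.
Qed.

Lemma subdifferentialE x v : subdifferential phi x v <-> subgradient dom f x v.
Proof.
split=> -[Dx h]; split=> // e e0; apply: nearS (h e e0) => y.
  by move=> hy Dy; move: hy; rewrite (dom_fine Dx) (dom_fine Dy) -EFinD lee_fin addrA.
have [Dy /(_ Dy)|/dom_infty -> _] := pselect (dom y); last by rewrite leey.
by rewrite (dom_fine Dx) (dom_fine Dy) -EFinD lee_fin addrA.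
Qed.

Lemma closed_functionE : closed_function phi -> closed [set p : 'rV[R]_n * R | dom p.1 /\ f p.1 <= p.2].
Proof.
rewrite /closed_function; congr closed; apply/funext => -[x s]; apply/propext => /=.
split=> [h|[Dx h]]; last by rewrite (dom_fine Dx) lee_fin.
have [Dx|/dom_infty E] := pselect (dom x); last by move: h; rewrite E.
by split=> //; rewrite -lee_fin -dom_fine.
Qed.

Lemma subgradient_tilt v v' x : subgradient dom f x v' -> subdifferential (tilt phi v) x (v' - v).
Proof.
move=> [Dx h]; split; first by rewrite /tilt (dom_fine Dx) -EFinB.
move=> e e0; apply: nearS (h e e0) => y hy; rewrite /tilt (dom_fine Dx).
have [Dy|/dom_infty ->] := pselect (dom y); last by rewrite addye ?leey.
move: (hy Dy); rewrite (dom_fine Dy) -!EFinB -EFinD lee_fin dotBl [dot v (y - x)]dotBr.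
by lra.
Qed.

Lemma active_manifold_chart k M x v (G : 'rV[R]_n -> 'rV[R]_(n - k)) :
  active_manifold_for 2 phi M x v -> local_equations 2 M x G ->
  exists fh gf, active_chart dom f x v G fh gf.
Proof.
move=> [_ [_ Mx [U [nU _ hr hinf]]]] hG.
have MG := local_equations_near hG.
have Ux := nbhs_singleton nU.
have [V [g [[oV Vx] sg hg]]] := hr x (conj Mx Ux).
(* [g] extends the tilted function, so the linear term is put back. *)
exists (fun y => g y + dot v y), (fun y => grad g y + v); split.
- exact: hG.1.
- exact: local_equations_inverse hG.
- apply: nearS (near_open oV Vx) => y Vy; split.
    have s1 : sdiff g y (dot (grad g y)).
      apply: sdiff_eqL (smooth_sdiff1 oV (smooth_weaken sg) Vy) => u.
      by rewrite dot_grad.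
    have := sdiffD s1 (sdiff_lin y (blin_dot v)).
    by apply: sdiff_eqL => u; rewrite dotDl.
  have [L sL] := grad_sdiff oV sg Vy.
  by eexists; exact: (sdiffD sL (sdiff_cst v y)).
- split; first by apply/(nbhs_singleton MG).
  apply: nearS2 MG (nearI nU (near_open oV Vx)) => y MGy [Uy Vy] /MGy My.
  have := hg y (conj My Uy) Vy; rewrite /tilt.
  have [Dy|/dom_infty ->] := pselect (dom y); last by rewrite addye.
  by rewrite (dom_fine Dy) -EFinB => -[<-]; rewrite subrK.
- have [e0 e00 he0] : exists2 e0 : R, 0 < e0 & forall y v', U y -> ~ M y ->
      subgradient dom f y v' -> e0 <= norm2 (v' - v).
    move: hinf; set A := [set _ | _ in _]; case E : (ereal_inf A) => [s| |] //; last first.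
      (* The infimum is [+oo]: there are no subgradients off the manifold, and any radius will
         do. *)
      move=> _; exists 1 => // y v' Uy nMy /(subgradient_tilt v) sv.
      have : (ereal_inf A <= (norm2 (v' - v))%:E)%E.
        by apply: ereal_inf_lbound; exists (v' - v) => //; exists y.
      by rewrite E.
    rewrite lte_fin => s0; exists s => // y v' Uy nMy /(subgradient_tilt v) sv.
    rewrite -lee_fin -E.
    by apply: ereal_inf_lbound; exists (v' - v) => //; exists y.
  (* The factor [n.+1] passes from the sup norm to the Euclidean norm, and the half makes the
     inequality strict. *)
  exists (e0 / 2 / n.+1%:R); first by rewrite !divr_gt0.
  apply: nearS2 MG nU => y MGy Uy v' sv hv; apply/MGy; apply: contrapT => nMy.
  have := le_trans (he0 y v' Uy nMy sv) (norm2_le _).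
  move: hv; rewrite ler_pdivlMr// mulrC.
  by set b := _ * `|_|; lra.
Qed.

End Extended.

Lemma convex_function_wcvx (R : realType) n (h : 'rV[R]_n -> R) :
  convex_function setT h -> wcvx 0 setT h.
Proof.
move=> ch t x y /andP[t0 t1] _ _; split=> //.
have := ch (Itv01 t0 t1) x y; rewrite !inE => /(_ I I).
by rewrite !mul0r addr0.
Qed.

(** * Charts for the composite problem and descent at a strict saddle *)

Section Composite.
Context {R : realType} {d m : nat}.
Variables (F : 'rV[R]_d -> 'rV[R]_m) (h : 'rV[R]_m -> R) (r : 'rV[R]_d -> \bar R).
Variables (mu : R) (x0 : 'rV[R]_d).
Hypothesis F_smooth : smooth_on 2 setT F.
Hypothesis r_gtNy : forall x, (-oo < r x)%E.

Let dom : set 'rV[R]_d := [set x | r x \is a fin_num].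
Let fr x := fine (r x).
Let JF x := 'J F x.
Let prox := proxlin F JF h fr mu.

Lemma proxlinear_objectiveE x y : dom y -> proxlinear_objective F h r mu x y = (prox x y)%:E.
Proof.
move=> Dy; rewrite /proxlinear_objective (dom_fine Dy) -!EFinD norm2_sqr.
by rewrite /prox /proxlin /JF /jacobian mul_rV_lin1.
Qed.

Lemma proxlinear_objective_infty x y : ~ dom y -> proxlinear_objective F h r mu x y = +oo%E.
Proof. by move=> /(dom_infty r_gtNy) E; rewrite /proxlinear_objective E addey. Qed.

Lemma subdifferential_real y w : subdifferential (EFin \o h) y w <-> subgradient setT h y w.
Proof.
have E : [set x | (EFin \o h) x \is a fin_num] = setT :> set 'rV[R]_m by apply/seteqP; split.
have := @subdifferentialE _ _ (EFin \o h) (fun x => ltNyr (h x)) y w.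
by rewrite E.
Qed.

Lemma composite_active_charts M : composite_active_manifold F h r M x0 ->
  M x0 /\ exists w0 v0 qR qH (GR : 'rV[R]_d -> 'rV[R]_qR) rh gr
    (GH : 'rV[R]_m -> 'rV[R]_qH) hh gh,
  [/\ [/\ subgradient setT h (F x0) w0, subgradient dom fr x0 v0 &
          w0 *m ('J F x0)^T + v0 = 0],
      active_chart dom fr x0 v0 GR rh gr,
      active_chart setT h (F x0) w0 GH hh gh,
      forall z : 'rV[R]_m, exists (u : 'rV[R]_d) (s : 'rV[R]_m),
        [/\ u *m 'J GR x0 = 0, s *m 'J GH (F x0) = 0 & z = u *m 'J F x0 + s] &
      \forall y \near x0, M y -> GR y = 0 /\ GH (F y) = 0].
Proof.
move=> [w0 [v0 [MR [MH [[sw sv opt] [[kR [_ [MRx [GR hR]]]] [kH [_ [MHx [GH hH]]]] tr] aR aH ->]]]]].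
split=> //.
have [rh [gr cR]] := active_manifold_chart r_gtNy aR hR.
have [hh [gh cH]] := active_manifold_chart (fun x => ltNyr (h x)) aH hH.
have E : [set x | (EFin \o h) x \is a fin_num] = setT :> set 'rV[R]_m by apply/seteqP; split.
rewrite E in cH.
have nR := local_equations_near hR; have nH := local_equations_near hH.
have GRx : GR x0 = 0 by apply/(nbhs_singleton nR).
have GHx : GH (F x0) = 0 by apply/(nbhs_singleton nH).
have sF := smooth_jacobian openT (smooth_weaken F_smooth) (I : setT x0).
exists w0, v0, (d - kR)%N, (m - kH)%N, GR, rh, gr, GH, hh, gh; split=> //.
- by split=> //; [exact/subdifferential_real|exact/subdifferentialE].
- move=> z; have [u [s [tu ts ->]]] := tr z; exists u, s; split.
  + have sG := smooth_jacobian openT (smooth_weaken hR.1) (I : setT x0).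
    apply: (tangential_kernel sG _ (tangent_tangential MRx tu)).
    by apply: nearS nR => y Gy /Gy ->; rewrite GRx.
  + have sG := smooth_jacobian openT (smooth_weaken hH.1) (I : setT (F x0)).
    apply: (tangential_kernel sG _ (tangent_tangential MHx ts)).
    by apply: nearS nH => y Gy /Gy ->; rewrite GHx.
  + by rewrite /jacobian mul_rV_lin1.
- by apply: nearS2 nR (cont_near (sdiff_cvg sF) erefl nH) => y Ry Hy [/Ry ? /Hy ?].
Qed.

(** A lower limit [a < 0] lies below [a / 2], so arbitrarily close to the base some quotient is less
    than [a / 2]; its denominator [t ^+ 2 / 2] yields [a / 4]. A finite quotient also places the
    point in [M] and in the domain. *)
Lemma second_order_descent M u a : M x0 -> dom x0 ->
  is_d2 (fun x => composite_objective F h r x + infty_indicator M x)%E x0 u a -> a < 0 ->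
  forall e, 0 < e -> exists t, [/\ 0 < t, t < e & exists y,
    [/\ `|y - (x0 + t *: u)| <= e * t, M y &
        h (F y) + fr y - (h (F x0) + fr x0) <= a / 4 * t ^+ 2]].
Proof.
move=> Mx Dx [w]; rewrite /parabolic_subderivative limf_einfE => ha a0 e e0.
(* The second bound makes the parabolic displacement [t ^+ 2 / 2 *: w'] at most [e * t]. *)
pose T := Num.min e (e / (`|w| + 1)).
have w1 : 0 < `|w| + 1 by rewrite ltr_wpDl.
have T0 : 0 < T by rewrite lt_min e0 divr_gt0.
pose V : set (R * 'rV[R]_d) := [set q | (0 < q.1 /\ q.1 < T) /\ `|w - q.2| < 1].
have nV : filter_prod (0%R : R)^'+ (nbhs w) V.
  exists ([set t : R | 0 < t /\ t < T], [set z | `|w - z| < 1]) => /=.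
    split; last by apply: ((near_distP (fun z => `|w - z| < 1) w).2); exists 1.
    by apply: filterI; [exact: nbhs_right_gt|exact: nbhs_right_lt].
  by move=> q [].
pose fM x := (composite_objective F h r x + infty_indicator M x)%E.
pose f (q : R * 'rV[R]_d) :=
  ((fM (x0 + q.1 *: u + (q.1 ^+ 2 / 2) *: q.2)%R - fM x0) * ((q.1 ^+ 2 / 2)^-1)%:E)%E.
have : (ereal_inf (f @` V) < (a / 2)%:E)%E.
  apply: (@le_lt_trans _ _ a%:E); last by rewrite lte_fin; lra.
  by rewrite -ha; apply: ereal_sup_ubound; exists V.
move=> /ereal_inf_lt [_ [[t w'] [/= [t0 tT] ww'] <-]].
rewrite /f /fM /=; set y := x0 + t *: u + _.
have t20 : 0 < t ^+ 2 / 2 by rewrite divr_gt0// exprn_gt0.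
have E : ~ (dom y /\ M y) ->
    (composite_objective F h r y + infty_indicator M y = +oo)%E.
  move=> nDM; rewrite /composite_objective /infty_indicator.
  case: ifPn => [|_]; last first.
    have [Dy|/(dom_infty r_gtNy) ->] := pselect (dom y); last by rewrite addey.
    by rewrite (dom_fine Dy) -EFinD addey.
  rewrite inE => My.
  have /(dom_infty r_gtNy) -> : ~ dom y by move=> Dy; apply: nDM.
  by rewrite addey// addye.
have obj0 z : M z -> dom z ->
    (composite_objective F h r z + infty_indicator M z = (h (F z) + fr z)%:E)%E.
  move=> Mz Dz; rewrite /composite_objective /infty_indicator mem_set//.
  by rewrite (dom_fine Dz) adde0 EFinD.
rewrite (obj0 _ Mx Dx).
have [[Dy My]|/E ->] := pselect (dom y /\ M y); last first.
  by rewrite addye// gt0_mulye ?lte_fin ?invr_gt0.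
rewrite (obj0 _ My Dy) -EFinB -EFinM lte_fin ltr_pdivrMr// => hf.
exists t; split=> //; first by rewrite (lt_le_trans tT)// ge_min lexx.
exists y; split=> //; last by move: hf; lra.
have -> : y - (x0 + t *: u) = (t ^+ 2 / 2) *: w' by rewrite /y; zmod.
rewrite normrZ gtr0_norm//.
have w'1 : `|w'| <= `|w| + 1.
  have -> : w' = w - (w - w') by zmod.
  by rewrite (le_trans (ler_normB _ _))// lerD2l ltW.
have tw : t * (`|w| + 1) <= e.
  by rewrite -ler_pdivlMr// (le_trans (ltW tT))// ge_min lexx orbT.
have : t ^+ 2 / 2 * `|w'| <= t ^+ 2 / 2 * (`|w| + 1) by rewrite ler_wpM2l// ltW.
have : t * (t * (`|w| + 1)) <= t * e by rewrite ler_pM2l.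
have -> : t ^+ 2 / 2 * (`|w| + 1) = t * (t * (`|w| + 1)) / 2 by ring.
have : 0 < t * e by exact: mulr_gt0.
lra.
Qed.

End Composite.

Theorem theorem5p3 (R : realType) (d m : nat)
    (F : 'rV[R]_d -> 'rV[R]_m) (h : 'rV[R]_m -> R) (r : 'rV[R]_d -> \bar R)
    (rho beta : R) (xbar : 'rV[R]_d) (M : set 'rV[R]_d) (mu : R)
    (F_smooth : smooth_on 2 setT F)
    (h_convex : convex_function setT h)
    (r_gtNy : forall x, (-oo < r x)%E)
    (r_closed : closed_function r)
    (rho_gt0 : 0 < rho)
    (r_weakly_convex : weakly_convex rho r)
    (beta_gt0 : 0 < beta)
    (hF_approx : forall x y : 'rV[R]_d,
      `|h (F y) - h (F x + 'd F x (y - x))| <= beta / 2 * norm2 (y - x) ^+ 2)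
    (xbar_critical : critical (composite_objective F h r) xbar)
    (M_active : composite_active_manifold F h r M xbar)
    (mu_bounds : 0 < mu < rho^-1) :
  exists S : 'rV[R]_d -> 'rV[R]_d,
    [/\ forall x, proxlinear_argmin F h r mu x = [set S x],
        exists2 U, open_nbhs xbar U & smooth_on 1 U S &
        composite_strict_saddle F h r xbar ->
          exists2 a : R, eigenvalue ('J S xbar) a & 1 < a].
Proof.
have /andP[mu0 mu_rho] := mu_bounds.
have rho_mu : rho < mu^-1 by rewrite -[rho]invrK ltf_pV2 ?posrE ?invr_gt0.
pose D : set 'rV[R]_d := [set x | r x \is a fin_num].
pose fr x := fine (r x).
have hc := convex_function_wcvx h_convex.
have rc := weakly_convex_wcvx r_gtNy r_weakly_convex.
have rcl := closed_functionE r_gtNy r_closed.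
have [_ [w0 [v0 [qR [qH [GR [rh [gr [GH [hh [gh [[sw sv opt] cR cH tr _]]]]]]]]]]]] :=
  composite_active_charts F_smooth r_gtNy M_active.
have [S hS] := choice (proxlin_argmin_exists (fun x => 'J F x) hc rc rcl sw sv mu0 rho_mu).
have argminE x : proxlinear_argmin F h r mu x = [set S x].
  have [DS mS] := hS x; apply/seteqP; split=> y /=.
    move=> hy; have Dy : D y.
      apply: contrapT => nDy; have := hy (S x).
      by rewrite (proxlinear_objective_infty _ _ _ r_gtNy)// proxlinear_objectiveE.
    apply: (argmin_unique hc rc mu0 rho_mu hS Dy) => z Dz.
    by have := hy z; rewrite !proxlinear_objectiveE// lee_fin.
  move=> -> z; have [Dz|nDz] := pselect (D z); last first.
    by rewrite [leRHS](proxlinear_objective_infty _ _ _ r_gtNy)// leey.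
  by rewrite !proxlinear_objectiveE// lee_fin; exact: mS.
have nS := prox_sdiff F_smooth hc rc sw sv opt mu0 rho_mu cR cH tr hS.
have [W [oW Wx] hW] : exists2 W, open_nbhs xbar W & forall x, W x -> exists L, sdiff S x L.
  have [b b0 hb] := (near_distP _ _).1 nS.
  exists (ball xbar b); first by split; [exact: ball_open|exact: ballxx].
  by move=> x; rewrite -ball_normE; exact: hb.
(* Outside [W] the zero map is a default that makes [choice] applicable. *)
have ex x : exists L, W x -> sdiff S x L.
  by have [/hW [L sL]|nW] := pselect (W x); [exists L|exists (fun=> 0)].
have [L hL] := choice ex.
exists S; split=> //.
  by exists W => //; exact: sdiff_smooth oW hL.
(* The manifold [M'] of the saddle may differ from [M], but it describes the same [S]. *)
move=> [_ [M' [M'_active [u [a [tu d2 a0]]]]]].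
have [M'x [w1 [v1 [qR1 [qH1 [GR1 [rh1 [gr1 [GH1 [hh1 [gh1 [[sw1 sv1 opt1] cR1 cH1 tr1 nM]]]]]]]]]]]] :=
  composite_active_charts F_smooth r_gtNy M'_active.
have [gR gH] := nbhs_singleton nM M'x.
have tanu := tangent_tangential M'x tu.
have sF := smooth_jacobian openT (smooth_weaken F_smooth) (I : setT xbar).
have [sGR _ _ _ _] := cR1; have [sGH _ _ _ _] := cH1.
have sR := smooth_jacobian openT (smooth_weaken sGR) (I : setT xbar).
have sH := smooth_jacobian openT (smooth_weaken sGH) (I : setT (F xbar)).
have uR : u *m 'J GR1 xbar = 0.
  apply: (tangential_kernel sR _ tanu).
  by apply: nearS nM => y My /My [-> _]; rewrite gR.
have uH : u *m 'J F xbar *m 'J GH1 (F xbar) = 0.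
  apply: (tangential_kernel (@sdiff_comp _ _ _ _ GH1 F xbar _ _ sH sF) _ tanu).
  by apply: nearS nM => y My /My [_ /= ->]; rewrite gH.
have Dx : D xbar := sv.1.
have a40 : a / 4 < 0 by rewrite pmulr_llt0.
have [b b0 hb] := (near_distP _ _).1 nM.
have [|k k1 [v v0' Lv]] := prox_eigenvalue F_smooth hc rc sw1 sv1 opt1 mu0 rho_mu cR1 cH1 tr1 hS
  (hL xbar Wx) a40 uR uH.
  move=> e e0; have ub : 0 < `|u| + 1 by rewrite ltr_wpDl.
  pose e1 := Num.min (Num.min 1 e) (b / (`|u| + 1)).
  have e10 : 0 < e1 by rewrite !lt_min ltr01 e0 divr_gt0.
  have e1e : e1 <= e by rewrite !ge_min lexx orbT.
  have e11 : e1 <= 1 by rewrite !ge_min lexx.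
  have [t [t0 te [y [hy M'y hf]]]] := second_order_descent r_gtNy M'x Dx d2 a0 e10.
  have yb : `|xbar - y| < b.
    apply: (curve_close t0 hy); rewrite (@le_lt_trans _ _ (t * (`|u| + 1)))//.
      by rewrite ler_pM2l// lerD2l.
    by rewrite -ltr_pdivlMr// (lt_le_trans te)// ge_min lexx orbT.
  have [Ry Hy] := hb y yb M'y.
  exists t; split=> //; first exact: lt_le_trans te e1e.
  by exists y; split=> //; rewrite (le_trans hy)// ler_pM2r.
exists k => //; apply/eigenvalueP; exists v => //.
by rewrite /jacobian mul_rV_lin1 (sdiff_diff (hL xbar Wx)).2.
Qed.
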